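(* Let $H: S^{2n-1}\to S^{2m-1}$ be a holomorphically nondegenerate rational map of degree $d$. Then $$\dim\mathfrak{hol}(H)\le \dim\mathfrak{hol}(H^d_n)=\left(\frac{2d+n}{n}\right)K(n,d)^2,$$ and if $H$ is moreover assumed to be polynomial, then $\dim\mathfrak{hol}(H)=\dim\mathfrak{hol}(H^d_n)$ if and only if $H$ is unitarily equivalent to $H^d_n$.
   Context: Let $n\ge 2$, $m\ge 1$, $d\geq 1$. $S^{2n-1}=\{z\in\mathbb C^n:\|z\|=1\}$, and $v\cdot w=\sum_j v_jw_j$ (bilinear, no conjugation). A rational map $H:S^{2n-1}\to S^{2m-1}$ of degree $d$ is $H=P/Q$ in lowest terms with $P=(P_1,\dots,P_m)$ and $Q$ holomorphic polynomials on $\mathbb C^n$, $Q\neq 0$ on $S^{2n-1}$, $H(S^{2n-1})\subset S^{2m-1}$, $d=\max\{\deg P,\deg Q\}$. $K(n,d)=\binom{n+d-1}{d}$, and $H^d_n(z)=\left(\sqrt{d!/\alpha!}\;z^\alpha\right)_{|\alpha|=d}$ (multiindices $\alpha\in\mathbb N^n$ of length $d$ in lexicographic order) is the homogeneous sphere map $S^{2n-1}\to S^{2K(n,d)-1}$. $H$ is holomorphically nondegenerate if there is no map $Y\not\equiv 0$ into $\mathbb C^m$, holomorphic in a neighborhood of $S^{2n-1}$, with $Y\cdot\bar H=0$ on $S^{2n-1}$. $\mathfrak{hol}(H)$, the space of infinitesimal deformations of $H$, is the real vector space of maps $X$ into $\mathbb C^m$, holomorphic in a neighborhood of $S^{2n-1}$,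 with $\operatorname{Re}(X\cdot\bar H)=0$ on $S^{2n-1}$ (maps agreeing on $S^{2n-1}$ are identified); $\dim$ denotes real dimension. $H$ is unitarily equivalent to $H^d_n$ if $m=K(n,d)$ and there are unitary maps $U$ of $\mathbb C^m$ and $W$ of $\mathbb C^n$ with $H=U\circ H^d_n\circ W$. *)

(* Defs.v *)
From HB Require Import structures.
From mathcomp Require Import all_boot all_order all_algebra.
From mathcomp Require Import spectral complex.
From mathcomp Require Import all_classical all_reals all_analysis.
(* The notations of mpoly clash with those of the analysis library. *)
From mathcomp Require Import -(notations) mpoly.

Set Implicit Arguments.
Unset Strict Implicit.
Unset Printing Implicit Defensive.

Import Order.TTheory GRing.Theory Num.Theory.
Import numFieldNormedType.Exports.

Local Open Scope classical_set_scope.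
Local Open Scope ring_scope.
Local Open Scope complex_scope.

(* The norm topology on R[i], as the library does for abstract fields. *)
#[non_forgetful_inheritance]
HB.instance Definition _ (R : rcfType) :=
  PseudoPointedMetric.copy R[i] R[i]^o.
#[non_forgetful_inheritance]
HB.instance Definition _ (R : rcfType) := GRing.ComAlgebra.copy R[i] R[i]^o.
#[non_forgetful_inheritance]
HB.instance Definition _ (R : rcfType) := Vector.copy R[i] R[i]^o.
#[non_forgetful_inheritance]
HB.instance Definition _ (R : rcfType) := NormedModule.copy R[i] R[i]^o.

Section RealDimension.
Context {R : realType} {E : lmodType R[i]}.

Definition real_basis (V : set E) (k : nat) (b : 'I_k -> E) : Prop :=
  [/\ forall i, V (b i),
      forall c : 'I_k -> R, \sum_i (c i)%:C *: b i = 0 -> forall i, c i = 0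
    & forall x, V x -> exists c : 'I_k -> R, x = \sum_i (c i)%:C *: b i].

(* All finite bases of V have the same size (see real_dimE), and the infimum
   of the empty set is +oo, which is thus the value when V has none. *)
Definition real_dim (V : set E) : \bar R :=
  ereal_inf [set k%:R%:E | k in [set k | exists b : 'I_k -> E, real_basis V b]].

Lemma real_basis_leq (V : set E) k l (b : 'I_k -> E) (b' : 'I_l -> E) :
  real_basis V b -> real_basis V b' -> (k <= l)%N.
Proof.
move=> [Vb freeb _] [_ _ spanb']; rewrite leqNgt; apply/negP => ltlk.
have /choice[A bA] i := spanb' _ (Vb i).
pose M : 'M[R]_(k, l) := \matrix_(i, j) A i j.
have : kermx M != 0.
  rewrite -mxrank_eq0 mxrank_ker subn_eq0 -ltnNge.
  by rewrite (leq_ltn_trans (rank_leq_col M)).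
case/matrix0Pn => p [q] /eqP; apply.
apply: (freeb (fun i => kermx M p i) _ q).
under eq_bigr => i _ do rewrite bA scaler_sumr.
rewrite exchange_big /= big1 // => j _.
under eq_bigr => i _ do rewrite scalerA -rmorphM.
rewrite -scaler_suml -rmorph_sum.
suff -> : \sum_i kermx M p i * A i j = 0 by rewrite scale0r.
have /matrixP/(_ p j) := mulmx_ker M; rewrite [RHS]mxE mxE => kerE.
by rewrite -[RHS]kerE; apply: eq_bigr => i _; rewrite [M i j]mxE.
Qed.

Lemma real_dimE (V : set E) k (b : 'I_k -> E) :
  real_basis V b -> real_dim V = k%:R%:E.
Proof.
move=> Bb; rewrite /real_dim.
suff -> : [set k | exists b : 'I_k -> E, real_basis V b] = [set k].
  by rewrite image_set1 ereal_inf1.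
apply/seteqP; split => [l /= [b' Bb']|l /= ->]; last by exists b.
by apply/eqP; rewrite eqn_leq (real_basis_leq Bb' Bb) (real_basis_leq Bb Bb').
Qed.

End RealDimension.

Definition unit_sphere (R : realType) (n : nat) : set 'cV[R[i]]_n :=
  [set z | \sum_j `|z j 0| ^+ 2 = 1].
Arguments unit_sphere {R} n.

Section SphereMaps.
Context {R : realType}.

Definition bdot (m : nat) (v w : 'cV[R[i]]_m) : R[i] := \sum_j v j 0 * w j 0.

Definition conjv (m : nat) (v : 'cV[R[i]]_m) : 'cV[R[i]]_m :=
  map_mx Num.conj v.

(* [differentiable] over the field R[i]: the differential is C-linear. *)
Definition holo_near_sphere (n m : nat) (Y : 'cV[R[i]]_n -> 'cV[R[i]]_m)
    : Prop :=
  exists U : set 'cV[R[i]]_n,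
    [/\ open U, unit_sphere n `<=` U & forall z, U z -> differentiable Y z].

Definition peval (n : nat) (p : mpoly n R[i]) (z : 'cV[R[i]]_n) : R[i] :=
  meval (fun j => z j 0) p.

(* Total degree; [msize] is the total degree plus one, and 0 at 0. *)
Definition pdeg (n : nat) (p : mpoly n R[i]) : nat := (msize p).-1.

Definition pdivides (n : nat) (g p : mpoly n R[i]) : Prop :=
  exists q, p = g * q.

Definition lowest_terms (n m : nat) (P : 'I_m -> mpoly n R[i])
    (Q : mpoly n R[i]) : Prop :=
  forall g, (forall i, pdivides g (P i)) -> pdivides g Q -> pdeg g = 0%N.

(* Only the values of H on the sphere matter here and below. *)
Definition rational_sphere_map (n m d : nat) (H : 'cV[R[i]]_n -> 'cV[R[i]]_m)
    : Prop :=
  exists (P : 'I_m -> mpoly n R[i]) (Q : mpoly n R[i]),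
    [/\ lowest_terms P Q,
        forall z, unit_sphere n z -> peval Q z != 0,
        forall z, unit_sphere n z -> H z = \col_i (peval (P i) z / peval Q z),
        forall z, unit_sphere n z -> unit_sphere m (H z)
      & d = maxn (\max_i pdeg (P i)) (pdeg Q)].

Definition polynomial_map (n m : nat) (H : 'cV[R[i]]_n -> 'cV[R[i]]_m) : Prop :=
  exists P : 'I_m -> mpoly n R[i],
    forall z, unit_sphere n z -> H z = \col_i peval (P i) z.

(* Y vanishes near the sphere as soon as it vanishes on it, so "Y not
   identically 0" is read on the sphere, regardless of other components of
   the domain of Y. *)
Definition holo_nondegenerate (n m : nat) (H : 'cV[R[i]]_n -> 'cV[R[i]]_m)
    : Prop :=
  ~ exists Y : 'cV[R[i]]_n -> 'cV[R[i]]_m,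
      [/\ holo_near_sphere Y,
          exists2 z, unit_sphere n z & Y z != 0
        & forall z, unit_sphere n z -> bdot (Y z) (conjv (H z)) = 0].

(* Maps agreeing on the sphere are identified by restricting them to it. *)
Definition hol (n m : nat) (H : 'cV[R[i]]_n -> 'cV[R[i]]_m)
    : set (unit_sphere n -> 'cV[R[i]]_m) :=
  [set X | exists Y : 'cV[R[i]]_n -> 'cV[R[i]]_m,
     [/\ holo_near_sphere Y,
         forall z, unit_sphere n z -> complex.Re (bdot (Y z) (conjv (H z))) = 0
       & X = fun z => Y (set_val z)]].

End SphereMaps.

Definition K (n d : nat) : nat := 'C(n + d - 1, d).

Definition lexi_le (n d : nat) (a b : n.-tuple 'I_d.+1) : bool :=
  (map val a <= map val b :> seqlexi nat)%O.

(* The entries of a multiindex of length d are at most d. *)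
Definition multiindex_seq (n d : nat) : seq (n.-tuple 'I_d.+1) :=
  sort (@lexi_le n d)
    (enum [set a : n.-tuple 'I_d.+1 | (\sum_(k <- a) k == d)%N]%SET).

Lemma size_multiindex_seq (n d : nat) : size (multiindex_seq n d) == K n d.
Proof.
apply/eqP; rewrite size_sort -cardE /K; case: n => [|n].
  case: d => [|d]; last first.
    rewrite add0n subn1 bin_small //; apply: eq_card0 => a.
    by rewrite !inE (tuple0 a) /= big_nil.
  rewrite bin0; transitivity #|{: 0.-tuple 'I_1}|; last by rewrite card_tuple.
  by apply: eq_card => a; rewrite !inE (tuple0 a) /= big_nil.
by rewrite card_ord_partitions addSn subn1 /= -bin_sub ?leq_addr// addKn.
Qed.

Definition multiindices (n d : nat) : (K n d).-tuple (n.-tuple 'I_d.+1) :=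
  Tuple (size_multiindex_seq n d).

Definition Hhom (R : realType) (n d : nat) (z : 'cV[R[i]]_n)
    : 'cV[R[i]]_(K n d) :=
  \col_i let a := tnth (multiindices n d) i in
    sqrtC (d`!%:R / (\prod_(j < n) (tnth a j)`!)%N%:R)
    * \prod_(j < n) z j 0 ^+ tnth a j.
Arguments Hhom {R} n d z.

Definition unitarily_equivalent (R : realType) (n m d : nat)
    (H : 'cV[R[i]]_n -> 'cV[R[i]]_m) : Prop :=
  exists (e : K n d = m) (U : 'M[R[i]]_m) (W : 'M[R[i]]_n),
    [/\ U \is unitarymx, W \is unitarymx
      & forall z, unit_sphere n z ->
          H z = U *m castmx (e, erefl 1%N) (Hhom n d (W *m z))].

(* Main.v *)
(* If H = P / Q and X is an infinitesimal deformation, T = Q X is holomorphic near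
   the sphere and F = T . conj P is purely imaginary on it. On a torus |z_j| = r_j
   the Fourier coefficients of a function holomorphic near the sphere are those of
   a power series (this needs n >= 2). As P has degree at most d, those of F with
   sum of the exponents at most 0 come from products z^a conj(z^b) with
   |a|, |b| <= d, and F = - conj F gives the others. So F is a combination of
   products with max(|a|, |b|) = d, and nondegeneracy makes X |-> F injective into
   the real space of imaginary such combinations, of dimension
   K^2 + 2 K C(n+d-1, n) = (2d + n) / n K^2 where K = K(n, d). For H^d_n the map is
   also onto. Conversely, let H be polynomial and the map onto. Every conj(z^b)
   with |b| = d is T . conj H for some T, which makes H homogeneous of degree d;
   comparing |H|^2 = 1 with (sum_j |z_j|^2)^d = 1 shows that the coefficient vectors
   of H are orthogonal with the norms of H^d_n, and they span C^m by
   nondegeneracy. *)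
Require Import Defs.
From mathcomp Require Import all_boot all_order all_algebra.
From mathcomp Require Import spectral complex.
From mathcomp Require Import all_classical all_reals all_analysis.
From mathcomp Require Import ring lra zify.
From mathcomp Require Import -(notations) mpoly.
Set Implicit Arguments.
Unset Strict Implicit.
Unset Printing Implicit Defensive.

Import Order.TTheory GRing.Theory Num.Theory.
Import numFieldNormedType.Exports.
Import ComplexField.Normc.

Local Open Scope classical_set_scope.
Local Open Scope ring_scope.
Local Open Scope complex_scope.

(** * Dyadic roots of unity *)

(** The analytic input is one uniqueness and one vanishing statement about Fourier coefficients on
    the tori |z_j| = r_j contained in the sphere. No integral is used: the mean over a torus is a
    limit, along an ultrafilter, of averages over grids of dyadic roots of unity. Every bounded
    function then has a mean, linear and invariant under dyadic rotations, and this invariance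
    already yields the orthogonality of characters. Cauchy's theorem accordingly has to be stated
    for sums over roots of unity; Goursat's bisection provides it under mere complex
    differentiability. Convergence of Taylor series is avoided: a function holomorphic near the
    sphere enters only through its coefficients, and equality on the sphere is deduced from equality
    of the means against all characters. The dimension counts the pairs (a, b) with max(|a|, |b|) =
    d: K^2 of them have |a| = |b| = d, and in the others one entry has degree d and the other is one
    of the C(n+d-1, n) multiindices of smaller degree; the identity n C(n+d-1, n) = d K gives the
    closed form. *)

Section Cis.
Context {R : realType}.
Implicit Types (x y t s : R) (z : R[i]).

Lemma normc_norm z : `|z| = (normc z)%:C. Proof. by []. Qed.

Lemma normc_ge0 z : 0 <= normc z.
Proof. by case: z => a b; apply: sqrtr_ge0. Qed.

Lemma normc_real x : normc x%:C = `|x|.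
Proof. by rewrite /normc /= expr0n addr0 sqrtr_sqr. Qed.

Lemma normcX z n : normc (z ^+ n) = normc z ^+ n.
Proof.
by elim: n => [|n IH]; rewrite ?expr0 ?normc1// !exprS normcM IH.
Qed.

Lemma normc_sum (I : Type) (r : seq I) (P : pred I) (F : I -> R[i]) :
  normc (\sum_(i <- r | P i) F i) <= \sum_(i <- r | P i) normc (F i).
Proof.
elim/big_ind2: _ => [|a b c d ab cd|//]; first by rewrite normc0.
by apply: le_trans (le_normcD _ _) _; apply: lerD.
Qed.

Lemma normc_distC z z' : normc (z - z') = normc (z' - z).
Proof. by rewrite -normcN opprB. Qed.

Lemma normc_conj z : normc (Num.conj z) = normc z.
Proof. by case: z => a b; rewrite /= sqrrN. Qed.

Definition cis t : R[i] := cos t +i* sin t.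

Lemma cis0 : cis 0 = 1.
Proof. by rewrite /cis cos0 sin0. Qed.

Lemma cisD s t : cis (s + t) = cis s * cis t.
Proof. by rewrite /cis cosD sinD; simpc; rewrite [X in _ +i* X]addrC. Qed.

Lemma cisX t n : cis t ^+ n = cis (t *+ n).
Proof.
by elim: n => [|n IH]; rewrite ?mulr0n ?cis0// exprS IH mulrS cisD.
Qed.

Lemma normc_cis t : normc (cis t) = 1.
Proof. by rewrite /normc/= cos2Dsin2 sqrtr1. Qed.

Lemma cis_neq0 t : cis t != 0.
Proof.
by apply/eqP => /(congr1 (@normc R)); rewrite normc_cis normc0 => /eqP; rewrite oner_eq0.
Qed.

Lemma norm_sin_le t : `|sin t| <= `|t|.
Proof.
wlog t0 : t / 0 <= t => [H|].
  have [/H//|/ltW] := leP 0 t; rewrite -oppr_ge0 => /H.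
  by rewrite sinN !normrN.
have [c _] := MVT_segment t0 (fun x _ => is_derive_sin x)
  (continuous_subspaceT (@continuous_sin R)).
rewrite sin0 !subr0 => ->; rewrite normrM ler_piMl// cos_max //.
Qed.

(** The chord subtending the angle t has length 2 |sin(t / 2)|. *)
Lemma normc_cisB1 t : normc (cis t - 1) <= `|t|.
Proof.
have -> : normc (cis t - 1) = 2 * `|sin (t / 2)|.
  have {1}-> : t = (t / 2) *+ 2 by rewrite -mulr_natr divfK// pnatr_eq0.
  rewrite /cis cos_mulr2n sin_mulr2n.
  rewrite /normc/=; have := cos2Dsin2 (t / 2).
  set c := cos _; set s := sin _ => cs.
  rewrite -[2 in RHS]ger0_norm// -normrM -sqrtr_sqr; congr Num.sqrt.
  have -> : c ^+ 2 *+ 2 - 1 - 1 = - (s ^+ 2 *+ 2) by rewrite -(addrK (s ^+ 2) (c ^+ 2)) cs; ring.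
  rewrite oppr0 addr0 sqrrN.
  have -> : ((c * s) *+ 2) ^+ 2 = (c ^+ 2) * (s ^+ 2 *+ 4) by ring.
  by rewrite -(addrK (s ^+ 2) (c ^+ 2)) cs; ring.
by rewrite -ler_pdivlMl//; apply: le_trans (norm_sin_le _) _; rewrite normrM mulrC ger0_norm.
Qed.

(** Powers of two make the groups of roots nested ([dyroot_pow]), so that a finer grid contains
    every coarser one. *)
Definition dyroot (N : nat) : R[i] := cis (2 * pi / 2 ^+ N).

Lemma normc_dyroot N : normc (dyroot N) = 1.
Proof. exact: normc_cis. Qed.

Lemma dyroot_pow k l : dyroot (k + l) ^+ (2 ^ l)%N = dyroot k.
Proof.
rewrite /dyroot cisX; congr cis; rewrite -[_ *+ (2 ^ l)%N]mulr_natr natrX exprD invfM mulrA.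
by rewrite mulfVK// expf_neq0.
Qed.

Lemma dyroot0 : dyroot 0 = 1.
Proof. by rewrite /dyroot expr0 divr1 mulr_natl /cis cos2pi sin2pi. Qed.

Lemma dyroot_exp N : dyroot N ^+ (2 ^ N)%N = 1.
Proof. by rewrite -[N in dyroot N]add0n dyroot_pow dyroot0. Qed.

Lemma dyroot_half N : dyroot N.+1 ^+ (2 ^ N)%N = -1.
Proof.
rewrite -add1n dyroot_pow /dyroot expr1 mulrAC divff// mul1r /cis cospi sinpi.
by apply/eqP; rewrite eq_complex /= oppr0 !eqxx.
Qed.

Lemma dyrootB1_le N : normc (dyroot N - 1) <= 2 * pi / 2 ^+ N.
Proof.
apply: le_trans (normc_cisB1 _) _; rewrite ger0_norm//.
by rewrite divr_ge0// ?exprn_ge0// mulr_ge0// pi_ge0.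
Qed.

Lemma normc_expB1 z n : normc z = 1 -> normc (z ^+ n - 1) <= n%:R * normc (z - 1).
Proof.
move=> z1; rewrite subrX1 normcM mulrC ler_wpM2r ?normc_ge0//.
apply: le_trans (normc_sum _ _ _) _; rewrite -[X in _ <= X%:R]card_ord -sumr_const.
by apply: ler_sum => i _; rewrite normcX z1 expr1n.
Qed.

(** The 2^N-th power of this root is -1, so [normc_expB1] gives 2 <= 2^N |w - 1|. The bound lets
    [goursat] divide by w - 1. *)
Lemma dyrootB1_ge N : 4 <= 2 ^+ N.+1 * normc (dyroot N.+1 - 1).
Proof.
have := @normc_expB1 (dyroot N.+1) (2 ^ N)%N (normc_dyroot _).
rewrite dyroot_half -opprD normcN -(natrD _ 1 1) -[X in normc X]/(2%:R : R[i]).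
rewrite -(rmorph_nat (real_complex R)) normc_real ger0_norm ?ler0n// natrX exprS.
by rewrite -mulrA; set X := 2 ^+ N * _; lra.
Qed.

End Cis.

(** * Goursat's theorem on an annulus *)

Section Goursat.
Context {R : realType}.
Implicit Types (x y s : R) (G : R[i] -> R[i]) (l : R[i]).

(** Bisection of the unit square: [P k i j] is about the dyadic square of side 2^-k with lower
    corner (i, j) / 2^k. If [P 0 0 0] failed, nested bad squares would shrink to a point and
    contradict the local hypothesis there. *)
Lemma dyadic_induction2 (P : nat -> nat -> nat -> Prop) :
  (forall k i j, P k.+1 i.*2 j.*2 -> P k.+1 i.*2.+1 j.*2 ->
     P k.+1 i.*2 j.*2.+1 -> P k.+1 i.*2.+1 j.*2.+1 -> P k i j) ->
  (forall x y, 0 <= x <= 1 -> 0 <= y <= 1 -> exists k0, forall k i j, (k0 <= k)%N ->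
     i%:R / 2 ^+ k <= x <= i.+1%:R / 2 ^+ k ->
     j%:R / 2 ^+ k <= y <= j.+1%:R / 2 ^+ k -> P k i j) ->
  P 0 0 0.
Proof.
move=> Pstep Ploc; apply: contrapT => nP.
have step (k : nat) (ij : nat * nat) : exists ij' : nat * nat,
    (~ P k ij.1 ij.2 -> ~ P k.+1 ij'.1 ij'.2) /\
    (ij'.1./2 = ij.1 /\ ij'.2./2 = ij.2).
  case: ij => i j /=; apply: contrapT => /forallNP H.
  have [p|np] := pselect (P k i j).
    by apply: (H (i.*2, j.*2)); rewrite /= !doubleK.
  by apply: np; apply: Pstep; apply: contrapT => q;
    [apply: (H (i.*2, j.*2))|apply: (H (i.*2.+1, j.*2))
    |apply: (H (i.*2, j.*2.+1))|apply: (H (i.*2.+1, j.*2.+1))];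
    rewrite /= ?uphalf_double ?doubleK.
pose nxt k ij := projT1 (cid (step k ij)).
pose sq := fix sq k := if k is k'.+1 then nxt k' (sq k') else (0, 0)%N.
have sqP k : ~ P k (sq k).1 (sq k).2.
  elim: k => [//|k IH] /=.
  by have [/(_ IH)] := projT2 (cid (step k (sq k))).
(* Halving makes the left ends increase and the right ends decrease; the limit point is the supremum
   of the left ends. *)
have limit (f : nat -> nat) : f 0 = 0 -> (forall k, (f k.+1)./2 = f k) ->
    exists2 x : R, 0 <= x <= 1 & forall k, (f k)%:R / 2 ^+ k <= x <= (f k).+1%:R / 2 ^+ k.
  move=> f0 fS.
  have two_gt0 k : 0 < 2 ^+ k :> R by rewrite exprn_gt0.
  have up k : (f k)%:R / 2 ^+ k <= (f k.+1)%:R / 2 ^+ k.+1 :> R.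
    rewrite exprS invfM mulrA ler_pM2r ?invr_gt0// ler_pdivlMr// -natrM ler_nat -(fS k).
    by rewrite muln2 -[leqRHS]odd_double_half leq_addl.
  have dn k : (f k.+1).+1%:R / 2 ^+ k.+1 <= (f k).+1%:R / 2 ^+ k :> R.
    rewrite exprS invfM mulrA ler_pM2r ?invr_gt0// ler_pdivrMr// -natrM ler_nat -(fS k).
    by rewrite muln2 doubleS -[in leqLHS](odd_double_half (f k.+1)); case: (odd _).
  have upm k m : (f k)%:R / 2 ^+ k <= (f (m + k)%N)%:R / 2 ^+ (m + k) :> R.
    by elim: m => [//|m IH]; apply: le_trans IH (up _).
  have dnm k m : (f (m + k)%N).+1%:R / 2 ^+ (m + k) <= (f k).+1%:R / 2 ^+ k :> R.
    by elim: m => [//|m]; apply: le_trans (dn _).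
  have ub k m : (f k)%:R / 2 ^+ k <= (f m).+1%:R / 2 ^+ m :> R.
    apply: le_trans (upm k m) _; apply: le_trans (dnm m k).
    by rewrite addnC ler_pM2r ?invr_gt0// ler_nat.
  pose A := range (fun k => (f k)%:R / 2 ^+ k : R).
  have A0 : A !=set0 by exists ((f 0)%:R / 2 ^+ 0), 0.
  have xk k : (f k)%:R / 2 ^+ k <= sup A <= (f k).+1%:R / 2 ^+ k.
    apply/andP; split.
      apply: ub_le_sup; last by exists k.
      by exists ((f k).+1%:R / 2 ^+ k) => _ [m _ <-].
    by apply: ge_sup => // _ [m _ <-].
  by exists (sup A) => //; have := xk 0; rewrite f0 expr0 !divr1.
have sqS k : (sq k.+1).1./2 = (sq k).1 /\ (sq k.+1).2./2 = (sq k).2.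
  by have [_] := projT2 (cid (step k (sq k))).
have [x x01 xP] := limit (fun k => (sq k).1) erefl (fun k => (sqS k).1).
have [y y01 yP] := limit (fun k => (sq k).2) erefl (fun k => (sqS k).2).
have [k0 Pk] := Ploc x y x01 y01.
exact: sqP k0 (Pk k0 _ _ (leqnn _) (xP _) (yP _)).
Qed.

(** Complex differentiability at [l], with real [e] and [d] so that all estimates take place in
    [R]. *)
Definition cdiff G l := exists B : R[i], forall e, 0 < e -> exists2 d, 0 < d &
  forall l', normc (l' - l) < d -> normc (G l' - G l - B * (l' - l)) <= e * normc (l' - l).

(** Logarithmic polar coordinates e^(s x + 2 pi i y): the unit square covers the annulus 1 <= |l| <=
    e^s, and translations become multiplications. *)
Definition polar s x y : R[i] := (expR (s * x))%:C * cis (2 * pi * y).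

Lemma polarD s x y x' y' : polar s (x + x') (y + y') = polar s x y * polar s x' y'.
Proof.
by rewrite /polar !mulrDr expRD cisD rmorphM/= mulrACA.
Qed.

Lemma normc_polar s x y : normc (polar s x y) = expR (s * x).
Proof. by rewrite normcM normc_cis mulr1 normc_real ger0_norm// expR_ge0. Qed.

Lemma norm_expRB1 x (c : R) : `|x| <= c -> `|expR x - 1| <= `|x| * expR c.
Proof.
move=> xc; have xc' : x <= c := le_trans (ler_norm _) xc.
have [x0|x0] := leP 0 x.
  have e1 : 1 <= expR x by rewrite -[leLHS]expR0 ler_expR.
  rewrite (ger0_norm x0) ger0_norm ?subr_ge0//.
  have := expR_ge1Dx (- x); rewrite expRN => h.
  have e0 := expR_gt0 x; have ex : expR x - 1 <= x * expR x.
    have := ler_wpM2r (ltW e0) h; rewrite mulVf ?gt_eqF// mulrDl mul1r mulNr; lra.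
  by apply: le_trans ex _; rewrite ler_wpM2l// ler_expR.
have := expR_ge1Dx x; have e1 : expR x <= 1 by rewrite -[leRHS]expR0 ler_expR ltW.
have : 1 <= expR c by rewrite -[leLHS]expR0 ler_expR (le_trans _ xc).
rewrite (ltr0_norm x0) ler0_norm ?subr_le0// opprB => *; nra.
Qed.

(** By [polarD] the difference is a value of [polar] times the distance to 1 of [polar] at the
    increment; the radial and the angular factor of the latter are estimated separately. *)
Lemma polar_lip s x y x' y' : 0 <= s -> x <= 1 -> `|x' - x| <= 1 ->
  normc (polar s x' y' - polar s x y) <=
  expR s * (expR s * s + 2 * pi) * (`|x' - x| + `|y' - y|).
Proof.
move=> s0 x1 dx; have pi0 := @pi_ge0 R.
rewrite -[x'](subrK x) -[y'](subrK y) !addrK polarD -[X in _ - X]mul1r -mulrBl normcM.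
rewrite mulrC normc_polar -mulrA.
apply: ler_pM; rewrite ?expR_ge0 ?normc_ge0//; first by rewrite ler_expR ler_piMr.
set u := x' - x; set v := y' - y.
rewrite /polar -[X in X - 1](subrK (cis (2 * pi * v))) -addrA.
apply: le_trans (le_normcD _ _) _.
rewrite -[X in _ * _ - X]mul1r -mulrBl normcM normc_cis mulr1.
rewrite -(rmorph1 (real_complex R)) -rmorphB normc_real.
have su : `|s * u| <= s by rewrite normrM (ger0_norm s0) ler_piMr.
have := norm_expRB1 su; have := normc_cisB1 (2 * pi * v).
rewrite !normrM (ger0_norm s0) (ger0_norm pi0) ger0_norm//.
have := normr_ge0 u; have := normr_ge0 v; have := expR_ge0 s.
set a := `|u|; set b := `|v|; set E := expR s => E0 b0 a0 h1 h2.
apply: le_trans (lerD h2 h1) _.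
have : 0 <= E * s * b by rewrite !mulr_ge0.
have : 0 <= pi * a by rewrite mulr_ge0.
by rewrite mulrDl !mulrDr; nra.
Qed.

Lemma polar0 s : polar s 0 0 = 1.
Proof. by rewrite /polar !mulr0 expR0 cis0 mulr1. Qed.

Section Cells.
Variables (w q : R[i]) (F : nat -> nat -> R[i]).

(** Riemann sum of F dl/l around one grid cell: on a geometric grid dl/l is constant along radial
    steps ([q]) and along angular steps ([w]). Shared edges cancel, whence [sum_cell]. *)
Definition cell a b := (F a.+1 b - F a b) * w - (F a b.+1 - F a b) * q.

Lemma sum_cell a0 a1 b0 b1 : (a0 <= a1)%N -> (b0 <= b1)%N ->
  \sum_(a0 <= a < a1) \sum_(b0 <= b < b1) cell a b =
  (\sum_(b0 <= b < b1) (F a1 b - F a0 b)) * w -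
  (\sum_(a0 <= a < a1) (F a b1 - F a b0)) * q.
Proof.
move=> a01 b01; under eq_bigr do rewrite sumrB -!mulr_suml telescope_sumr//.
rewrite sumrB -!mulr_suml exchange_big /=; congr (_ * _ - _).
by apply: eq_bigr => b _; rewrite telescope_sumr.
Qed.

Lemma sum_cell_split a0 a1 a2 b0 b1 b2 :
  (a0 <= a1 <= a2)%N -> (b0 <= b1 <= b2)%N ->
  \sum_(a0 <= a < a2) \sum_(b0 <= b < b2) cell a b =
  (\sum_(a0 <= a < a1) \sum_(b0 <= b < b1) cell a b +
   \sum_(a0 <= a < a1) \sum_(b1 <= b < b2) cell a b) +
  (\sum_(a1 <= a < a2) \sum_(b0 <= b < b1) cell a b +
   \sum_(a1 <= a < a2) \sum_(b1 <= b < b2) cell a b).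
Proof.
move=> /andP[a01 a12] /andP[b01 b12]; rewrite (big_cat_nat a01 a12)/=.
by congr (_ + _); rewrite -big_split /=; apply: eq_bigr => a _; rewrite (big_cat_nat b01 b12).
Qed.

End Cells.

(* A discrete Cauchy theorem for the annulus 1 <= |l| <= e^s: in logarithmic
   polar coordinates the annulus is a square, the sum of [cell] over a dyadic
   grid telescopes to its two boundary circles, and Goursat's bisection shows
   that it tends to 0. *)
Lemma goursat s G : 0 <= s ->
  (forall l, 1 <= normc l <= expR s -> cdiff G l) ->
  forall e : R, 0 < e -> exists N0, forall N, (N0 <= N)%N ->
  normc (\sum_(0 <= b < (2 ^ N)%N)
    (G ((expR s)%:C * dyroot N ^+ b) - G (dyroot N ^+ b))) <= e * 2 ^+ N.
Proof.
move=> s0 dG; have two_gt0 k : 0 < 2 ^+ k :> R by rewrite exprn_gt0.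
have two_ge1 k : 1 <= 2 ^+ k :> R by rewrite exprn_ege1// ler1n.
pose z N a b := polar s (a%:R / 2 ^+ N) (b%:R / 2 ^+ N).
pose q N := polar s (1 / 2 ^+ N) 0; pose w N := dyroot N : R[i].
have wE N : w N = polar s 0 (1 / 2 ^+ N).
  by rewrite /w /dyroot /polar mulr0 expR0 div1r mul1r.
have zSa N a b : z N a.+1 b = z N a b * q N.
  by rewrite /z /q -polarD addr0 -mulrDl -natr1.
have zSb N a b : z N a b.+1 = z N a b * w N.
  by rewrite /z wE -polarD addr0 -mulrDl natr1.
have z_w N a b : z N a b = z N a 0 * w N ^+ b.
  by elim: b => [|b IH]; rewrite ?expr0 ?mulr1// zSb IH exprSr mulrA.
have z00 N : z N 0 0 = 1 by rewrite /z !mul0r polar0.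
have zN0 N : z N (2 ^ N)%N 0 = (expR s)%:C.
  by rewrite /z natrX divff ?gt_eqF// mul0r /polar mulr0 cis0 mulr1 mulr1.
pose C := expR s * (expR s * s + 2 * pi).
have C_gt0 : 0 < C.
  by rewrite mulr_gt0 ?expR_gt0// ltr_wpDl ?mulr_ge0 ?expR_ge0// mulr_gt0 ?pi_gt0.
have wB1 N : normc (w N - 1) <= C / 2 ^+ N.
  rewrite wE -(polar0 s); apply: le_trans (polar_lip _ _ _ _ _) _ => //.
    by rewrite subrr normr0.
  by rewrite !subr0 normr0 add0r div1r ger0_norm// invr_ge0 ltW.
have qB1 N : normc (q N - 1) <= C / 2 ^+ N.
  have h : `|1 / 2 ^+ N - 0| = (2 ^+ N)^-1 :> R.
    by rewrite subr0 div1r ger0_norm// invr_ge0 ltW.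
  rewrite /q -(polar0 s); apply: le_trans (polar_lip _ _ _ _ _) _ => //.
    by rewrite h invf_le1.
  by rewrite h subrr normr0 addr0.
(* On the full grid the two radial edges coincide, as w^(2^N) = 1, so the sum of the cells is the
   difference of the circle sums times w - 1. Dividing by it costs at most 2^N / 4, by
   [dyrootB1_ge]. *)
suff H : forall e : R, 0 < e -> exists N0, forall N, (N0 <= N)%N ->
    normc (\sum_(0 <= a < (2 ^ N)%N) \sum_(0 <= b < (2 ^ N)%N)
      cell (w N - 1) (q N - 1) (fun a b => G (z N a b)) a b) <= e.
  move=> e e0; have e20 : 0 < e * 2 by rewrite mulr_gt0.
  have [N0 HN] := H _ e20.
  exists N0.+1 => -[//|N] NN; have := HN N.+1 (ltnW NN).
  rewrite sum_cell// [X in _ - X](_ : _ = 0) ?subr0; last first.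
    rewrite big1 ?mul0r// => a _.
    by rewrite z_w /w dyroot_exp mulr1 subrr.
  under eq_bigr do rewrite z_w zN0 z_w z00 mul1r.
  rewrite normcM => h; have := @dyrootB1_ge R N.
  have := two_gt0 N.+1; have := @normc_ge0 R (dyroot N.+1 - 1).
  rewrite -/(w N.+1); move: h; set A := normc _; set B := normc _.
  have : 0 <= A by apply: normc_ge0.
  move=> A0 h B0 t0 h4; rewrite -(ler_pM2r (x := B)); last by nra.
  by rewrite (le_trans h)// -mulrA; nra.
move=> e e0.
(* The bound scales like the area 4^-k, so that the bounds of four subsquares add up to that of the
   square. *)
pose P k i j := exists N0, forall N, (N0 <= N)%N -> (k <= N)%N ->
  normc (\sum_((i * 2 ^ (N - k))%N <= a < (i.+1 * 2 ^ (N - k))%N)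
    \sum_((j * 2 ^ (N - k))%N <= b < (j.+1 * 2 ^ (N - k))%N)
      cell (w N - 1) (q N - 1) (fun a b => G (z N a b)) a b) <= e / 4 ^+ k.
suff [N0 PN] : P 0 0 0.
  exists N0 => N NN; have := PN N NN (leq0n _).
  by rewrite !mul0n !subn0 !mul1n expr0 divr1.
apply: dyadic_induction2 => [k i j|x y x01 y01].
  move=> [N1 H1] [N2 H2] [N3 H3] [N4 H4]; exists (k.+1 + (N1 + N2 + N3 + N4))%N => N NN kN.
  have kN' : (k < N)%N by apply: leq_trans NN; apply: leq_addr.
  have e2 (c : nat) : (c * 2 ^ (N - k))%N = (c.*2 * 2 ^ (N - k.+1))%N.
    by rewrite -muln2 -mulnA -expnS subnSK.
  have le2 (c : nat) : (c.*2 * 2 ^ (N - k.+1) <= c.*2.+1 * 2 ^ (N - k.+1) <= c.+1.*2 * 2 ^ (N - k.+1))%N.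
    by rewrite !leq_pmul2r ?expn_gt0// leqnSn doubleS /=.
  rewrite !e2 (sum_cell_split _ _ _ (le2 i) (le2 j)).
  have := H1 N _ kN'; have := H2 N _ kN'; have := H3 N _ kN'; have := H4 N _ kN'.
  rewrite !doubleS => h4 h3 h2 h1.
  have le_e : e / 4 ^+ k = (e / 4 ^+ k.+1 + e / 4 ^+ k.+1) + (e / 4 ^+ k.+1 + e / 4 ^+ k.+1).
    by rewrite exprS invfM; set u := _^-1; lra.
  rewrite le_e; do 3?[apply: le_trans (le_normcD _ _) (lerD _ _)].
  - by apply: h1; lia.
  - by apply: h3; lia.
  - by apply: h2; lia.
  - by apply: h4; lia.
have ann x' y' : 0 <= x' <= 1 -> 1 <= normc (polar s x' y') <= expR s.
  move=> /andP[x0 x1]; rewrite normc_polar ler_expR -[leLHS]expR0 ler_expR.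
  by rewrite mulr_ge0//= ler_piMr.
have [B dB] := dG _ (ann x y x01).
pose l0 := polar s x y; rewrite -/l0 in dB.
(* On a square of side 2^-k the deviation from the affine part is at most 2 C e' / 2^k. Two sums of
   2^(N-k) differences of such values, each weighted by C / 2^N, give 8 C^2 e' / 4^k. *)
pose e' := e / (8 * C ^+ 2).
have e'0 : 0 < e' by rewrite divr_gt0// mulr_gt0// exprn_gt0.
have [d d0 dP] := dB e' e'0.
have [k0 k0P] : exists k0, 2 * C / d < 2 ^+ k0.
  exists (Num.bound (2 * C / d)).
  have h : 0 <= 2 * C / d by rewrite divr_ge0 ?(ltW d0)// mulr_ge0// ltW.
  apply: lt_trans (archi_boundP h) _.
  by rewrite -natrX ltr_nat ltn_expl.
exists k0 => k i j kk xik yjk; exists 0%N => N _ kN.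
have tk : 2 * C / d < 2 ^+ k by apply: lt_le_trans k0P _; rewrite ler_eXn2l// ltr1n.
(* Subtracting the affine part of G at [l0] changes no [cell]: a linear function contributes z (q -
   1) (w - 1) twice, with opposite signs. *)
pose E := fun a b => G (z N a b) - (G l0 + B * (z N a b - l0)).
have -> : (\sum_((i * 2 ^ (N - k))%N <= a < (i.+1 * 2 ^ (N - k))%N)
    \sum_((j * 2 ^ (N - k))%N <= b < (j.+1 * 2 ^ (N - k))%N)
      cell (w N - 1) (q N - 1) (fun a b => G (z N a b)) a b) =
  \sum_((i * 2 ^ (N - k))%N <= a < (i.+1 * 2 ^ (N - k))%N)
    \sum_((j * 2 ^ (N - k))%N <= b < (j.+1 * 2 ^ (N - k))%N)
      cell (w N - 1) (q N - 1) E a b.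
  apply: eq_bigr => a _; apply: eq_bigr => b _; rewrite /cell /E zSa zSb.
  by ring.
have leN (c : nat) : (c * 2 ^ (N - k) <= c.+1 * 2 ^ (N - k))%N.
  by rewrite leq_pmul2r ?expn_gt0.
rewrite sum_cell//.
have near1 (c i' : nat) (t : R) : i'%:R / 2 ^+ k <= t <= i'.+1%:R / 2 ^+ k ->
    (i' * 2 ^ (N - k) <= c <= i'.+1 * 2 ^ (N - k))%N ->
    `|c%:R / 2 ^+ N - t| <= 1 / 2 ^+ k.
  move=> /andP[t1 t2] /andP[c1 c2].
  have eN : 2 ^+ N = 2 ^+ k * 2 ^+ (N - k) :> R by rewrite -exprD subnKC.
  have lo : i'%:R / 2 ^+ k <= c%:R / 2 ^+ N :> R.
    by rewrite eN ler_pdivlMr ?mulr_gt0// mulrA divfK ?gt_eqF// -natrX -natrM ler_nat.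
  have hi : c%:R / 2 ^+ N <= i'.+1%:R / 2 ^+ k :> R.
    by rewrite eN ler_pdivrMr ?mulr_gt0// mulrA divfK ?gt_eqF// -natrX -natrM ler_nat.
  have e1 : i'.+1%:R / 2 ^+ k = i'%:R / 2 ^+ k + 1 / 2 ^+ k :> R by rewrite -mulrDl natr1.
  by rewrite e1 in t2 hi; rewrite ler_distl; apply/andP; split; lra.
have Ebnd a b : (i * 2 ^ (N - k) <= a <= i.+1 * 2 ^ (N - k))%N ->
    (j * 2 ^ (N - k) <= b <= j.+1 * 2 ^ (N - k))%N ->
    normc (E a b) <= e' * (2 * C / 2 ^+ k).
  move=> ha hb; have nx := near1 _ _ _ xik ha; have ny := near1 _ _ _ yjk hb.
  have dl : normc (z N a b - l0) <= 2 * C / 2 ^+ k.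
    apply: le_trans (polar_lip _ _ _ _ _) _ => //; first by case/andP: x01.
      by apply: le_trans nx _; rewrite div1r invf_le1.
    have -> : 2 * C / 2 ^+ k = C * (1 / 2 ^+ k + 1 / 2 ^+ k) by set u := 2 ^+ k; ring.
    by rewrite ler_pM2l// lerD.
  have dl' : normc (z N a b - l0) < d.
    by apply: le_lt_trans dl _; rewrite ltr_pdivrMr// [d * _]mulrC -ltr_pdivrMr.
  rewrite /E opprD addrA; apply: le_trans (dP _ dl') _.
  by rewrite ler_wpM2l// ltW.
have sumbnd (i' : nat) (f : nat -> R[i]) (M : R) : (forall c, (i' * 2 ^ (N - k) <= c < i'.+1 * 2 ^ (N - k))%N -> normc (f c) <= M) ->
  normc (\sum_((i' * 2 ^ (N - k))%N <= c < (i'.+1 * 2 ^ (N - k))%N) f c) <= 2 ^+ (N - k) * M.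
  move=> fM; apply: le_trans (normc_sum _ _ _) _.
  apply: (@le_trans _ _ (\sum_((i' * 2 ^ (N - k))%N <= c < (i'.+1 * 2 ^ (N - k))%N) M)).
    by rewrite !big_nat; apply: ler_sum => c; apply: fM.
  by rewrite sumr_const_nat -mulnBl subSnn mul1n -[M *+ _]mulr_natl natrX.
pose M := e' * (2 * C / 2 ^+ k).
have mid c : (c * 2 ^ (N - k) <= c.+1 * 2 ^ (N - k))%N by [].
apply: le_trans (le_normcD _ _) _; rewrite normcN !normcM.
have h1 : normc (\sum_((j * 2 ^ (N - k))%N <= b < (j.+1 * 2 ^ (N - k))%N) (E (i.+1 * 2 ^ (N - k))%N b - E (i * 2 ^ (N - k))%N b)) <= 2 ^+ (N - k) * (2 * M).
  apply: sumbnd => b /andP[b1 b2]; apply: le_trans (le_normcD _ _) _.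
  by rewrite normcN mulr_natl mulr2n; apply: lerD; apply: Ebnd; rewrite ?leqnn ?mid// b1 ltnW.
have h2 : normc (\sum_((i * 2 ^ (N - k))%N <= a < (i.+1 * 2 ^ (N - k))%N) (E a (j.+1 * 2 ^ (N - k))%N - E a (j * 2 ^ (N - k))%N)) <= 2 ^+ (N - k) * (2 * M).
  apply: sumbnd => b /andP[b1 b2]; apply: le_trans (le_normcD _ _) _.
  by rewrite normcN mulr_natl mulr2n; apply: lerD; apply: Ebnd; rewrite ?leqnn ?mid// b1 ltnW.
have := lerD (ler_pM (normc_ge0 _) (normc_ge0 _) h1 (wB1 N))
  (ler_pM (normc_ge0 _) (normc_ge0 _) h2 (qB1 N)).
move=> /le_trans; apply.
have -> : 4 ^+ k = 2 ^+ k * 2 ^+ k :> R by rewrite -exprMn; congr (_ ^+ _); lra.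
rewrite -(subnK kN) addnC exprD /M /e' addKn le_eqVlt; apply/orP; left; apply/eqP.
by field; rewrite !gt_eqF.
Qed.

End Goursat.

(** * Means over the torus *)

Section Ulim.
Context {R : realType}.

Definition ultraoo : set_system nat := projT1 (cid (ultraFilterLemma eventually_filter)).

Instance ultraoo_ultra : UltraFilter ultraoo.
Proof. exact: (projT2 (cid (ultraFilterLemma eventually_filter))).1. Qed.

Lemma ultraoo_ge : eventually `<=` ultraoo.
Proof. exact: (projT2 (cid (ultraFilterLemma eventually_filter))).2. Qed.

Definition ulim (a : nat -> R) : R := lim (a @ ultraoo).

(** Compactness of [-C, C] gives a cluster point along [ultraoo], and a cluster point of an
    ultrafilter is a limit. *)
Lemma ulim_cvg (a : nat -> R) C : (forall k, `|a k| <= C) -> a k @[k --> ultraoo] --> ulim a.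
Proof.
move=> aC; suff [p ap] : exists p : R, a k @[k --> ultraoo] --> p.
  by rewrite /ulim (cvg_lim _ ap)//; exact: Rhausdorff.
have FA : (a @ ultraoo) `[- C, C]%classic.
  rewrite /nbhs /=; apply: (filterS _ (@filterT _ ultraoo _)) => k _ /=.
  by rewrite in_itv/= -ler_norml aC.
have [p [_ clp]] := @segment_compact R (- C) C (a @ ultraoo) _ FA.
exists p => V Vp; have [//|nV] := in_ultra_setVsetC (a @^-1` V) ultraoo_ultra.
by have [x [nx Vx]] := clp (~` V) V nV Vp.
Qed.

Lemma ulimE (a : nat -> R) l : a k @[k --> ultraoo] --> l -> ulim a = l.
Proof. by move=> al; rewrite /ulim (cvg_lim _ al)//; exact: Rhausdorff. Qed.

Lemma ulimD (a b : nat -> R) C D : (forall k, `|a k| <= C) -> (forall k, `|b k| <= D) ->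
  ulim (fun k => a k + b k) = ulim a + ulim b.
Proof. by move=> aC bD; apply: ulimE; apply: cvgD (ulim_cvg aC) (ulim_cvg bD). Qed.

Lemma ulimZ (a : nat -> R) C c : (forall k, `|a k| <= C) ->
  ulim (fun k => c * a k) = c * ulim a.
Proof. by move=> aC; apply: ulimE; apply: cvgMr (ulim_cvg aC). Qed.

Lemma ulim_le (a b : nat -> R) C D : (forall k, `|a k| <= C) -> (forall k, `|b k| <= D) ->
  (forall k, a k <= b k) -> ulim a <= ulim b.
Proof.
move=> aC bD ab; apply: (ler_cvg_to (ulim_cvg aC) (ulim_cvg bD)).
exact: (filterS _ (@filterT _ ultraoo _)).
Qed.

Lemma ulim_cst c : ulim (fun=> c) = c.
Proof. by apply: ulimE; apply: cvg_cst. Qed.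

Lemma ulim_eventually (a b : nat -> R) n0 : (forall k, (n0 <= k)%N -> a k = b k) ->
  ulim a = ulim b.
Proof.
move=> ab; rewrite /ulim; congr lim; apply/seteqP; split => V /= h.
  apply: (@filterS2 _ ultraoo _ [set k | (n0 <= k)%N] (a @^-1` V) _ _ _ h).
    by move=> k /= /ab <-.
  exact: ultraoo_ge (nbhs_infty_ge n0).
apply: (@filterS2 _ ultraoo _ [set k | (n0 <= k)%N] (b @^-1` V) _ _ _ h).
  by move=> k /= /ab ->.
exact: ultraoo_ge (nbhs_infty_ge n0).
Qed.

End Ulim.

Section Mean.
Context {R : realType} {n : nat}.
Implicit Types (u : 'cV[R[i]]_n) (f g : 'cV[R[i]]_n -> R) (F G : 'cV[R[i]]_n -> R[i]).

Definition torus : set 'cV[R[i]]_n := [set u | forall j, normc (u j 0) = 1].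

(** The exponent is N + 1 rather than N because ['Z_p] is the cyclic group of order p only for p >
    1. *)
Definition gridpt (N : nat) (x : {ffun 'I_n -> 'Z_(2 ^ N.+1)}) : 'cV[R[i]]_n :=
  \col_j dyroot N.+1 ^+ (x j : nat).

Lemma gridpt_torus N x : torus (@gridpt N x).
Proof. by move=> j; rewrite mxE normcX normc_dyroot expr1n. Qed.

Definition gridavg (N : nat) f : R :=
  (\sum_(x : {ffun 'I_n -> 'Z_(2 ^ N.+1)}) f (gridpt x)) / #|{: {ffun 'I_n -> 'Z_(2 ^ N.+1)}}|%:R.

Lemma card_grid_gt0 N : 0 < #|{: {ffun 'I_n -> 'Z_(2 ^ N.+1)}}|%:R :> R.
Proof. by rewrite ltr0n; apply/card_gt0P; exists [ffun=> 0]. Qed.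

Lemma gridavg_le N f g : (forall u, torus u -> f u <= g u) -> gridavg N f <= gridavg N g.
Proof.
move=> fg; rewrite ler_pM2r ?invr_gt0 ?card_grid_gt0//; apply: ler_sum => x _.
exact/fg/gridpt_torus.
Qed.

Lemma gridavg_cst N c : gridavg N (fun=> c) = c.
Proof. by rewrite /gridavg sumr_const -[c *+ _]mulr_natr mulfK// gt_eqF// card_grid_gt0. Qed.

Lemma gridavg_norm N f C : (forall u, torus u -> `|f u| <= C) -> `|gridavg N f| <= C.
Proof.
move=> fC; rewrite ler_norml -{1}(gridavg_cst N (- C)) -{2}(gridavg_cst N C).
by apply/andP; split; apply: gridavg_le => u /fC; rewrite ler_norml => /andP[].
Qed.

Definition bounded_on_torus f := exists C, forall u, torus u -> `|f u| <= C.

(* The mean over the torus, as the limit along a fixed ultrafilter of averages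
   over the 2^N-th roots of unity: it exists for every bounded function, and
   only the invariance under dyadic rotations is ever used. *)
Definition rmean f : R := ulim (fun N => gridavg N f).

Lemma rmeanD f g : bounded_on_torus f -> bounded_on_torus g ->
  rmean (fun u => f u + g u) = rmean f + rmean g.
Proof.
move=> [C fC] [D gD]; rewrite -(@ulimD R _ _ C D).
- by congr ulim; apply/funext => N; rewrite /gridavg big_split mulrDl.
- by move=> k; apply: gridavg_norm.
- by move=> k; apply: gridavg_norm.
Qed.

Lemma rmeanZ c f : bounded_on_torus f -> rmean (fun u => c * f u) = c * rmean f.
Proof.
move=> [C fC]; rewrite -(@ulimZ R _ C).
- by congr ulim; apply/funext => N; rewrite /gridavg -mulr_sumr mulrA.
- by move=> k; apply: gridavg_norm.
Qed.

Lemma rmean_le f g : bounded_on_torus f -> bounded_on_torus g ->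
  (forall u, torus u -> f u <= g u) -> rmean f <= rmean g.
Proof.
move=> [C fC] [D gD] fg; apply: (@ulim_le R _ _ C D) => k.
- exact: gridavg_norm.
- exact: gridavg_norm.
- exact: gridavg_le.
Qed.

Lemma rmean_cst c : rmean (fun=> c) = c.
Proof.
rewrite /rmean (_ : (fun N => _) = fun=> c) ?ulim_cst//.
by apply/funext => N; apply: gridavg_cst.
Qed.

Lemma rmean_eq f g : (forall u, torus u -> f u = g u) -> rmean f = rmean g.
Proof.
move=> fg; congr ulim; apply/funext => N; congr (_ / _).
by apply: eq_bigr => x _; apply/fg/gridpt_torus.
Qed.

Definition rot (j : 'I_n) (a : R[i]) u : 'cV[R[i]]_n :=
  \col_k (if k == j then a * u k 0 else u k 0).

Lemma rot_torus j a u : normc a = 1 -> torus u -> torus (rot j a u).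
Proof. by move=> a1 u1 k; rewrite mxE; case: eqP => _; rewrite ?normcM ?a1 ?u1 ?mulr1. Qed.

(** Once N >= k, a rotation by a 2^k-th root of unity translates the grid (Z / 2^(N+1))^n; the
    finitely many other N do not affect the limit. *)
Lemma rmean_rot j k (c : nat) f : rmean (fun u => f (rot j (dyroot k ^+ c) u)) = rmean f.
Proof.
apply: (@ulim_eventually _ _ _ k) => N kN; congr (_ / _).
pose m := (c * 2 ^ (N.+1 - k))%N.
have kN' : (k <= N.+1)%N by rewrite ltnW.
have -> : dyroot k ^+ c = dyroot N.+1 ^+ m :> R[i].
  rewrite /m mulnC exprM; congr (_ ^+ c).
    by rewrite -[in dyroot N.+1](subnKC kN') dyroot_pow.
pose y : {ffun 'I_n -> 'Z_(2 ^ N.+1)} := [ffun k => if k == j then m%:R else 0].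
rewrite [RHS](reindex_inj (addIr y)); apply: eq_bigr => x _; congr f.
apply/matrixP => l i; rewrite !mxE !ffunE; case: (l == j); last by rewrite addr0.
have p1 : (1 < 2 ^ N.+1)%N by rewrite -[X in (X < _)%N](expn0 2) ltn_exp2l.
have modE a : dyroot N.+1 ^+ (a %% (Zp_trunc (2 ^ N.+1)).+2)%N = dyroot N.+1 ^+ a :> R[i].
  by rewrite Zp_cast// expr_mod// dyroot_exp.
by rewrite /= modE exprD (val_Zp_nat p1) expr_mod ?dyroot_exp// mulrC.
Qed.

End Mean.

Section CMean.
Context {R : realType} {n : nat}.
Implicit Types (u v : 'cV[R[i]]_n) (f g : 'cV[R[i]]_n -> R) (F G : 'cV[R[i]]_n -> R[i]).
Local Notation torus := (@torus R n).

Lemma norm_Re_le (z : R[i]) : `|complex.Re z| <= normc z.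
Proof. by have := normc_ge_Re z; rewrite normc_norm lecR. Qed.

Lemma norm_Im_le (z : R[i]) : `|complex.Im z| <= normc z.
Proof.
by case: z => a b; rewrite /normc/= -sqrtr_sqr ler_wsqrtr// lerDr sqr_ge0.
Qed.

Lemma normc_le_ReIm (a b : R) : normc (a +i* b) <= `|a| + `|b|.
Proof.
rewrite /normc -[leRHS]ger0_norm ?addr_ge0// -sqrtr_sqr ler_wsqrtr//.
by rewrite sqrrD !real_normK ?num_real// lerD2r lerDl mulrn_wge0// mulr_ge0.
Qed.

Definition cbounded F := exists C, forall u, torus u -> normc (F u) <= C.

Lemma cbounded_Re F : cbounded F -> bounded_on_torus (fun u => complex.Re (F u)).
Proof. by move=> [C FC]; exists C => u /FC; apply: le_trans; apply: norm_Re_le. Qed.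

Lemma cbounded_Im F : cbounded F -> bounded_on_torus (fun u => complex.Im (F u)).
Proof. by move=> [C FC]; exists C => u /FC; apply: le_trans; apply: norm_Im_le. Qed.

Lemma cboundedD F G : cbounded F -> cbounded G -> cbounded (fun u => F u + G u).
Proof.
move=> [C FC] [D GD]; exists (C + D) => u tu.
by apply: le_trans (le_normcD _ _) _; rewrite lerD ?FC ?GD.
Qed.

Lemma cboundedM F G : cbounded F -> cbounded G -> cbounded (fun u => F u * G u).
Proof.
move=> [C FC] [D GD]; exists (C * D) => u tu.
by rewrite normcM ler_pM ?normc_ge0 ?FC ?GD.
Qed.

Lemma cbounded_cst c : cbounded (fun=> c).
Proof. by exists (normc c). Qed.

Lemma cbounded_sum (I : Type) (r : seq I) (P : pred I) (F : I -> 'cV[R[i]]_n -> R[i]) :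
  (forall i, P i -> cbounded (F i)) -> cbounded (fun u => \sum_(i <- r | P i) F i u).
Proof.
move=> FP; elim: r => [|i r IH].
  by under eq_fun do rewrite big_nil; apply: cbounded_cst.
have [/FP Fi|nPi] := boolP (P i); last by under eq_fun do rewrite big_cons (negbTE nPi).
under eq_fun do rewrite big_cons.
case: (P i) => //.
exact: cboundedD.
Qed.

Lemma cbounded_conj F : cbounded F -> cbounded (fun u => Num.conj (F u)).
Proof. by move=> [C FC]; exists C => u /FC; rewrite normc_conj. Qed.

Definition mean F : R[i] :=
  rmean (fun u => complex.Re (F u)) +i* rmean (fun u => complex.Im (F u)).

Lemma mean_eq F G : (forall u, torus u -> F u = G u) -> mean F = mean G.
Proof. by move=> FG; congr (_ +i* _); apply: rmean_eq => u /FG ->. Qed.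

Lemma mean_real g : mean (fun u => (g u)%:C) = (rmean g)%:C.
Proof. by rewrite /mean /= rmean_cst. Qed.

Lemma mean_cst c : mean (fun=> c) = c.
Proof. by case: c => a b; rewrite /mean !rmean_cst. Qed.

Lemma meanD F G : cbounded F -> cbounded G -> mean (fun u => F u + G u) = mean F + mean G.
Proof.
move=> bF bG; rewrite /mean; simpc; rewrite -!rmeanD;
  do 1?[exact: cbounded_Re|exact: cbounded_Im].
by congr (_ +i* _); apply: rmean_eq => u _; case: (F u) (G u) => [a b] [].
Qed.

Lemma meanZ (c : R[i]) F : cbounded F -> mean (fun u => c * F u) = c * mean F.
Proof.
move=> bF; case: c => a b; rewrite /mean; simpc.
have bRe := cbounded_Re bF; have bIm := cbounded_Im bF.
have bZ x f : bounded_on_torus f -> bounded_on_torus (fun u : 'cV[R[i]]_n => x * f u).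
  by move=> [C fC]; exists (`|x| * C) => u /fC fu; rewrite normrM ler_wpM2l.
rewrite -mulNr -!rmeanZ// -!rmeanD; do 1?[exact: bZ].
by congr (_ +i* _); apply: rmean_eq => u _; case: (F u) => x y /=; rewrite ?mulNr// addrC.
Qed.

Lemma mean_sum (I : Type) (r : seq I) (P : pred I) (F : I -> 'cV[R[i]]_n -> R[i]) :
  (forall i, P i -> cbounded (F i)) ->
  mean (fun u => \sum_(i <- r | P i) F i u) = \sum_(i <- r | P i) mean (F i).
Proof.
move=> bF; elim: r => [|i r IH].
  by under eq_fun do rewrite big_nil; rewrite big_nil mean_cst.
rewrite big_cons -IH; have [Pi|nPi] := boolP (P i); last first.
  by apply: mean_eq => u _; rewrite big_cons (negbTE nPi).
rewrite -meanD//; [|exact: bF|exact: cbounded_sum].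
by apply: mean_eq => u _; rewrite big_cons Pi.
Qed.

Lemma mean_conj F : cbounded F -> mean (fun u => Num.conj (F u)) = Num.conj (mean F).
Proof.
move=> bF; rewrite /mean /=; congr (_ +i* _).
  by apply: rmean_eq => u _; case: (F u).
rewrite -mulN1r -rmeanZ; last exact: cbounded_Im.
by apply: rmean_eq => u _; rewrite mulN1r; case: (F u).
Qed.

Lemma mean_rot j k (c : nat) F : mean (fun u => F (rot j (dyroot k ^+ c) u)) = mean F.
Proof.
congr (_ +i* _); first exact: rmean_rot j k c (fun u => complex.Re (F u)).
exact: rmean_rot j k c (fun u => complex.Im (F u)).
Qed.

(** The real and the imaginary part are bounded separately, whence the factor 2. *)
Lemma mean_le F g : bounded_on_torus g -> (forall u, torus u -> normc (F u) <= g u) ->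
  normc (mean F) <= 2 * rmean g.
Proof.
move=> bg Fg; apply: le_trans (normc_le_ReIm _ _) _.
have [C gC] := bg.
have bF : cbounded F.
  by exists C => u tu; apply: le_trans (le_trans (ler_norm _) (gC u tu)); apply: Fg.
have bNg : bounded_on_torus (fun u => -1 * g u) by exists C => u /gC; rewrite mulN1r normrN.
have aux f : (forall u, torus u -> `|f u| <= normc (F u)) -> bounded_on_torus f -> `|rmean f| <= rmean g.
  move=> fF bf; rewrite ler_norml -mulN1r -rmeanZ//; apply/andP; split; apply: rmean_le => // u tu.
    by rewrite mulN1r; have := le_trans (fF u tu) (Fg u tu); rewrite ler_norml => /andP[].
  by have := le_trans (fF u tu) (Fg u tu); rewrite ler_norml => /andP[].
rewrite mulr_natl mulr2n lerD// aux//; do 1?[exact: cbounded_Re|exact: cbounded_Im].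
- by move=> u _; apply: norm_Re_le.
- by move=> u _; apply: norm_Im_le.
Qed.

Lemma mean_le_cst F C : (forall u, torus u -> normc (F u) <= C) -> normc (mean F) <= 2 * C.
Proof.
move=> FC; rewrite -[C in _ * C](@rmean_cst R n); apply: mean_le FC.
by exists `|C|.
Qed.

Implicit Type (a : 'I_n -> int).

Definition chi a u : R[i] := \prod_j u j 0 ^ a j.

Lemma torus_neq0 u j : torus u -> u j 0 != 0.
Proof.
by move=> tu; apply/eqP => u0; have := tu j; rewrite u0 normc0 => /esym/eqP; rewrite oner_eq0.
Qed.

Lemma normc_chi a u : torus u -> normc (chi a u) = 1.
Proof.
move=> tu; rewrite /chi; elim/big_ind: _ => [|x y|j _]; first exact: normc1.
  by rewrite normcM => -> ->; rewrite mulr1.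
by case: (a j) => k /=; rewrite ?[_ ^ Posz _]/exprz ?[_ ^ Negz _]/exprz ?normcV ?normcX tu expr1n ?invr1.
Qed.

Lemma cbounded_chi a : cbounded (chi a).
Proof. by exists 1 => u /normc_chi ->. Qed.

Lemma chiD a b u : torus u -> chi (fun j => a j + b j) u = chi a u * chi b u.
Proof.
move=> tu; rewrite /chi -big_split; apply: eq_bigr => j _.
by rewrite expfzDr// torus_neq0.
Qed.

Lemma chi0 u : chi (fun=> 0) u = 1.
Proof. by rewrite /chi big1. Qed.

Lemma conj_unit (z : R[i]) : normc z = 1 -> Num.conj z = z^-1.
Proof. by move=> z1; rewrite invC_norm normc_norm z1 expr1n invr1 mul1r. Qed.

Lemma conj_chi a u : torus u -> Num.conj (chi a u) = chi (fun j => - a j) u.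
Proof.
move=> tu; rewrite conj_unit ?normc_chi//.
rewrite -[LHS]mulr1 -(chi0 u) -[X in _ * chi X u](_ : (fun j => a j + - a j) = _); last first.
  by apply/funext => j; rewrite subrr.
rewrite chiD// mulKf//; apply/eqP => c0.
by have := normc_chi a tu; rewrite c0 normc0 => /esym/eqP; rewrite oner_eq0.
Qed.

(** Halving m until it is odd reduces to the root -1; each halving is undone by passing to the next
    dyadic root. *)
Lemma dyroot_nontriv (m : nat) : (0 < m)%N -> exists k, dyroot k ^+ m != 1 :> R[i].
Proof.
have neq : -1 != 1 :> R[i] by rewrite -subr_eq0 -opprD oppr_eq0 -(natrD _ 1 1) pnatr_eq0.
elim/ltn_ind: m => m IH m0; have [mo|me] := boolP (odd m).
  by exists 1%N; have := @dyroot_half R 0; rewrite expn0 expr1 => ->; rewrite -signr_odd mo expr1.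
have mE : m = m./2.*2 by rewrite -[LHS]odd_double_half (negbTE me).
have [||k kP] := IH m./2; [by lia|by lia|].
by exists k.+1; rewrite mE -mul2n exprM -[2%N]expn1 -addn1 dyroot_pow.
Qed.

Lemma chi_rot a j c u : c != 0 -> torus u -> chi a (rot j c u) = c ^ a j * chi a u.
Proof.
move=> c0 tu; rewrite /chi (bigD1 j)//= [in RHS](bigD1 j)//= mulrA; congr (_ * _).
  by rewrite mxE eqxx exprzMl ?unitfE ?torus_neq0.
by apply: eq_bigr => k /negbTE kj; rewrite mxE kj.
Qed.

(** Orthogonality of characters: if a_j <> 0, rotating the j-th coordinate by a dyadic root c with
    c^(a_j) <> 1 preserves the mean but also multiplies it by c^(a_j), so it is 0. *)
Lemma mean_chi a : mean (chi a) = [forall j, a j == 0]%:R.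
Proof.
case: forallP => [a0|/existsNP[j /eqP aj]].
  by rewrite (@mean_eq _ (fun=> 1)) ?mean_cst// => u _; rewrite /chi big1// => j _; rewrite (eqP (a0 j)).
have [k kP] : exists k, dyroot k ^ a j != 1 :> R[i].
  case: (a j) aj => m m0.
    by have [|k kP] := @dyroot_nontriv m; [case: m m0|exists k].
  by have [//|k kP] := @dyroot_nontriv m.+1; exists k; rewrite /exprz invr_eq1.
have d0 : dyroot k != 0 :> R[i] by apply: cis_neq0.
have := mean_rot j k 1 (chi a); rewrite expr1.
rewrite (@mean_eq _ (fun u => dyroot k ^ a j * chi a u)); last first.
  by move=> u tu; rewrite chi_rot.
rewrite meanZ; last exact: cbounded_chi.
move/eqP; rewrite -subr_eq0 -[X in _ - X]mul1r -mulrBl mulf_eq0 subr_eq0 (negbTE kP) /=.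
by move/eqP.
Qed.

End CMean.

(** * Uniqueness of Fourier coefficients *)

Section FourierUniqueness.
Context {R : realType} {n : nat}.
Implicit Types (u v : 'cV[R[i]]_n) (F G : 'cV[R[i]]_n -> R[i]).
Local Notation torus := (@torus R n).

Lemma bernoulli (h : R) L : 0 <= h -> 1 + L%:R * h <= (1 + h) ^+ L.
Proof.
move=> h0; elim: L => [|L IH]; first by rewrite expr0 mul0r addr0.
have h1 : 0 <= 1 + h by rewrite addr_ge0.
have := ler_wpM2l h1 IH; rewrite -exprS; apply: le_trans.
have : 0 <= L%:R * (h * h) by rewrite !mulr_ge0// ler0n.
by rewrite -natr1; set l := L%:R; lra.
Qed.

(** By Bernoulli, rho^L <= 1 / (1 + L h) with h = 1 / rho - 1. For M = (p + 1) L, p of the p + 1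
    factors rho^L absorb (M + 1)^p and the last one makes the product small. *)
Lemma exp_beats_poly (p : nat) (rho e : R) : 0 <= rho < 1 -> 0 < e ->
  exists M : nat, M.+1%:R ^+ p * rho ^+ M <= e.
Proof.
wlog r0 : rho / 0 < rho => [H|].
  move=> /andP[r0 r1] e0; have [||M MP] := H (Num.max rho (1 / 2)) _ _ e0.
  - by rewrite lt_max orbC divr_gt0.
  - by apply/andP; split; [rewrite le_max r0|rewrite gt_max r1/=; lra].
  - exists M; apply: le_trans MP; rewrite ler_wpM2l ?exprn_ge0//.
    by rewrite lerXn2r ?nnegrE// le_max ?r0// lexx.
move=> /andP[_ r1] e0; pose h := rho^-1 - 1.
have h0 : 0 < h by rewrite subr_gt0 invf_gt1.
have rL L : rho ^+ L <= (1 + L%:R * h)^-1.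
  have := bernoulli L (ltW h0); rewrite {2}/h addrC [1 + (_ - _)]addrC subrK exprVn [_ + 1]addrC => hL.
  rewrite -[leLHS]invrK lef_pV2 ?posrE ?invr_gt0 ?exprn_gt0//.
  by rewrite ltr_wpDr// mulr_ge0 ?ler0n// ltW.
pose B := p.+1%:R * (1 + h^-1).
have B0 : 0 <= B by rewrite mulr_ge0 ?ler0n// addr_ge0// invr_ge0 ltW.
have [L LP] : exists L : nat, B ^+ p <= e * (1 + L%:R * h).
  exists (Num.bound (B ^+ p / (e * h))).
  have := archi_boundP (divr_ge0 (exprn_ge0 p B0) (ltW (mulr_gt0 e0 h0))).
  rewrite ltr_pdivrMr ?mulr_gt0//; set b := _%:R => hb.
  by rewrite mulrDr mulr1 ler_wpDl ?ltW// mulrCA.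
exists (p.+1 * L)%N.
have d0 : 0 < 1 + L%:R * h by rewrite ltr_wpDr// mulr_ge0 ?ler0n// ltW.
have r0' := exprn_ge0 L (ltW r0).
have s1 : (p.+1 * L).+1%:R * rho ^+ L <= B.
  have c1 : (p.+1 * L).+1%:R <= p.+1%:R * L.+1%:R :> R.
    by rewrite -natrM ler_nat mulnS addSn ltnS leq_addl.
  apply: le_trans (ler_pM (ler0n _ _) r0' c1 (rL L)) _.
  rewrite /B -mulrA ler_wpM2l ?ler0n// ler_pdivrMr// -natr1.
  have -> : (1 + h^-1) * (1 + L%:R * h) = 1 + L%:R * h + h^-1 + L%:R by field; rewrite gt_eqF.
  have : 0 <= L%:R * h by rewrite mulr_ge0 ?ler0n// ltW.
  have : 0 < h^-1 by rewrite invr_gt0.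
  by set a := L%:R * h; lra.
have -> : rho ^+ (p.+1 * L) = (rho ^+ L) ^+ p * rho ^+ L by rewrite mulnC exprM exprSr.
rewrite mulrA -exprMn.
apply: le_trans (ler_pM _ r0' (lerXn2r p _ _ s1) (rL L)) _; rewrite ?nnegrE//.
- by rewrite exprn_ge0// mulr_ge0// ler0n.
- by rewrite mulr_ge0// ler0n.
- by rewrite ler_pdivrMr.
Qed.

(** Cauchy-Schwarz against the constant vector, from the sum of squared deviations from the
    average. *)
Lemma sqr_sum_le (I : finType) (x : I -> R) :
  (\sum_i x i) ^+ 2 <= #|I|%:R * \sum_i x i ^+ 2.
Proof.
have [/eqP I0|] := eqVneq #|I| 0%N.
  by rewrite !big1 ?mulr0 ?expr0n// => i; move: I0; rewrite (cardD1 i).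
rewrite -lt0n -(ltr0n R) => N0; set S := \sum_i x i; set N := _%:R in N0 *.
have : 0 <= \sum_i (x i - S / N) ^+ 2 by apply: sumr_ge0 => i _; apply: sqr_ge0.
under eq_bigr do rewrite sqrrB; rewrite big_split/= sumrB sumr_const.
rewrite sumrMnl -mulr_suml -/S -[_ *+ #|I|]mulr_natl -/N => h.
rewrite -subr_ge0; have -> : N * (\sum_i x i ^+ 2) - S ^+ 2 = N * ((\sum_i x i ^+ 2) - S * (S / N) *+ 2 + N * (S / N) ^+ 2).
  by field; rewrite gt_eqF.
by rewrite mulr_ge0// ltW.
Qed.

(** Parseval computes the mean as the sum of the |a_i|^2; the value at [v] is at most the sum of the
    |a_i|, which Cauchy-Schwarz compares with it. *)
Lemma trigpoly_le (I : finType) (a : I -> R[i]) (g : I -> 'I_n -> int) v :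
  (forall i k, i != k -> exists j, g i j != g k j) -> torus v ->
  normc (\sum_i a i * chi (g i) v) ^+ 2 <=
  #|I|%:R * rmean (fun u => normc (\sum_i a i * chi (g i) u) ^+ 2).
Proof.
move=> gP tv.
have -> : rmean (fun u => normc (\sum_i a i * chi (g i) u) ^+ 2) = \sum_i normc (a i) ^+ 2.
  apply: complexI; rewrite -mean_real.
  transitivity (mean (fun u : 'cV[R[i]]_n => \sum_i \sum_k (a i * Num.conj (a k)) * chi (fun j => g i j - g k j) u)).
    apply: mean_eq => u tu; rewrite rmorphXn /= -normc_norm normCK rmorph_sum mulr_suml.
    apply: eq_bigr => i _; rewrite mulr_sumr; apply: eq_bigr => k _.
    rewrite rmorphM /= conj_chi// mulrACA; congr (_ * _).
    by rewrite (chiD (g i) (fun j => - g k j) tu).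
  have bt i k : cbounded (fun u : 'cV[R[i]]_n => a i * Num.conj (a k) * chi (fun j => g i j - g k j) u).
    by apply: cboundedM; [apply: cbounded_cst|apply: cbounded_chi].
  rewrite mean_sum; last by move=> i _; apply: cbounded_sum.
  rewrite rmorph_sum; apply: eq_bigr => i _.
  rewrite mean_sum// (bigD1 i)//= big1 ?addr0.
    rewrite meanZ; last exact: cbounded_chi.
    rewrite mean_chi (_ : [forall j, _] = true) ?mulr1 -?normCK ?rmorphXn//.
    by apply/forallP => j; rewrite subrr.
  move=> k ki; rewrite meanZ; last exact: cbounded_chi.
  rewrite mean_chi (_ : [forall j, _] = false) ?mulr0//.
  apply/negP => /forallP gik; have [|j] := gP i k _; first by rewrite eq_sym.
  by rewrite -subr_eq0 gik.
apply: le_trans (sqr_sum_le _); rewrite lerXn2r ?nnegrE ?normc_ge0 ?sumr_ge0//.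
  by move=> i _; apply: normc_ge0.
apply: le_trans (normc_sum _ _ _) _; apply: ler_sum => i _.
by rewrite normcM normc_chi// mulr1.
Qed.

Definition null F := cbounded F /\ forall a, mean (fun u => F u * chi a u) = 0.

(** Multipliers that preserve the vanishing of all Fourier coefficients: they contain the characters
    and are closed under sums and products. *)
Definition null_mult (k : 'cV[R[i]]_n -> R[i]) := forall F, null F -> null (fun u => F u * k u).

Lemma null_mult_chi (c : R[i]) a : null_mult (fun u => c * chi a u).
Proof.
move=> F [bF F0]; split.
  by apply: cboundedM => //; apply: cboundedM; [apply: cbounded_cst|apply: cbounded_chi].
move=> b; rewrite (@mean_eq _ _ _ (fun u => c * (F u * chi (fun j => a j + b j) u))).
  by rewrite meanZ ?F0 ?mulr0//; apply: cboundedM => //; apply: cbounded_chi.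
by move=> u tu; rewrite chiD//; ring.
Qed.

Lemma null_eq F G : (forall u, torus u -> F u = G u) -> null F -> null G.
Proof.
move=> FG [[C FC] F0]; split; first by exists C => u tu; rewrite -FG// FC.
by move=> a; rewrite -[RHS](F0 a); apply: mean_eq => u tu; rewrite FG.
Qed.

Lemma null_multD k l : null_mult k -> null_mult l -> null_mult (fun u => k u + l u).
Proof.
move=> hk hl F nF; have [bk k0] := hk F nF; have [bl l0] := hl F nF.
have e u : F u * k u + F u * l u = F u * (k u + l u) by rewrite mulrDr.
apply: (@null_eq (fun u => F u * k u + F u * l u)) => //; split; first exact: cboundedD.
move=> a; under eq_fun do rewrite mulrDl.
by rewrite meanD ?k0 ?l0 ?addr0//; apply: cboundedM => //; apply: cbounded_chi.
Qed.

Lemma null_multM k l : null_mult k -> null_mult l -> null_mult (fun u => k u * l u).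
Proof. by move=> hk hl F /hk/hl; apply: null_eq => u _; rewrite mulrA. Qed.

Lemma null_mult1 : null_mult (fun=> 1).
Proof. by move=> F; apply: null_eq => u _; rewrite mulr1. Qed.

Lemma null_multX k m : null_mult k -> null_mult (fun u => k u ^+ m).
Proof.
move=> hk; elim: m => [|m IH]; first exact: null_mult1.
by move=> F nF; apply: null_eq (null_multM hk IH nF) => u _; rewrite exprS.
Qed.

Lemma null_mult_prod (I : Type) (r : seq I) (k : I -> 'cV[R[i]]_n -> R[i]) :
  (forall i, null_mult (k i)) -> null_mult (fun u => \prod_(i <- r) k i u).
Proof.
move=> hk; elim: r => [|i r IH] F nF.
  by apply: null_eq (null_mult1 nF) => u _; rewrite big_nil.
by apply: null_eq (null_multM (hk i) IH nF) => u _; rewrite big_cons.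
Qed.

Definition ejint (j : 'I_n) (m : int) : 'I_n -> int := fun k => if k == j then m else 0.

Lemma chi_ejint j m u : chi (ejint j m) u = u j 0 ^ m.
Proof.
rewrite /chi (bigD1 j)//= /ejint eqxx big1 ?mulr1// => k /negbTE ->.
by rewrite expr0z.
Qed.

(* [null] is preserved by trigonometric factors, so F w has mean 0 for
   w = |prod_j ((1 + u_j conj v_j) / 2)^M|^2. This w peaks at v, where it is 1,
   and decays exponentially in M elsewhere, whereas its mean is at least
   (M+1)^(-n) by Cauchy-Schwarz on its (M+1)^n coefficients. *)
Lemma fourier_unique F v : torus v -> null F ->
  (forall e : R, 0 < e -> exists2 d, 0 < d & forall u, torus u ->
     (forall j, normc (u j 0 - v j 0) < d) -> normc (F u - F v) <= e) ->
  F v = 0.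
Proof.
move=> tv nF Fv; apply: eq0_normc; apply/eqP; rewrite eq_le normc_ge0 andbT.
have [C0 FC0] := nF.1.
pose C := Num.max C0 0; have C_ge0 : 0 <= C by rewrite le_max lexx orbT.
have FC u : torus u -> normc (F u) <= C by move=> /FC0; rewrite le_max => ->.
apply/ler_addgt0Pl => e' e'0; rewrite addr0.
pose e := e' / (2 + 8 * C).
have D0 : 0 < 2 + 8 * C by rewrite ltr_wpDr// mulr_ge0.
have e0 : 0 < e by rewrite divr_gt0.
have [d0 d00 dP0] := Fv e e0.
pose d := Num.min d0 1.
have d_gt0 : 0 < d by rewrite lt_min d00/=.
have d_le1 : d <= 1 by rewrite ge_min lexx orbT.
have dP u : torus u -> (forall j, normc (u j 0 - v j 0) < d) -> normc (F u - F v) <= e.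
  by move=> tu ud; apply: dP0 => // j; apply: lt_le_trans (ud j) _; rewrite ge_min lexx.
(* Bound for |h j u|^2 when |u_j - v_j| >= d, by the identity [hn] below. *)
pose rho := 1 - d ^+ 2 / 4.
have rho01 : 0 <= rho < 1.
  by have : d ^+ 2 <= 1 by [rewrite expr_le1// ltW]; have := exprn_gt0 2 d_gt0; rewrite /rho; lra.
have [M MP] := exp_beats_poly n rho01 e0.
(* On the torus this has modulus 1 exactly when u_j = v_j; [h'] is its conjugate there, again a
   combination of characters. *)
pose h (j : 'I_n) u := 1 / 2 + Num.conj (v j 0) / 2 * chi (ejint j 1) u.
pose h' (j : 'I_n) u := 1 / 2 + v j 0 / 2 * chi (ejint j (-1)) u.
pose p u := \prod_j h j u ^+ M.
have h'E j u : torus u -> Num.conj (h j u) = h' j u.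
  move=> tu; rewrite /h rmorphD !rmorphM fmorphV /= conj_chi// conjCK rmorph1 rmorph_nat.
  rewrite /h'; congr (_ + _ * chi _ _); apply/funext => k; rewrite /ejint.
  by case: eqP => // _; rewrite oppr0.
have nh j : null_mult (h j).
  apply: null_multD; last exact: null_mult_chi.
  move=> G nG; apply: null_eq (null_mult_chi (1 / 2) (fun=> 0) nG) => u _.
  by rewrite chi0 mulr1.
have nh' j : null_mult (h' j).
  apply: null_multD; last exact: null_mult_chi.
  move=> G nG; apply: null_eq (null_mult_chi (1 / 2) (fun=> 0) nG) => u _.
  by rewrite chi0 mulr1.
pose w u := normc (p u) ^+ 2.
have wE u : torus u -> (w u)%:C = p u * \prod_j h' j u ^+ M.
  move=> tu; rewrite rmorphXn /= -normc_norm normCK; congr (_ * _).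
  by rewrite rmorph_prod; apply: eq_bigr => j _; rewrite rmorphXn /= h'E.
have nFw : mean (fun u => F u * (w u)%:C) = 0.
  have nP : null_mult p by apply: null_mult_prod => j; apply: null_multX.
  have nP' : null_mult (fun u => \prod_j h' j u ^+ M).
    by apply: null_mult_prod => j; apply: null_multX.
  have [_ /(_ (fun=> 0)) <-] := null_multM nP nP' nF.
  by apply: mean_eq => u tu; rewrite chi0 mulr1 wE.
have hn j u : torus u -> normc (h j u) ^+ 2 = 1 - normc (u j 0 - v j 0) ^+ 2 / 4.
  move=> tu; apply: complexI; rewrite rmorphB [X in _ = _ - X]rmorphM fmorphV !rmorphXn rmorph1 rmorph_nat /=.
  rewrite -!normc_norm !normCK h'E// /h /h' !chi_ejint expr1z exprN1 rmorphB /=.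
  rewrite (conj_unit (tu j)) (conj_unit (tv j)).
  have uj := torus_neq0 j tu; have vj := torus_neq0 j tv.
  by field; apply/andP.
have hle j u : torus u -> normc (h j u) ^+ 2 <= 1.
  by move=> tu; rewrite hn// gerBl divr_ge0// exprn_ge0// normc_ge0.
have wprod u : w u = \prod_j (normc (h j u) ^+ 2) ^+ M.
  rewrite /w /p; elim/big_rec2: _ => [|j y z _ <-]; first by rewrite normc1 expr1n.
  by rewrite normcM normcX exprMn -!exprM mulnC.
have w1 u : torus u -> w u <= 1.
  move=> tu; rewrite wprod; apply: prodr_ile1 => j _.
  by rewrite exprn_ge0 ?exprn_ge0 ?normc_ge0//= exprn_ile1 ?hle// exprn_ge0 ?normc_ge0.
have wfar u j : torus u -> d <= normc (u j 0 - v j 0) -> w u <= rho ^+ M.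
  move=> tu dj; rewrite wprod (bigD1 j)//= -[leRHS]mulr1; apply: ler_pM.
  - by rewrite exprn_ge0 ?exprn_ge0 ?normc_ge0.
  - by apply: prodr_ge0 => k _; rewrite exprn_ge0 ?exprn_ge0 ?normc_ge0.
  - have rho0 : 0 <= rho by case/andP: rho01.
    rewrite lerXn2r ?nnegrE ?exprn_ge0 ?normc_ge0// hn// /rho lerB// ler_pM2r//.
    by rewrite lerXn2r ?nnegrE ?normc_ge0// ltW.
  - apply: prodr_ile1 => k _.
    by rewrite exprn_ge0 ?exprn_ge0 ?normc_ge0//= exprn_ile1 ?hle// exprn_ge0 ?normc_ge0.
have pv : p v = 1.
  rewrite /p big1// => j _; rewrite /h chi_ejint expr1z mulrAC (conj_unit (tv j)).
  by rewrite mulVf ?torus_neq0// -mulrDl -(natrD _ 1 1) divff ?expr1n// pnatr_eq0.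
pose A := rmean w.
have A_ge : 1 <= M.+1%:R ^+ n * A.
  (* Binomial expansion of p into (M + 1)^n distinct characters: as p(v) = 1, [trigpoly_le] bounds
     the mean of w from below. *)
  pose a (k : {ffun 'I_n -> 'I_M.+1}) : R[i] :=
    \prod_j ((1 / 2) ^+ (M - k j) * (Num.conj (v j 0) / 2) ^+ k j *+ 'C(M, k j)).
  pose g (k : {ffun 'I_n -> 'I_M.+1}) (j : 'I_n) : int := (k j : nat)%:Z.
  have pE u : p u = \sum_k a k * chi (g k) u.
    rewrite /p; under eq_bigr do rewrite /h chi_ejint expr1z exprDn.
    rewrite bigA_distr_bigA; apply: eq_bigr => k _.
    rewrite /a /chi -big_split; apply: eq_bigr => j _.
    by rewrite /= [(_ * u j 0) ^+ _]exprMn mulrA mulrnAl.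
  have gP k k' : k != k' -> exists j, g k j != g k' j.
    move=> kk; apply: contrapT => /forallNP H; case/eqP: kk; apply/ffunP => j.
    by apply/val_inj/eqP; have /negP := H j; rewrite negbK /g eqz_nat.
  have := @trigpoly_le _ a g v gP tv; rewrite -pE pv normc1 expr1n card_ffun !card_ord natrX.
  by rewrite /A /w; under [in X in _ -> X]eq_fun do rewrite pE.
have bw : bounded_on_torus w.
  by exists 1 => u tu; rewrite ger0_norm ?w1// exprn_ge0 ?normc_ge0.
have bew : bounded_on_torus (fun u => e * w u).
  by exists e => u tu; rewrite normrM (gtr0_norm e0) ler_piMr ?(ltW e0)// ger0_norm ?w1// exprn_ge0 ?normc_ge0.
have rM0 : 0 <= rho ^+ M by rewrite exprn_ge0//; case/andP: rho01.
have bc : bounded_on_torus (fun _ : 'cV[R[i]]_n => 2 * C * rho ^+ M) by exists `|2 * C * rho ^+ M|.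
have bcw : cbounded (fun u => (w u)%:C).
  by exists 1 => u tu; rewrite normc_real ger0_norm ?w1// exprn_ge0 ?normc_ge0.
have main : normc (F v) * A <= 2 * (e * A + 2 * C * rho ^+ M).
  have -> : e * A + 2 * C * rho ^+ M = rmean (fun u => e * w u + 2 * C * rho ^+ M).
    by rewrite rmeanD// rmeanZ// rmean_cst.
  have A0 : 0 <= A.
    have : 0 < M.+1%:R ^+ n :> R by rewrite exprn_gt0// ltr0n.
    move: A_ge; set N := _ ^+ n; nra.
  rewrite -[A in leLHS](ger0_norm A0) -normc_real -mean_real -normcM -meanZ//.
  have -> : mean (fun u => F v * (w u)%:C) = - mean (fun u => F u * (w u)%:C + (- F v) * (w u)%:C).
    have b1 : cbounded (fun u => F u * (w u)%:C) by exact: (cboundedM nF.1 bcw).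
    have b2 : cbounded (fun u => - F v * (w u)%:C) by exact: (cboundedM (cbounded_cst _) bcw).
    by rewrite meanD// nFw add0r !meanZ// mulNr opprK.
  rewrite normcN; apply: mean_le.
    case: bew bc => [a ha] [b hb]; exists (a + b) => u tu.
    by apply: le_trans (ler_normD _ _) _; apply: lerD; [exact: ha|exact: (hb u tu)].
  move=> u tu; rewrite -mulrDl normcM normc_real ger0_norm; last by rewrite exprn_ge0 ?normc_ge0.
  have w0 : 0 <= w u by rewrite exprn_ge0 ?normc_ge0.
  have [near|/existsNP[j /negP]] := pselect (forall j, normc (u j 0 - v j 0) < d).
    apply: ler_wpDr; first by rewrite !mulr_ge0.
    by rewrite ler_wpM2r// dP.
  rewrite -leNgt => /(wfar _ _ tu) wr; apply: ler_wpDl; first by rewrite mulr_ge0// ltW.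
  apply: ler_pM; rewrite ?normc_ge0//.
  by apply: le_trans (le_normcD _ _) _; rewrite normcN mulr_natl mulr2n lerD// FC.
have N0 : 0 <= M.+1%:R ^+ n :> R by rewrite exprn_ge0// ler0n.
have h1 := ler_wpM2l N0 main.
have : normc (F v) <= 2 * e + 4 * C * e.
  set N := M.+1%:R ^+ n in A_ge MP N0 h1; set f := normc (F v) in h1 *.
  have B0 : 0 < N * A by apply: lt_le_trans A_ge.
  rewrite -(ler_pM2r B0).
  have : 4 * C * (N * rho ^+ M) <= 4 * C * e * (N * A).
    rewrite -[leLHS]mulr1 -mulrA -[leRHS]mulrA ler_wpM2l ?mulr_ge0// ler_pM ?mulr_ge0//.
  by move: h1; set r := rho ^+ M; lra.
have -> : e' = e * (2 + 8 * C) by rewrite divfK// gt_eqF.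
have : 0 <= C * e by rewrite mulr_ge0// ltW.
by lra.
Qed.
End FourierUniqueness.

(** * Holomorphy near the sphere *)

Section Holomorphic.
Context {R : realType} {n : nat}.
Implicit Types (z w u : 'cV[R[i]]_n) (f : 'cV[R[i]]_n -> R[i]) (d e : R).

Definition close d z w := forall j, normc (w j 0 - z j 0) < d.

(** Balls over [R[i]] have radii in [R[i]]; a positive one is real, so neighbourhoods can be
    described by real radii and coordinatewise distances. *)
Lemma nbhs_close z (A : set 'cV[R[i]]_n) :
  nbhs z A <-> exists2 d, 0 < d & forall w, close d z w -> A w.
Proof.
rewrite nbhs_ballP; split => [[e /= e0 eA]|[d d0 dA]].
  have eE : (complex.Re e)%:C = e by apply: RRe_real; apply: gtr0_real.
  exists (complex.Re e); first by rewrite -ltcR eE.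
  move=> w zw; apply: eA; split => // i j; rewrite (ord1 j) /ball /= normc_norm -eE ltcR normc_distC.
  exact: zw.
exists d%:C; first by rewrite /= ltcR.
move=> w [_ zw]; apply: dA => j; have := zw j 0.
by rewrite /ball /= normc_norm ltcR normc_distC.
Qed.

Lemma close_le d e z w : d <= e -> close d z w -> close e z w.
Proof. by move=> de zw j; apply: lt_le_trans (zw j) de. Qed.

Lemma continuous_close f z : {for z, continuous f} ->
  forall e, 0 < e -> exists2 d, 0 < d & forall w, close d z w -> normc (f w - f z) <= e.
Proof.
move=> /cvgrPdist_le fz e e0.
have e0' : 0 < e%:C :> R[i] by rewrite ltcR.
have /nbhs_close[d d0 dP] := fz _ e0'.
by exists d => // w /dP; rewrite normc_norm lecR normc_distC.
Qed.

Definition setcoord z (j : 'I_n) (l : R[i]) : 'cV[R[i]]_n :=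
  \col_k (if k == j then l else z k 0).

Lemma differentiable_cdiff f z j : differentiable f z ->
  cdiff (fun l => f (setcoord z j l)) (z j 0).
Proof.
move=> df; have /cvg_ex[/= B] := @diff_derivable _ _ _ f z (delta_mx j 0) df.
move=> /cvgrPdist_le fB; exists B => e e0.
have e0' : 0 < e%:C :> R[i] by rewrite ltcR.
have /nbhs_ballP[d /= d0 dP] := fB _ e0'.
have dE : (complex.Re d)%:C = d by apply: RRe_real; apply: gtr0_real.
exists (complex.Re d); first by rewrite -ltcR dE.
move=> l; have [->|nl] := eqVneq l (z j 0).
  rewrite (_ : setcoord z j (z j 0) = z) ?subrr ?mulr0 ?subrr ?normc0 ?mulr0//.
  by apply/matrixP => k i; rewrite mxE (ord1 i); case: eqP => // ->.
move=> ld; have h0 : l - z j 0 != 0 by rewrite subr_eq0.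
have := dP (l - z j 0).
rewrite /ball /= sub0r normrN normc_norm -[X in _ < X]dE ltcR => /(_ ld h0).
have -> : (l - z j 0) *: delta_mx j 0 + z = setcoord z j l.
  apply/matrixP => k i; rewrite !mxE (ord1 i) eqxx andbT.
  by case: eqP => [->|_]; rewrite ?mulr1 ?subrK// mulr0 add0r.
rewrite normc_norm lecR => h.
have -> : setcoord z j (z j 0) = z.
  by apply/matrixP => k i; rewrite mxE (ord1 i); case: eqP => // ->.
have -> : f (setcoord z j l) - f z - B * (l - z j 0) =
    - ((B - (l - z j 0)^-1 *: (f (setcoord z j l) - f z)) * (l - z j 0)).
  by rewrite mulrBl /GRing.scale /= mulrAC mulVf// mul1r opprB.
by rewrite normcN normcM ler_wpM2r// normc_ge0.
Qed.

Definition holo_on (U : set 'cV[R[i]]_n) f :=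
  open U /\ forall z, U z -> differentiable f z.

Lemma open_close (U : set 'cV[R[i]]_n) z : open U -> U z ->
  exists2 d, 0 < d & forall w, close d z w -> U w.
Proof. by move=> oU Uz; apply/nbhs_close; apply: open_nbhs_nbhs. Qed.

(** C^n as R^(2n), where closed bounded sets are compact as closed subsets of a product of
    segments. *)
Definition cvec (x : 'rV[R]_(n + n)) : 'cV[R[i]]_n :=
  \col_j (x 0 (lshift n j) +i* x 0 (rshift n j)).

(** A Lebesgue number argument: [P d w] is a property at scale d that survives shrinking d, and the
    local scales at the points of a compact set have a common positive lower bound. *)
Lemma compact_uniform (A : set 'rV[R]_(n + n)) (P : R -> 'cV[R[i]]_n -> Prop) :
  compact A -> (forall d e z, 0 < d -> d <= e -> P e z -> P d z) ->
  (forall x, A x -> exists2 d, 0 < d & forall w, close d (cvec x) w -> P d w) ->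
  exists2 d, 0 < d & forall x, A x -> P d (cvec x).
Proof.
move=> /compact_near_coveringP cA Pmono PA.
have near_P (x : 'rV[R]_(n + n)) : A x -> \forall x' \near x & d \near 0^'+, P d (cvec x').
  move=> /PA[d d0 dP].
  near=> x' d'.
  have : P d (cvec x').
    apply: dP => j; rewrite !mxE.
    have xx : ball x (d / 2) x' by near: x'; apply: nbhsx_ballx; rewrite divr_gt0.
    have coord k : `|x' 0 k - x 0 k| < d / 2 by rewrite distrC; have [_] := xx; apply.
    simpc; apply: le_lt_trans (normc_le_ReIm _ _) _.
    by rewrite [ltRHS](splitr d) ltrD.
  apply: (Pmono d' d); first by near: d'; exact: nbhs_right_gt.
  by near: d'; apply: nbhs_right_le.
have := cA R (0^'+) (fun d x' => P d (cvec x')) _ near_P.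
move=> H; have [d [dA d0]] : exists d, A `<=` (fun x => P d (cvec x)) /\ 0 < d.
  by apply: (@filter_ex _ (0^'+)); apply: filterI; [exact: H|exact: nbhs_right_gt].
by exists d.
Unshelve. all: by end_near. Qed.


Lemma cube_compact (A : set 'rV[R]_(n + n)) c : closed A ->
  (forall x, A x -> forall k, `|x 0 k| <= c) -> compact A.
Proof.
move=> cA Ac.
have H := @rV_compact R (n + n) (fun=> `[- c, c]%classic) (fun=> @segment_compact R _ _).
apply: subclosed_compact cA H _.
by move=> x Ax k /=; have xc := Ac _ Ax k; rewrite in_itv /= -ler_norml xc.
Qed.

Definition sqlen (x : 'rV[R]_(n + n)) (j : 'I_n) : R :=
  x 0 (lshift n j) ^+ 2 + x 0 (rshift n j) ^+ 2.

Lemma sqlen_continuous j : continuous (fun x => sqlen x j).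
Proof.
rewrite (_ : sqlen^~ j = fun x : 'rV[R]_(n + n) =>
  x 0 (lshift n j) * x 0 (lshift n j) + x 0 (rshift n j) * x 0 (rshift n j)); last first.
  by apply/funext => x; rewrite /sqlen !expr2.
have cc k : continuous (fun x : 'rV[R]_(n + n) => x 0 k) by apply: coord_continuous.
by move=> x; exact: cvgD (cvgM (cc _ x) (cc _ x)) (cvgM (cc _ x) (cc _ x)).
Qed.

Lemma continuous_sum (T : topologicalType) (I : Type) (r : seq I) (g : I -> T -> R) :
  (forall i, continuous (g i)) -> continuous (fun x => \sum_(i <- r) g i x).
Proof.
move=> gc; elim: r => [|i r IH].
  by under eq_fun do rewrite big_nil; move=> x; apply: cvg_cst.
under eq_fun do rewrite big_cons; move=> x; apply: cvgD; [exact: gc|exact: IH].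
Qed.

Lemma coord_le_sqlen c (x : 'rV[R]_(n + n)) k : 0 <= c ->
  (forall j, sqlen x j <= c ^+ 2) -> `|x 0 k| <= c.
Proof.
move=> c0 xc; rewrite -(ler_pXn2r (ltn0Sn 1)) ?nnegrE// real_normK ?num_real//.
rewrite -(fintype.splitK k); case: (fintype.split k) => j; apply: le_trans (xc j); rewrite /sqlen /=.
  by rewrite lerDl sqr_ge0.
by rewrite lerDr sqr_ge0.
Qed.

Lemma torus_compact (r : 'I_n -> R) : compact [set x | forall j, sqlen x j = r j ^+ 2].
Proof.
pose c := \sum_j `|r j|.
have c0 : 0 <= c by apply: sumr_ge0.
apply: (@cube_compact _ c).
  rewrite (_ : [set x | _] = \bigcap_(j in setT) ((fun x => sqlen x j) @^-1` [set r j ^+ 2])).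
    apply: closed_bigI => j _; apply: preimage_closed; last exact: closed_eq.
    by move=> x _; apply: sqlen_continuous.
  by apply/seteqP; split => [x H j _|x H j]; apply: H.
move=> x H k; apply: coord_le_sqlen => // j; rewrite H -[leLHS]real_normK ?num_real//.
by rewrite lerXn2r ?nnegrE// /c (bigD1 j)//= lerDl sumr_ge0.
Qed.

Lemma sphere_compact : compact [set x | \sum_j sqlen x j = 1].
Proof.
apply: (@cube_compact _ 1).
  rewrite (_ : [set x | _] = (fun x => \sum_j sqlen x j) @^-1` [set 1]) //.
  apply: preimage_closed; last exact: closed_eq.
  by move=> x _; apply: continuous_sum => j; apply: sqlen_continuous.
move=> x /= H k; apply: coord_le_sqlen => // j; rewrite expr1n -H (bigD1 j)//= lerDl.
by apply: sumr_ge0 => i _; rewrite addr_ge0 ?sqr_ge0.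
Qed.

Definition vecc z : 'rV[R]_(n + n) :=
  \row_k match fintype.split k with inl j => complex.Re (z j 0) | inr j => complex.Im (z j 0) end.

Lemma veccK z : cvec (vecc z) = z.
Proof.
apply/matrixP => j i; rewrite !mxE (ord1 i).
by rewrite (unsplitK (inl j)) (unsplitK (inr j)); case: (z j 0).
Qed.

Lemma sqlen_vecc z j : sqlen (vecc z) j = normc (z j 0) ^+ 2.
Proof.
rewrite /sqlen !mxE (unsplitK (inl j)) (unsplitK (inr j)).
by case: (z j 0) => a b; rewrite /normc sqr_sqrtr// addr_ge0 ?sqr_ge0.
Qed.

Definition usphere z := \sum_j normc (z j 0) ^+ 2 = 1.

Lemma unit_sphereE z : unit_sphere n z <-> usphere z.
Proof.
rewrite /unit_sphere /usphere /=; have -> : \sum_j `|z j 0| ^+ 2 = (\sum_j normc (z j 0) ^+ 2)%:C.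
  by rewrite rmorph_sum; apply: eq_bigr => j _; rewrite rmorphXn.
by split => [/complexI|->].
Qed.

Lemma sphere_uniform (P : R -> 'cV[R[i]]_n -> Prop) :
  (forall d e z, 0 < d -> d <= e -> P e z -> P d z) ->
  (forall z, usphere z -> exists2 d, 0 < d & forall w, close d z w -> P d w) ->
  exists2 d, 0 < d & forall z, usphere z -> P d z.
Proof.
move=> Pm PS; have [] := compact_uniform sphere_compact Pm.
  move=> x /= xS; apply: PS; rewrite /usphere -[RHS]xS; apply: eq_bigr => j _.
  by rewrite -sqlen_vecc /sqlen !mxE (unsplitK (inl j)) (unsplitK (inr j)) !mxE.
move=> d d0 dP; exists d => // z zS; rewrite -(veccK z); apply: dP => /=.
by rewrite -[RHS]zS; apply: eq_bigr => j _; rewrite sqlen_vecc.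
Qed.

Lemma torus_uniform (r : 'I_n -> R) (P : R -> 'cV[R[i]]_n -> Prop) :
  (forall j, 0 <= r j) -> (forall d e z, 0 < d -> d <= e -> P e z -> P d z) ->
  (forall z, (forall j, normc (z j 0) = r j) -> exists2 d, 0 < d & forall w, close d z w -> P d w) ->
  exists2 d, 0 < d & forall z, (forall j, normc (z j 0) = r j) -> P d z.
Proof.
move=> r0 Pm PS; have [] := compact_uniform (@torus_compact r) Pm.
  move=> x /= xS; apply: PS => j; apply/eqP.
  rewrite -(eqrXn2 (ltn0Sn 1)) ?normc_ge0// -xS -sqlen_vecc; apply/eqP.
  by rewrite /sqlen !mxE (unsplitK (inl j)) (unsplitK (inr j)) !mxE.
move=> d d0 dP; exists d => // z zS; rewrite -(veccK z); apply: dP => j /=.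
by rewrite sqlen_vecc zS.
Qed.

End Holomorphic.

(** * Laurent coefficients on tori and their invariance under a change of one radius *)

Section Coefficients.
Context {R : realType} {n : nat}.
Implicit Types (z w u : 'cV[R[i]]_n) (f : 'cV[R[i]]_n -> R[i]) (d e : R) (l : R[i]).
Local Notation torus := (@torus R n).

Lemma cdiff_cst c l : cdiff (fun=> c) l.
Proof.
exists 0 => e e0; exists 1 => // l' _.
by rewrite subrr mul0r subrr normc0 mulr_ge0 ?normc_ge0 ?ltW.
Qed.

Lemma cdiff_id l : cdiff id l.
Proof.
exists 1 => e e0; exists 1 => // l' _.
by rewrite mul1r subrr normc0 mulr_ge0 ?normc_ge0 ?ltW.
Qed.

Lemma cdiff_scale (G : R[i] -> R[i]) c l : cdiff G (c * l) -> cdiff (fun x => G (c * x)) l.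
Proof.
move=> [B GB]; exists (B * c) => e e0.
have c1 : 0 < normc c + 1 by rewrite ltr_wpDl ?normc_ge0.
have [d d0 dP] := GB _ (divr_gt0 e0 c1).
exists (d / (normc c + 1)) => [|l' ll]; first by rewrite divr_gt0.
have n0 := normc_ge0 (l' - l); have c0 := normc_ge0 c.
have h : normc (c * l' - c * l) < d.
  rewrite -mulrBr normcM; rewrite ltr_pdivlMr// in ll; nra.
have := dP _ h; rewrite -mulrBr mulrA normcM => /le_trans; apply.
have -> : e / (normc c + 1) * (normc c * normc (l' - l)) =
  e * normc (l' - l) * (normc c / (normc c + 1)) by ring.
rewrite ler_piMr ?mulr_ge0 ?(ltW e0)// ler_pdivrMr// mul1r; lra.
Qed.

Lemma cdiffM (F G : R[i] -> R[i]) l : cdiff F l -> cdiff G l -> cdiff (fun x => F x * G x) l.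
Proof.
move=> [A FA] [B GB]; exists (A * G l + F l * B) => e e0.
pose b := normc B; pose a := normc A; pose M := normc (G l) + b + 1.
have b0 : 0 <= b := normc_ge0 _; have a0 : 0 <= a := normc_ge0 _.
have g0 := normc_ge0 (G l); have f0 := normc_ge0 (F l).
have M0 : 0 < M + normc (F l) by rewrite /M; lra.
pose e1 := e / (2 * (M + normc (F l))).
have e10 : 0 < e1 by rewrite divr_gt0// mulr_gt0.
have [d1 d10 d1P] := FA _ e10.
pose e2 := Num.min e1 1.
have e20 : 0 < e2 by rewrite lt_min e10/=.
have [d2 d20 d2P] := GB _ e20.
pose D := a * (b + 1) + 1.
have D0 : 0 < D by rewrite ltr_wpDl// mulr_ge0// addr_ge0.
pose d := Num.min (Num.min d1 d2) (Num.min 1 (e / (2 * D))).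
exists d; first by rewrite !lt_min d10 d20 ltr01 divr_gt0// mulr_gt0.
move=> l' ll; set h := normc (l' - l).
have h0 : 0 <= h := normc_ge0 _.
have [hd1 hd2 h1 he] : [/\ h < d1, h < d2, h < 1 & h < e / (2 * D)].
  by move: ll; rewrite -/h !lt_min => /andP[/andP[-> ->] /andP[-> ->]].
have F1 := d1P _ hd1; have G1 := d2P _ hd2.
rewrite -/h in F1 G1.
have G2 : normc (G l' - G l) <= (b + 1) * h.
  rewrite -[G l' - G l](subrK (B * (l' - l))); apply: le_trans (le_normcD _ _) _.
  rewrite normcM -/b -/h; apply: le_trans (lerD G1 (lexx _)) _.
  rewrite -mulrDl ler_wpM2r// addrC lerD2l ge_min lexx orbT//.
have G3 : normc (G l') <= M.
  rewrite -[G l'](subrK (G l)); apply: le_trans (le_normcD _ _) _; rewrite /M; nra.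
have -> : F l' * G l' - F l * G l - (A * G l + F l * B) * (l' - l) =
  (F l' - F l - A * (l' - l)) * G l' + F l * (G l' - G l - B * (l' - l)) +
  A * (l' - l) * (G l' - G l) by ring.
apply: le_trans (le_normcD _ _) _; apply: le_trans (lerD (le_normcD _ _) (lexx _)) _.
rewrite !normcM -/a -/h.
have t1 := ler_pM (normc_ge0 _) (normc_ge0 _) F1 G3.
have e21 : e2 <= e1 by rewrite ge_min lexx.
have t2 : normc (F l) * normc (G l' - G l - B * (l' - l)) <= normc (F l) * (e1 * h).
  by rewrite ler_wpM2l//; apply: le_trans G1 _; rewrite ler_wpM2r.
have t3 : a * h * normc (G l' - G l) <= e / 2 * h.
  apply: (@le_trans _ _ (a * h * ((b + 1) * h))); first by rewrite ler_wpM2l// mulr_ge0.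
  have -> : a * h * ((b + 1) * h) = (a * (b + 1) * h) * h by ring.
  rewrite ler_wpM2r//.
  have : h * (2 * D) < e by rewrite -ltr_pdivlMr// mulr_gt0.
  rewrite /D; set q := a * (b + 1); have : 0 <= q by rewrite mulr_ge0// addr_ge0.
  by nra.
have e1E : e1 * (M + normc (F l)) = e / 2 by rewrite /e1; field; rewrite gt_eqF.
have -> : e * h = (e1 * (M + normc (F l))) * h + e / 2 * h by rewrite e1E; field.
apply: lerD t3.
have -> : e1 * (M + normc (F l)) * h = e1 * h * M + normc (F l) * (e1 * h) by ring.
exact: lerD.
Qed.

Lemma cdiffV l : l != 0 -> cdiff (@GRing.inv _) l.
Proof.
move=> l0; exists (- l ^- 2) => e e0.
have nl : 0 < normc l.
  by rewrite lt_neqAle normc_ge0 andbT eq_sym; apply/eqP => /eq0_normc /eqP; rewrite (negbTE l0).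
exists (Num.min (normc l / 2) (e * normc l ^+ 3 / 2)).
  by rewrite lt_min !divr_gt0// mulr_gt0// exprn_gt0.
move=> l'; rewrite lt_min => /andP[h1 h2].
have hl' : normc l / 2 <= normc l'.
  have := le_normcD l' (l - l'); rewrite addrC subrK normc_distC; lra.
have l'0 : l' != 0.
  by apply/eqP => E; rewrite E normc0 in hl'; lra.
have -> : l'^-1 - l^-1 - - l ^- 2 * (l' - l) = (l' - l) ^+ 2 / (l ^+ 2 * l').
  by field; rewrite l0 l'0.
have nl' : 0 < normc l' by apply: lt_le_trans hl'; rewrite divr_gt0.
rewrite normcM normcV [normc (l ^+ 2 * l')]normcM !normcX ler_pdivrMr ?mulr_gt0 ?exprn_gt0//.
have h3 : normc (l' - l) <= e * (normc l ^+ 2 * normc l').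
  apply: le_trans (ltW h2) _; rewrite -mulrA ler_wpM2l ?(ltW e0)// exprSr -mulrA.
  by rewrite ler_wpM2l// exprn_ge0 ?normc_ge0.
rewrite mulrAC expr2 ler_wpM2r ?normc_ge0//.
Qed.

Lemma cdiff_exprz (m : int) l : l != 0 -> cdiff (fun x => x ^ m) l.
Proof.
move=> l0; have powP k : cdiff (fun x => x ^+ k) l.
  elim: k => [|k IH]; first exact: cdiff_cst.
  rewrite (_ : (fun x => x ^+ k.+1) = fun x => x * x ^+ k); first exact: cdiffM (cdiff_id l) IH.
  by apply/funext => x; rewrite exprS.
have powN k : cdiff (fun x => x^-1 ^+ k) l.
  elim: k => [|k IH]; first exact: cdiff_cst.
  rewrite (_ : (fun x => x^-1 ^+ k.+1) = fun x => x^-1 * x^-1 ^+ k); first exact: cdiffM (cdiffV l0) IH.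
  by apply/funext => x; rewrite exprS.
case: m => k; first exact: powP.
rewrite (_ : (fun x => x ^ Negz k) = fun x => x^-1 ^+ k.+1); first exact: powN.
by apply/funext => x; rewrite exprVn.
Qed.

Lemma normc_expzB1 l (m : int) : normc l = 1 -> normc (l ^ m - 1) <= `|m|%:~R * normc (l - 1).
Proof.
move=> l1; case: m => k; first exact: normc_expB1.
have l0 : l ^+ k.+1 != 0.
  by rewrite expf_neq0//; apply/eqP => E; move: l1; rewrite E normc0 => /esym/eqP; rewrite oner_eq0.
have -> : l ^ Negz k - 1 = (1 - l ^+ k.+1) / l ^+ k.+1.
  by rewrite mulrBl divff// mul1r.
rewrite normcM normcV normcX l1 expr1n invr1 mulr1 normc_distC.
exact: normc_expB1.
Qed.

Definition ptor (r : 'I_n -> R) u : 'cV[R[i]]_n := \col_k ((r k)%:C * u k 0).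

Lemma ptor_norm r u k : 0 <= r k -> torus u -> normc (ptor r u k 0) = r k.
Proof. by move=> r0 tu; rewrite mxE normcM normc_real tu mulr1 ger0_norm. Qed.

(** The mean of f(z) z^(-a) over the torus of radii [r], that is, the coefficient of z^a in a
    Laurent expansion of f there. *)
Definition coef f r (a : 'I_n -> int) : R[i] :=
  mean (fun u => f (ptor r u) * chi (fun k => - a k) u) * (\prod_k r k ^ (- a k))%:C.

Section Step.
Variables (f : 'cV[R[i]]_n -> R[i]) (U : set 'cV[R[i]]_n).
Hypothesis hf : holo_on U f.

Lemma holo_cont z : U z -> forall e, 0 < e ->
  exists2 d, 0 < d & forall w, close d z w -> normc (f w - f z) <= e.
Proof. by move=> /hf.2 df; apply: continuous_close; apply: differentiable_continuous. Qed.

Lemma holo_unif r : (forall j, 0 <= r j) -> (forall z, (forall j, normc (z j 0) = r j) -> U z) ->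
  forall e, 0 < e -> exists2 d, 0 < d & forall z w, (forall j, normc (z j 0) = r j) -> close d z w ->
    normc (f w - f z) <= e.
Proof.
move=> r0 rU e e0.
have [] := torus_uniform (P := fun d z => forall w, close d z w -> normc (f w - f z) <= e) r0.
- by move=> d d' z _ dd H w zw; apply: H; apply: close_le zw.
- move=> z /rU Uz; have [d d0 dP] := holo_cont Uz (divr_gt0 e0 (ltr0Sn _ 1)).
  have d2 : 0 < d / 2 by rewrite divr_gt0.
  exists (d / 2) => // z' zz' w z'w.
  have zw : close d z w.
    move=> j; rewrite -(subrK (z' j 0) (w j 0)) -addrA.
    by apply: le_lt_trans (le_normcD _ _) _; rewrite [ltRHS](splitr d) ltrD.
  have zz : close d z z' by apply: close_le zz'; lra.
  rewrite -(subrK (f z) (f w)) -addrA; apply: le_trans (le_normcD _ _) _.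
  by rewrite [X in _ + X]normc_distC [leRHS](splitr e) lerD ?dP.
- by move=> d d0 dP; exists d => // z w /dP; apply.
Qed.

Lemma bounded_at z : U z -> exists2 d, 0 < d & forall w, close d z w -> normc (f w) <= d^-1.
Proof.
move=> Uz; have [d d0 dP] := holo_cont Uz ltr01.
have c0 : 0 < normc (f z) + 1 by rewrite ltr_wpDl ?normc_ge0.
exists (Num.min d (normc (f z) + 1)^-1) => [|w zw].
  by rewrite lt_min d0 invr_gt0.
have zw' : close d z w by apply: close_le zw; rewrite ge_min lexx.
apply: (@le_trans _ _ (normc (f z) + 1)).
  rewrite -(subrK (f z) (f w)); apply: le_trans (le_normcD _ _) _.
  by rewrite addrC lerD2l dP.
by rewrite -[leLHS]invrK lef_pV2 ?posrE ?invr_gt0 ?lt_min ?d0 ?invr_gt0// ge_min lexx orbT.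
Qed.

Lemma holo_bounded r : (forall j, 0 <= r j) -> (forall z, (forall j, normc (z j 0) = r j) -> U z) ->
  exists M, forall z, (forall j, normc (z j 0) = r j) -> normc (f z) <= M.
Proof.
move=> r0 rU; have [] := torus_uniform (P := fun d z => normc (f z) <= d^-1) r0.
- move=> d d' z d0 dd /le_trans; apply; rewrite lef_pV2 ?posrE//.
  exact: lt_le_trans dd.
- by move=> z /rU; apply: bounded_at.
- by move=> d d0 dP; exists d^-1.
Qed.

Lemma holo_bounded_sphere : (forall z, usphere z -> U z) ->
  exists M, forall z, usphere z -> normc (f z) <= M.
Proof.
move=> rU; have [] := sphere_uniform (P := fun d z => normc (f z) <= d^-1).
- move=> d d' z d0 dd /le_trans; apply; rewrite lef_pV2 ?posrE//.
  exact: lt_le_trans dd.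
- by move=> z /rU; apply: bounded_at.
- by move=> d d0 dP; exists d^-1.
Qed.

Lemma rotM j a b u : rot j a (rot j b u) = rot j (a * b) u.
Proof. by apply/matrixP => k i; rewrite !mxE; case: eqP => _ //; rewrite mulrA. Qed.

(** Rotating one coordinate replaces a mean over the torus by a mean of circle sums, the quantities
    that [goursat] controls. *)
Lemma mean_avg j N (F : 'cV[R[i]]_n -> R[i]) : cbounded F ->
  mean F = (2 ^+ N)^-1 * mean (fun u => \sum_(b < (2 ^ N)%N) F (rot j (dyroot N ^+ b) u)).
Proof.
move=> [C FC]; rewrite mean_sum.
  under eq_bigr do rewrite mean_rot.
  by rewrite sumr_const card_ord -[mean F *+ _]mulr_natl natrX mulKf// expf_neq0.
by move=> b _; exists C => u tu; apply: FC; apply: rot_torus => //; rewrite normcX normc_dyroot expr1n.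
Qed.

Lemma sum_ord_mul (V : nmodType) (a b : nat) (F : nat -> V) :
  \sum_(i < (a * b)%N) F i = \sum_(i < a) \sum_(k < b) F (i * b + k)%N.
Proof.
elim: a => [|a IH]; first by rewrite !big_ord0.
rewrite [RHS]big_ord_recr /= -IH -!(big_mkord xpredT) mulSnr.
rewrite (@big_cat_nat _ _ _ (a * b))//= ?leq_addr//; congr (_ + _).
rewrite -{1}[(a * b)%N]add0n big_addn addKn big_mkord.
by apply: eq_bigr => k _; rewrite addnC.
Qed.

(** [goursat] holds from some N on that depends on the point u, whereas a mean over u requires one
    grid. Uniform continuity replaces the fine sum by a multiple of a coarse one with k independent
    of u, every fine root lying on an arc of angle 2 pi / 2^k that starts at a coarse root. *)
Lemma avg_refine j k N (F : 'cV[R[i]]_n -> R[i]) e : (k <= N)%N ->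
  (forall u c, torus u -> normc c = 1 -> normc (c - 1) <= 2 * pi / 2 ^+ k ->
     normc (F (rot j c u) - F u) <= e) ->
  forall u, torus u ->
  normc (\sum_(b < (2 ^ N)%N) F (rot j (dyroot N ^+ b) u) -
         2 ^+ (N - k) * \sum_(b < (2 ^ k)%N) F (rot j (dyroot k ^+ b) u)) <= 2 ^+ N * e.
Proof.
move=> kN Fe u tu.
have -> : (2 ^ N = 2 ^ k * 2 ^ (N - k))%N by rewrite -expnD subnKC.
rewrite (sum_ord_mul _ _ (fun b => F (rot j (dyroot N ^+ b) u))) mulr_sumr -sumrB.
have dN b a : dyroot N ^+ (b * 2 ^ (N - k) + a)%N = dyroot N ^+ a * dyroot k ^+ b :> R[i].
  by rewrite addnC exprD mulnC exprM -{2}(subnKC kN) dyroot_pow.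
apply: le_trans (normc_sum _ _ _) _.
apply: (@le_trans _ _ (\sum_(b < (2 ^ k)%N) 2 ^+ (N - k) * e)); last first.
  by rewrite sumr_const card_ord -[_ *+ (2 ^ k)%N]mulr_natl natrX mulrA -exprD subnKC.
apply: ler_sum => b _; set u' := rot j (dyroot k ^+ b) u.
have tu' : torus u' by apply: rot_torus => //; rewrite normcX normc_dyroot expr1n.
have -> : 2 ^+ (N - k) * F u' = \sum_(a < (2 ^ (N - k))%N) F u'.
  by rewrite sumr_const card_ord -[_ *+ (2 ^ _)%N]mulr_natl natrX.
rewrite -sumrB; apply: le_trans (normc_sum _ _ _) _.
apply: (@le_trans _ _ (\sum_(a < (2 ^ (N - k))%N) e)); last first.
  by rewrite sumr_const card_ord -[_ *+ (2 ^ _)%N]mulr_natl natrX.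
apply: ler_sum => a _; rewrite dN -rotM; apply: Fe => //.
  by rewrite normcX normc_dyroot expr1n.
apply: le_trans (normc_expB1 _ (normc_dyroot _)) _.
apply: (@le_trans _ _ ((2 ^ (N - k))%N%:R * (2 * pi / 2 ^+ N))).
  by apply: ler_pM; rewrite ?ler0n ?normc_ge0 ?ler_nat ?(ltnW (ltn_ord a)) ?dyrootB1_le.
have -> : 2 ^+ N = 2 ^+ k * 2 ^+ (N - k) :> R by rewrite -exprD subnKC.
rewrite natrX le_eqVlt; apply/orP; left; apply/eqP; field.
by rewrite !expf_neq0.
Qed.

End Step.
End Coefficients.

Section CoefStep.
Context {R : realType} {n : nat}.
Implicit Types (z w u : 'cV[R[i]]_n) (d e : R) (l : R[i]).
Local Notation torus := (@torus R n).
Variables (f : 'cV[R[i]]_n -> R[i]) (U : set 'cV[R[i]]_n).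
Hypothesis hf : holo_on U f.

Definition upd (r : 'I_n -> R) (j : 'I_n) (x : R) : 'I_n -> R := fun k => if k == j then x else r k.

Lemma normc_nat (k : nat) : normc (k%:R : R[i]) = k%:R.
Proof. by rewrite -(rmorph_nat (real_complex R)) normc_real ger0_norm// ler0n. Qed.

Lemma ptorK r z : (forall j, 0 < r j) -> (forall j, normc (z j 0) = r j) ->
  exists2 u, torus u & z = ptor r u.
Proof.
move=> r0 zr; exists (\col_k (z k 0 / (r k)%:C)) => [k|].
  by rewrite mxE normcM normcV normc_real zr gtr0_norm// divff// gt_eqF.
apply/matrixP => k i; rewrite !mxE (ord1 i) mulrC divfK//.
by apply/eqP => /complexI/eqP; rewrite gt_eqF.
Qed.

Lemma ptor_rot r j (x : R) l u : ptor (upd r j (x * r j)) (rot j l u) = ptor r (rot j (x%:C * l) u).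
Proof.
apply/matrixP => k i; rewrite !mxE /upd; case: eqP => [->|_] //.
by rewrite rmorphM /=; ring.
Qed.

(** Cauchy's theorem on the annulus swept by the j-th coordinate, for l -> f(.., l z_j, ..)
    l^(-a_j): its normalized circle sums at |l| = 1 and |l| = e^s agree in the limit, and averaging
    over the torus gives equal coefficients. *)
Lemma coef_step r j s (a : 'I_n -> int) : (forall k, 0 < r k) -> 0 <= s ->
  (forall x z, 1 <= x <= expR s -> (forall k, normc (z k 0) = upd r j (x * r j) k) -> U z) ->
  coef f (upd r j (expR s * r j)) a = coef f r a.
Proof.
move=> r0 s0 Uann; set r' := upd r j _.
have r'0 k : 0 < r' k by rewrite /r' /upd; case: eqP => _ //; rewrite mulr_gt0 ?expR_gt0.
have Ur z : (forall k, normc (z k 0) = r k) -> U z.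
  move=> zr; apply: (Uann 1); rewrite ?lexx ?andTb; first by rewrite -[leLHS]expR0 ler_expR.
  by move=> k; rewrite zr /upd; case: eqP => [->|] //; rewrite mul1r.
have Ur' z : (forall k, normc (z k 0) = r' k) -> U z.
  move=> zr; apply: (Uann (expR s)) => //; rewrite lexx andbT.
  by rewrite -[leLHS]expR0 ler_expR.
have rr k : 0 <= r k := ltW (r0 k).
have rr' k : 0 <= r' k := ltW (r'0 k).
pose m := - a j; pose A := (expR s)%:C ^ m : R[i].
pose Phi u := f (ptor r' u) * A - f (ptor r u).
pose chi' := chi (R := R) (fun k => - a k).
(* The factor A = e^(s m) with m = - a_j makes the sum of [Psi] over the rotations of u_j the
   difference of circle sums in [goursat]. *)
pose Psi u := Phi u * chi' u.
have [M0 fM] := holo_bounded hf rr Ur.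
have [M0' fM'] := holo_bounded hf rr' Ur'.
pose M := `|M0'| * normc A + `|M0|.
have M_ge0 : 0 <= M by rewrite addr_ge0// mulr_ge0// normc_ge0.
have PhiM u : torus u -> normc (Phi u) <= M.
  move=> tu; apply: le_trans (le_normcD _ _) _; rewrite normcN normcM lerD//.
    rewrite ler_wpM2r ?normc_ge0//; apply: le_trans (fM' _ _) (ler_norm _).
    by move=> k; rewrite ptor_norm.
  by apply: le_trans (fM _ _) (ler_norm _) => k; rewrite ptor_norm.
have bPsi : cbounded Psi by exists M => u tu; rewrite normcM normc_chi// mulr1 PhiM.
have A0 : A != 0 by rewrite expfz_neq0//; apply/eqP => /complexI/eqP; rewrite gt_eqF// expR_gt0.
suff mPsi : mean Psi = 0.
  have bf q : (forall k, 0 <= q k) -> (forall z, (forall k, normc (z k 0) = q k) -> U z) ->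
      cbounded (fun u => f (ptor q u) * chi' u).
    move=> q0 /(holo_bounded hf q0)[N fN]; apply: cboundedM; last exact: cbounded_chi.
    by exists N => u tu; apply: fN => k; rewrite ptor_norm.
  have PE u : Psi u = A * (f (ptor r' u) * chi' u) + (-1) * (f (ptor r u) * chi' u).
    by rewrite /Psi /Phi; ring.
  move: mPsi; rewrite (@mean_eq _ _ _ _ (fun u _ => PE u)) meanD; first last.
  - by apply: cboundedM; [apply: cbounded_cst|apply: bf].
  - by apply: cboundedM; [apply: cbounded_cst|apply: bf].
  rewrite !meanZ; try exact: bf.
  move/eqP; rewrite mulN1r subr_eq0 => /eqP mE.
  rewrite /coef -/chi' -mE (bigD1 j)//= [in RHS](bigD1 j)//= -/m.
  have -> : r' j ^ m = expR s ^ m * r j ^ m.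
    by rewrite /r' /upd eqxx exprzMl// unitfE gt_eqF// expR_gt0.
  rewrite (eq_bigr (fun i => r i ^ (- a i))); last by move=> k /negbTE kj; rewrite /r' /upd kj.
  have -> : A = (expR s ^ m)%:C.
    by rewrite /A; case: (m) => k; rewrite /exprz ?fmorphV rmorphXn.
  by rewrite !rmorphM /=; ring.
apply: eq0_normc; apply/eqP; rewrite eq_le normc_ge0 andbT.
apply/ler_addgt0Pl => e' e'0; rewrite addr0.
pose e := e' / 4; have e0 : 0 < e by rewrite divr_gt0.
have [k kP] : exists k, forall u c, torus u -> normc c = 1 -> normc (c - 1) <= 2 * pi / 2 ^+ k ->
     normc (Psi (rot j c u) - Psi u) <= e.
  have e10 : 0 < e / (4 * (normc A + 1)).
    by rewrite divr_gt0// mulr_gt0// ltr_wpDl// normc_ge0.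
  have [d1 d10 d1P] := holo_unif hf rr Ur e10.
  have [d2 d20 d2P] := holo_unif hf rr' Ur' e10.
  (* An arc with |c - 1| < 1 / Q moves both torus points by less than their moduli of continuity
     [d1] and [d2], and the factor c^m changes the value by at most e / 2. *)
  pose Q := (r j + r' j) / Num.min d1 d2 + 2 * M * `|m|%:~R / e + 1.
  have d120 : 0 < Num.min d1 d2 by rewrite lt_min d10.
  have m0 : 0 <= `|m|%:~R :> R by rewrite ler0z.
  have Q1 : 0 <= (r j + r' j) / Num.min d1 d2 by rewrite divr_ge0 ?(ltW d120)// addr_ge0.
  have Q2 : 0 <= 2 * M * `|m|%:~R / e by rewrite divr_ge0 ?(ltW e0)// !mulr_ge0.
  have Q0 : 0 < Q by rewrite ltr_wpDl// addr_ge0.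
  have [k kQ] : exists k, 2 * pi * Q < 2 ^+ k.
    have h : 0 <= 2 * pi * Q by rewrite !mulr_ge0 ?pi_ge0 ?(ltW Q0).
    exists (Num.bound (2 * pi * Q)); apply: lt_trans (archi_boundP h) _.
    by rewrite -natrX ltr_nat ltn_expl.
  exists k => u c tu c1 cB.
  have cQ : normc (c - 1) * Q < 1.
    have t0 : 0 < 2 ^+ k :> R by rewrite exprn_gt0.
    apply: le_lt_trans (ler_wpM2r (ltW Q0) cB) _.
    by rewrite mulrAC ltr_pdivrMr// mul1r.
  have n0 := normc_ge0 (c - 1).
  have close_rot q d : (forall i, 0 <= q i) -> 0 < d -> q j / d <= Q -> close d (ptor q u) (ptor q (rot j c u)).
    move=> q0 d0 qd i; rewrite !mxE; case: eqP => [->|_]; last by rewrite subrr normc0.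
    rewrite -mulrBr normcM normc_real ger0_norm// -{2}[u j 0]mul1r -mulrBl normcM tu mulr1.
    rewrite ler_pdivrMr// in qd; have := ler_wpM2r n0 qd.
    by nra.
  have c_r : close d1 (ptor r u) (ptor r (rot j c u)).
    apply: close_rot => //; rewrite /Q.
    have : r j / d1 <= (r j + r' j) / Num.min d1 d2.
      apply: ler_pM; rewrite ?invr_ge0 ?(ltW d10)//; first by rewrite lerDl.
      by rewrite lef_pV2 ?posrE// ge_min lexx.
    lra.
  have c_r' : close d2 (ptor r' u) (ptor r' (rot j c u)).
    apply: close_rot => //; rewrite /Q.
    have : r' j / d2 <= (r j + r' j) / Num.min d1 d2.
      apply: ler_pM; rewrite ?invr_ge0 ?(ltW d20)//; first by rewrite lerDr.
      by rewrite lef_pV2 ?posrE// ge_min lexx orbT.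
    lra.
  have f1 := d1P _ _ (fun k => ptor_norm (rr k) tu) c_r.
  have f2 := d2P _ _ (fun k => ptor_norm (rr' k) tu) c_r'.
  have c0 : c != 0 by apply/eqP => E; move: c1; rewrite E normc0 => /esym/eqP; rewrite oner_eq0.
  have cz : normc (c ^ m) = 1.
    by case: (m) => i; rewrite /exprz ?normcV normcX c1 expr1n ?invr1.
  rewrite /Psi /chi' chi_rot// -/m.
  have -> : Phi (rot j c u) * (c ^ m * chi (fun i => - a i) u) - Phi u * chi (fun i => - a i) u =
    ((Phi (rot j c u) - Phi u) * c ^ m + Phi u * (c ^ m - 1)) * chi (fun i => - a i) u by ring.
  rewrite normcM normc_chi// mulr1; apply: le_trans (le_normcD _ _) _.
  rewrite normcM cz mulr1 normcM.
  have p1 : normc (Phi (rot j c u) - Phi u) <= e / 4 + e / 4.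
    have -> : Phi (rot j c u) - Phi u =
       (f (ptor r' (rot j c u)) - f (ptor r' u)) * A - (f (ptor r (rot j c u)) - f (ptor r u)).
      by rewrite /Phi; ring.
    apply: le_trans (le_normcD _ _) _; rewrite normcN normcM.
    have nA := normc_ge0 A; have nA1 : 0 < normc A + 1 by rewrite ltr_wpDl.
    have hE : e / (4 * (normc A + 1)) * (normc A + 1) = e / 4 by field; rewrite gt_eqF.
    apply: lerD.
      apply: le_trans (ler_wpM2r nA f2) _; by rewrite -hE ler_wpM2l ?(ltW e10)// lerDl ler01.
    apply: le_trans f1 _; by rewrite -hE ler_peMr ?(ltW e10)// lerDr.
  have p2 : normc (Phi u) * normc (c ^ m - 1) <= e / 2.
    apply: le_trans (ler_pM (normc_ge0 _) (normc_ge0 _) (PhiM _ tu) (normc_expzB1 m c1)) _.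
    have h : 2 * M * `|m|%:~R / e * normc (c - 1) <= 1.
      apply: le_trans (ltW cQ); rewrite mulrC ler_wpM2l// /Q; lra.
    have -> : M * (`|m|%:~R * normc (c - 1)) = (2 * M * `|m|%:~R / e * normc (c - 1)) * (e / 2).
      by field; rewrite gt_eqF.
    by rewrite ler_piMl// divr_ge0// ltW.
  lra.
have avg_small u : torus u -> normc (\sum_(b < (2 ^ k)%N) Psi (rot j (dyroot k ^+ b) u)) <= 2 ^+ k * (2 * e).
  move=> tu.
  pose G l := f (ptor r (rot j l u)) * l ^ m * chi' u.
  have dG l : 1 <= normc l <= expR s -> cdiff G l.
    move=> /andP[l1 l2]; have nl0 : 0 < normc l by lra.
    have l0 : l != 0 by apply/eqP => E; rewrite E normc0 ltxx in nl0.
    apply: cdiffM; last exact: cdiff_cst.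
    apply: cdiffM; last exact: cdiff_exprz.
    pose z0 := ptor r (rot j l u).
    have Uz0 : U z0.
      apply: (Uann (normc l)); first by rewrite l1.
      move=> i; rewrite !mxE /upd; case: eqP => [->|_].
        by rewrite !normcM normc_real tu mulr1 ger0_norm// mulrC.
      by rewrite normcM normc_real tu mulr1 ger0_norm.
    have := @differentiable_cdiff R n f z0 j (hf.2 _ Uz0).
    have -> : z0 j 0 = ((r j)%:C * u j 0) * l by rewrite !mxE eqxx; ring.
    move=> /cdiff_scale; congr (cdiff _ _); apply/funext => x; congr f.
    apply/matrixP => i q; rewrite !mxE; case: eqP => [->|_] //.
    by ring.
  have [N0 HN] := goursat s0 dG e0.
  pose N := (N0 + k)%N.
  have := HN N (leq_addr _ _); rewrite big_mkord.
  have -> : \sum_(b < (2 ^ N)%N) (G ((expR s)%:C * dyroot N ^+ b) - G (dyroot N ^+ b)) =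
      \sum_(b < (2 ^ N)%N) Psi (rot j (dyroot N ^+ b) u).
    apply: eq_bigr => b _; rewrite /Psi /chi' chi_rot ?expf_neq0 ?cis_neq0// -/m.
    rewrite /G /Phi /r' ptor_rot exprzMl ?unitfE ?expf_neq0 ?cis_neq0//; last first.
      by apply/eqP => /complexI/eqP; rewrite gt_eqF// expR_gt0.
    by rewrite -/A -/chi'; ring.
  move=> h1; have h2 := avg_refine (leq_addl N0 k : (k <= N)%N) kP tu.
  set S1 := \sum_(b < (2 ^ N)%N) _ in h1 h2.
  set S2 := \sum_(b < (2 ^ k)%N) _ in h2 *.
  have h3 : 2 ^+ (N - k) * normc S2 <= 2 ^+ N * e + e * 2 ^+ N.
    have -> : 2 ^+ (N - k) * normc S2 = normc (2 ^+ (N - k) * S2).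
      by rewrite normcM normcX normc_nat.
    rewrite -[_ * S2](subKr S1); apply: le_trans (le_normcD _ _) _.
    by rewrite normcN addrC lerD.
  have t0 : 0 < 2 ^+ (N - k) :> R by rewrite exprn_gt0.
  have e2 : 2 ^+ N = 2 ^+ (N - k) * 2 ^+ k :> R by rewrite -exprD subnK ?leq_addl.
  rewrite -(ler_pM2l t0); apply: le_trans h3 _.
  by rewrite e2 le_eqVlt; apply/orP; left; apply/eqP; ring.
rewrite (mean_avg j k bPsi) normcM normcV normcX.
rewrite normc_nat.
have t0 : 0 < 2 ^+ k :> R by rewrite exprn_gt0.
rewrite ler_pdivrMl//; apply: le_trans (mean_le_cst avg_small) _.
by rewrite /e le_eqVlt; apply/orP; left; apply/eqP; field.
Qed.

End CoefStep.

(** * Taylor coefficients *)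

Section Taylor.
Context {R : realType} {n : nat}.
Implicit Types (z w u : 'cV[R[i]]_n) (d e : R) (r q : 'I_n -> R) (a : 'I_n -> int).
Local Notation torus := (@torus R n).

(** Radii of the tori that lie in the unit sphere and avoid the coordinate hyperplanes. *)
Definition spos r := (forall j, 0 < r j) /\ \sum_j r j ^+ 2 = 1.

Lemma usphere_ptor r u : spos r -> torus u -> usphere (ptor r u).
Proof.
move=> [r0 r1] tu; rewrite /usphere -[RHS]r1; apply: eq_bigr => j _.
by rewrite ptor_norm// ltW.
Qed.

Lemma exists_spos : (0 < n)%N -> exists r, spos r.
Proof.
move=> n0; exists (fun=> Num.sqrt n%:R^-1); split=> [j|].
  by rewrite sqrtr_gt0 invr_gt0 ltr0n.
under eq_bigr do rewrite sqr_sqrtr ?invr_ge0 ?ler0n//.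
by rewrite sumr_const card_ord -[_ *+ _]mulr_natl divff// pnatr_eq0 -lt0n.
Qed.

Lemma sqr_subr_le (x y : R) : 0 <= x -> 0 <= y -> (x - y) ^+ 2 <= `|x ^+ 2 - y ^+ 2|.
Proof.
move=> x0 y0; rewrite subr_sqr normrM -[leLHS]real_normK ?num_real// expr2 ler_wpM2l//.
by rewrite [leRHS]ger0_norm ?addr_ge0// ler_norml; apply/andP; split; lra.
Qed.

Section Const.
Variables (f : 'cV[R[i]]_n -> R[i]) (U : set 'cV[R[i]]_n).
Hypothesis hf : holo_on U f.
Hypothesis hU : forall z, usphere z -> U z.

Lemma tube : exists2 d, 0 < d & forall z w, usphere z -> close d z w -> U w.
Proof.
have [] := sphere_uniform (P := fun d z => forall w, close d z w -> U w).
- by move=> d d' z _ dd H w zw; apply: H; apply: close_le zw.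
- move=> z /hU Uz; have [d d0 dP] := open_close hf.1 Uz.
  exists (d / 2) => [|z' zz' w z'w]; first by rewrite divr_gt0.
  apply: dP => j; rewrite -(subrK (z' j 0) (w j 0)) -addrA.
  by apply: le_lt_trans (le_normcD _ _) _; rewrite [ltRHS](splitr d) ltrD.
- by move=> d d0 dP; exists d => // z w /dP; apply.
Qed.

(** An increase of the j-th radius is [coef_step] with e^s = y / q_j, and a decrease is the same
    step read backwards. Each point met on the way is compared with the point of the torus of radii
    [r] that has the same arguments, hence stays in the tube. *)
Lemma coef_upd d r q j y a : (forall z w, usphere z -> close d z w -> U w) ->
  spos r -> (forall k, 0 < q k) -> (forall k, `|q k - r k| < d) -> 0 < y -> `|y - r j| < d ->
  coef f (upd q j y) a = coef f q a.
Proof.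
move=> dU sr; have main p x : (forall k, 0 < p k) -> (forall k, `|p k - r k| < d) ->
    p j <= x -> `|x - r j| < d -> coef f (upd p j x) a = coef f p a.
  move=> p0 pd px xd; have x0 : 0 < x by apply: lt_le_trans px.
  pose s := ln (x / p j).
  have es : expR s = x / p j by rewrite lnK// posrE divr_gt0.
  have -> : x = expR s * p j by rewrite es divfK// gt_eqF.
  apply: (coef_step hf a p0); first by rewrite ln_ge0// ler_pdivlMr// mul1r.
  move=> t z /andP[t1]; rewrite es ler_pdivlMr// => tx zt.
  have pt : p j <= t * p j by rewrite ler_peMl// ltW.
  have up0 k : 0 < upd p j (t * p j) k.
    by rewrite /upd; case: eqP => // _; apply: lt_le_trans pt.
  have [u tu ->] := ptorK up0 zt.
  apply: (dU (ptor r u)); first exact: usphere_ptor.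
  move=> k; rewrite !mxE -mulrBl normcM tu mulr1 -rmorphB normc_real /upd.
  case: eqP => [->|_]; last exact: pd.
  have := pd j; move: xd; rewrite !ltr_norml => /andP[h1 h2] /andP[h3 h4].
  by apply/andP; split; lra.
move=> q0 qd y0 yd; have [qy|/ltW yq] := leP (q j) y; first exact: main.
have E : upd (upd q j y) j (q j) = q.
  by apply/funext => k; rewrite /upd; case: eqP => [->|].
rewrite -(main (upd q j y) (q j)) ?E//.
- by move=> k; rewrite /upd; case: eqP.
- by move=> k; rewrite /upd; case: eqP => // ->.
- by rewrite /upd eqxx.
Qed.

(** The radii are exchanged one at a time; the intermediate tuples stay in the box around [r],
    though in general not on the sphere. *)
Lemma coef_box d r q q' a : (forall z w, usphere z -> close d z w -> U w) ->
  spos r -> (forall k, 0 < q k) -> (forall k, `|q k - r k| < d) ->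
  (forall k, 0 < q' k) -> (forall k, `|q' k - r k| < d) -> coef f q a = coef f q' a.
Proof.
move=> dU sr q0 qd q'0 q'd.
pose h i : 'I_n -> R := fun k => if (k < i)%N then q' k else q k.
suff H i : (i <= n)%N -> coef f (h i) a = coef f q a.
  have -> : q' = h n by apply/funext => k; rewrite /h ltn_ord.
  exact/esym/H.
elim: i => [_|i IH ilt]; first by congr coef; apply/funext => k; rewrite /h ltn0.
rewrite -(IH (ltnW ilt)).
have -> : h i.+1 = upd (h i) (Ordinal ilt) (q' (Ordinal ilt)).
  apply/funext => k; rewrite /h /upd ltnS leq_eqVlt -val_eqE /=.
  by case: eqP => [/= ki|//]; congr q'; apply: val_inj.
apply: (coef_upd (d := d) (r := r)) => //.
- by move=> k; rewrite /h; case: ifP.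
- by move=> k; rewrite /h; case: ifP.
Qed.

(* By [coef_step] the coefficient does not change when one radius moves inside a
   tube around the sphere; r and r' are joined by small such steps. *)
Lemma coef_const r r' a : spos r -> spos r' -> coef f r a = coef f r' a.
Proof.
move=> sr sr'; have [d d0 dU] := tube.
(* The parameter is clamped because a dyadic interval containing a point of [0, 1] may end beyond 1.
   Interpolating the squares of the radii linearly keeps their sum equal to 1. *)
pose cl (t : R) := Num.min 1 t.
pose rho t : 'I_n -> R := fun k => Num.sqrt ((1 - cl t) * r k ^+ 2 + cl t * r' k ^+ 2).
have cl01 t : 0 <= t -> 0 <= cl t <= 1 by move=> t0; rewrite /cl le_min ge_min ler01 t0 lexx.
have rk2 p k : spos p -> 0 < p k ^+ 2 <= 1.
  move=> [p0 p1]; rewrite exprn_gt0//= -p1 (bigD1 k)//= lerDl sumr_ge0// => i _; exact: sqr_ge0.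
have rho2 t k : 0 <= t -> 0 < (1 - cl t) * r k ^+ 2 + cl t * r' k ^+ 2.
  move=> /cl01 /andP[c0 c1]; have /andP[x0 _] := rk2 r k sr; have /andP[y0 _] := rk2 r' k sr'.
  set x := r k ^+ 2 in x0 *; set y := r' k ^+ 2 in y0 *.
  have [c12|c12] := leP (cl t) (1 / 2).
    by apply: ltr_pwDl; [rewrite mulr_gt0//; lra|rewrite mulr_ge0// ltW].
  by apply: ltr_wpDl; [rewrite mulr_ge0// ?(ltW x0)//; lra|rewrite mulr_gt0//; lra].
have srho t : 0 <= t -> spos (rho t).
  move=> t0; split=> [k|]; first by rewrite sqrtr_gt0 rho2.
  under eq_bigr do rewrite sqr_sqrtr ?(ltW (rho2 _ _ t0))//.
  by rewrite big_split /= -!mulr_sumr sr.2 sr'.2 !mulr1 subrK.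
have rho0E : rho 0 = r.
  apply/funext => k; rewrite /rho /cl (min_r (@ler01 R)) subr0 mul1r mul0r addr0 sqrtr_sqr.
  by rewrite gtr0_norm// sr.1.
have rho1E : rho 1 = r'.
  apply/funext => k; rewrite /rho /cl minxx subrr mul1r mul0r add0r sqrtr_sqr.
  by rewrite gtr0_norm// sr'.1.
have rho_close t t' k : 0 <= t -> 0 <= t' -> `|t - t'| < d ^+ 2 -> `|rho t k - rho t' k| < d.
  move=> t0 t'0 tt; rewrite -(ltr_pXn2r (ltn0Sn 1)) ?nnegrE ?(ltW d0)//.
  rewrite real_normK ?num_real//; apply: le_lt_trans (sqr_subr_le (sqrtr_ge0 _) (sqrtr_ge0 _)) _.
  rewrite !sqr_sqrtr ?(ltW (rho2 _ _ _))//.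
  have -> : (1 - cl t) * r k ^+ 2 + cl t * r' k ^+ 2 - ((1 - cl t') * r k ^+ 2 + cl t' * r' k ^+ 2)
     = (cl t - cl t') * (r' k ^+ 2 - r k ^+ 2) by ring.
  rewrite normrM; apply: le_lt_trans tt.
  have h : `|cl t - cl t'| <= `|t - t'|.
    rewrite /cl; case: (leP 1 t) => h1; case: (leP 1 t') => h2; rewrite ?subrr ?normr0//.
      by rewrite !ger0_norm; lra.
    by rewrite !ler0_norm; lra.
  apply: le_trans h; rewrite ler_piMr//.
  have /andP[x0 x1] := rk2 r k sr; have /andP[y0 y1] := rk2 r' k sr'.
  by rewrite ler_norml; apply/andP; split; lra.
rewrite -rho0E -rho1E.
have -> : (0 : R) = 0%N%:R / 2 ^+ 0 by rewrite mul0r.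
have -> : (1 : R) = 1%N%:R / 2 ^+ 0 by rewrite expr0 divr1.
(* The bisection is one-dimensional here: [P] is constant in j. *)
pose P (k i j : nat) := coef f (rho (i%:R / 2 ^+ k)) a = coef f (rho (i.+1%:R / 2 ^+ k)) a.
apply: (@dyadic_induction2 R P) => [k i j H1 H2 _ _|x y /andP[x0 x1] _].
  have half (m : nat) : m.*2%:R / 2 ^+ k.+1 = m%:R / 2 ^+ k :> R.
    rewrite -muln2 natrM exprS; field.
    by rewrite expf_neq0.
  by move: H1 H2; rewrite /P -doubleS !half => -> ->.
have [k0 k0P] : exists k0, (d ^+ 2)^-1 < 2 ^+ k0.
  have h : 0 <= (d ^+ 2)^-1 by rewrite invr_ge0 exprn_ge0// ltW.
  exists (Num.bound (d ^+ 2)^-1); apply: lt_trans (archi_boundP h) _.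
  by rewrite -natrX ltr_nat ltn_expl.
exists k0 => k i j kk /andP[ix xi] _.
have t0 : 0 < 2 ^+ k :> R by rewrite exprn_gt0.
have small : 1 / 2 ^+ k < d ^+ 2.
  rewrite div1r -[ltRHS]invrK ltf_pV2 ?posrE ?invr_gt0 ?exprn_gt0//.
  by apply: lt_le_trans k0P _; rewrite ler_eXn2l// ltr1n.
have i1 : i.+1%:R / 2 ^+ k = i%:R / 2 ^+ k + 1 / 2 ^+ k :> R by rewrite -mulrDl natr1.
have ti : 0 <= i%:R / 2 ^+ k :> R by rewrite divr_ge0 ?ler0n// ltW.
have ti1 : 0 <= i.+1%:R / 2 ^+ k :> R by rewrite divr_ge0 ?ler0n// ltW.
apply: (coef_box (d := d) (r := rho x)) => //.
- exact: srho.
- by move=> l; apply: (srho _ ti).1.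
- move=> l; apply: rho_close => //; apply: le_lt_trans small.
  by rewrite ler_norml; apply/andP; split; rewrite ?i1 in xi *; lra.
- by move=> l; apply: (srho _ ti1).1.
- move=> l; apply: rho_close => //; apply: le_lt_trans small.
  by rewrite ler_norml; apply/andP; split; rewrite ?i1 in xi *; lra.
Qed.

(* Let the j-th radius tend to 0, which 1 < n allows on the sphere: with f bounded,
   a negative exponent at j forces the coefficient to 0. *)
Lemma coef_vanish r a j : (1 < n)%N -> a j < 0 -> spos r -> coef f r a = 0.
Proof.
move=> n1 aj sr; have [M fM] := holo_bounded_sphere hf hU.
have M0 : 0 <= M.
  have : torus (\col_k 1) by move=> k; rewrite mxE normc1.
  move=> /(usphere_ptor sr)/fM; apply: le_trans; exact: normc_ge0.
pose N : R := n.-1%:R.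
have N0 : 0 < N by rewrite ltr0n; case: (n) n1 => // -[].
pose s0 : R := Num.sqrt (2 * N)^-1.
have s00 : 0 < s0 by rewrite sqrtr_gt0 invr_gt0 mulr_gt0.
(* Bounds the remaining factors whatever the signs of their exponents: the other radii all equal s,
   and s0 <= s <= 1. *)
pose C : R := \prod_(k | k != j) s0^-1 ^+ `|a k|%N.
have C0 : 0 <= C by apply: prodr_ge0 => k _; rewrite exprn_ge0// invr_ge0 ltW.
apply: eq0_normc; apply/eqP; rewrite eq_le normc_ge0 andbT.
apply/ler_addgt0Pl => e e0; rewrite addr0.
have D0 : 0 < 2 * M * C + 1 by rewrite ltr_wpDl// !mulr_ge0.
pose t : R := Num.min (1 / 2) (e / (2 * M * C + 1)).
have t0 : 0 < t by rewrite lt_min !divr_gt0.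
have t12 : t <= 1 / 2 by rewrite ge_min lexx.
have te : t * (2 * M * C + 1) <= e by rewrite -ler_pdivlMr// ge_min lexx orbT.
have t2 : t ^+ 2 <= 1 / 2 by rewrite expr2; nra.
pose s : R := Num.sqrt ((1 - t ^+ 2) / N).
have s2 : 0 < (1 - t ^+ 2) / N by rewrite divr_gt0//; lra.
have s_gt0 : 0 < s by rewrite sqrtr_gt0.
pose q : 'I_n -> R := fun k => if k == j then t else s.
have sq : spos q.
  split=> [k|]; first by rewrite /q; case: eqP.
  rewrite (bigD1 j)//= {1}/q eqxx (eq_bigr (fun=> s ^+ 2)); last first.
    by move=> k /negbTE kj; rewrite /q kj.
  rewrite sumr_const (eq_card (B := predC1 j)); last by move=> k; rewrite !inE.
  rewrite cardC1 card_ord -[_ *+ n.-1]mulr_natl -/N sqr_sqrtr ?(ltW s2)//.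
  by field; rewrite gt_eqF.
rewrite (coef_const a sr sq).
have s0s : s0 <= s.
  rewrite ler_wsqrtr// invfM ler_pM2r ?invr_gt0//.
  by rewrite -div1r; lra.
have s1 : s <= 1.
  rewrite -[leRHS]sqrtr1 ler_wsqrtr// ler_pdivrMr// mul1r.
  have : 1 <= N by rewrite ler1n; case: (n) n1 => // -[].
  have : 0 <= t ^+ 2 by apply: sqr_ge0.
  lra.
have prod_le : \prod_k q k ^ (- a k) <= t * C.
  rewrite (bigD1 j)//=; apply: ler_pM.
  - by rewrite /q eqxx exprz_ge0// ltW.
  - by apply: prodr_ge0 => k _; rewrite exprz_ge0// ltW// sq.1.
  - rewrite /q eqxx; case: (a j) aj => // m _; rewrite NegzE opprK.
    rewrite -[leLHS]/(t ^+ m.+1) exprS ler_piMr ?(ltW t0)// exprn_ile1 ?(ltW t0)//; lra.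
  - apply: ler_prod => k kj; rewrite exprz_ge0 ?(ltW (sq.1 _))//= /q (negbTE kj).
    have s0V : 1 <= s0^-1 by rewrite invf_ge1// (le_trans s0s).
    case: (a k) => m; rewrite ?NegzE ?opprK ?abszN /=.
      rewrite -exprnN -exprVn lerXn2r ?nnegrE ?invr_ge0 ?(ltW s_gt0) ?(ltW s00)//.
      by rewrite lef_pV2 ?posrE.
    rewrite -[leLHS]/(s ^+ m.+1); apply: (@le_trans _ _ 1).
      by rewrite exprn_ile1// ltW.
    by rewrite exprn_ege1.
rewrite /coef normcM normc_real ger0_norm; last first.
  by apply: prodr_ge0 => k _; rewrite exprz_ge0// ltW// sq.1.
have mle : normc (mean (fun u => f (ptor q u) * chi (fun k => - a k) u)) <= 2 * M.
  apply: mean_le_cst => u tu; rewrite normcM normc_chi// mulr1.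
  by apply: fM; apply: usphere_ptor.
apply: le_trans (ler_pM (normc_ge0 _) _ mle prod_le) _.
  by apply: prodr_ge0 => k _; rewrite exprz_ge0// ltW// sq.1.
apply: le_trans te; have -> : 2 * M * (t * C) = t * (2 * M * C) by ring.
by rewrite ler_wpM2l ?(ltW t0)// lerDl.
Qed.

End Const.

Definition sholo (f : 'cV[R[i]]_n -> R[i]) :=
  exists U, holo_on U f /\ forall z, usphere z -> U z.

(** Hartogs' theorem at the level of coefficients: a single family, supported on nonnegative
    exponents, serves all tori of the sphere at once. *)
Lemma taylor f : (1 < n)%N -> sholo f -> exists c : ('I_n -> int) -> R[i],
  (forall a j, a j < 0 -> c a = 0) /\
  forall r a, spos r -> mean (fun u => f (ptor r u) * chi (fun k => - a k) u) =
    c a * (\prod_k r k ^ a k)%:C.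
Proof.
move=> n1 [U [hf hU]].
have [r0 sr0] := exists_spos (ltnW n1).
exists (coef f r0); split=> [a j aj|r a sr].
  exact: (coef_vanish hf hU n1 aj sr0).
rewrite (coef_const hf hU a sr0 sr) /coef -mulrA -rmorphM -big_split /=.
rewrite big1 ?mulr1// => k _; rewrite -expfzDr ?addNr//.
by rewrite gt_eqF// sr.1.
Qed.

End Taylor.

(** * Functions on the sphere *)

Section Sphere.
Context {R : realType} {n : nat}.
Implicit Types (z w u : 'cV[R[i]]_n) (d e : R) (r q : 'I_n -> R) (a b m : multinom n).
Implicit Types (F G : 'cV[R[i]]_n -> R[i]).
Local Notation torus := (@torus R n).

Definition ccont F := forall z, usphere z -> forall e, 0 < e ->
  exists2 d, 0 < d & forall w, close d z w -> normc (F w - F z) <= e.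

Lemma ccont_cst c : ccont (fun=> c).
Proof. by move=> z _ e e0; exists 1 => // w _; rewrite subrr normc0 ltW. Qed.

Lemma ccontD F G : ccont F -> ccont G -> ccont (fun z => F z + G z).
Proof.
move=> cF cG z zS e e0; have e2 : 0 < e / 2 by rewrite divr_gt0.
have [d d0 dP] := cF z zS _ e2; have [d' d'0 d'P] := cG z zS _ e2.
exists (Num.min d d') => [|w zw]; first by rewrite lt_min d0.
have -> : F w + G w - (F z + G z) = (F w - F z) + (G w - G z) by ring.
apply: le_trans (le_normcD _ _) _; rewrite (splitr e) lerD//.
  by apply: dP; apply: close_le zw; rewrite ge_min lexx.
by apply: d'P; apply: close_le zw; rewrite ge_min lexx orbT.
Qed.

Lemma ccontM F G : ccont F -> ccont G -> ccont (fun z => F z * G z).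
Proof.
move=> cF cG z zS e e0.
have f0 := normc_ge0 (F z); have g0 := normc_ge0 (G z).
pose M := normc (F z) + normc (G z) + 1.
have M0 : 0 < M by rewrite /M; lra.
pose e1 := Num.min 1 (e / M).
have e10 : 0 < e1 by rewrite lt_min ltr01 divr_gt0.
have [d d0 dP] := cF z zS _ e10; have [d' d'0 d'P] := cG z zS _ e10.
exists (Num.min d d') => [|w zw]; first by rewrite lt_min d0.
have h1 : normc (F w - F z) <= e1 by apply: dP; apply: close_le zw; rewrite ge_min lexx.
have h2 : normc (G w - G z) <= e1 by apply: d'P; apply: close_le zw; rewrite ge_min lexx orbT.
have -> : F w * G w - F z * G z = (F w - F z) * (G w - G z) + F z * (G w - G z) + (F w - F z) * G z by ring.
apply: le_trans (le_normcD _ _) _; apply: le_trans (lerD (le_normcD _ _) (lexx _)) _.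
rewrite !normcM.
have e11 : e1 <= 1 by rewrite ge_min lexx.
have e1M : e1 * M <= e by rewrite -ler_pdivlMr// ge_min lexx orbT.
have t1 := ler_pM (normc_ge0 _) (normc_ge0 _) h1 h2.
have t2 := ler_wpM2l f0 h2; have t3 := ler_wpM2r g0 h1.
apply: le_trans (lerD (lerD t1 t2) t3) _; apply: le_trans e1M.
have -> : e1 * M = e1 * 1 + normc (F z) * e1 + e1 * normc (G z) by rewrite /M; ring.
by rewrite !lerD2r ler_wpM2l// ltW.
Qed.

Lemma ccont_conj F : ccont F -> ccont (fun z => Num.conj (F z)).
Proof.
move=> cF z zS e e0; have [d d0 dP] := cF z zS _ e0; exists d => // w /dP.
by rewrite -rmorphB normc_conj.
Qed.

Lemma ccont_coord (j : 'I_n) : ccont (fun z => z j 0).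
Proof. by move=> z _ e e0; exists e => // w /(_ j)/ltW. Qed.

Lemma ccont_sum (I : Type) (s : seq I) (P : pred I) (F : I -> 'cV[R[i]]_n -> R[i]) :
  (forall i, ccont (F i)) -> ccont (fun z => \sum_(i <- s | P i) F i z).
Proof.
move=> cF; elim: s => [|i s IH].
  by under eq_fun do rewrite big_nil; apply: ccont_cst.
under eq_fun do rewrite big_cons; case: (P i) => //.
exact: ccontD.
Qed.

Lemma ccont_bounded F : ccont F -> exists M, forall z, usphere z -> normc (F z) <= M.
Proof.
move=> cF; have [] := sphere_uniform (P := fun d z => normc (F z) <= d^-1).
- move=> d d' z d0 dd /le_trans; apply; rewrite lef_pV2 ?posrE//.
  exact: lt_le_trans dd.
- move=> z zS; have [d d0 dP] := cF z zS 1 ltr01.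
  have c0 : 0 < normc (F z) + 1 by rewrite ltr_wpDl ?normc_ge0.
  exists (Num.min d (normc (F z) + 1)^-1) => [|w zw].
    by rewrite lt_min d0 invr_gt0.
  have zw' : close d z w by apply: close_le zw; rewrite ge_min lexx.
  apply: (@le_trans _ _ (normc (F z) + 1)).
    rewrite -(subrK (F z) (F w)); apply: le_trans (le_normcD _ _) _.
    by rewrite addrC lerD2l dP.
  by rewrite -[leLHS]invrK lef_pV2 ?posrE ?invr_gt0 ?lt_min ?d0 ?invr_gt0// ge_min lexx orbT.
- by move=> d d0 dP; exists d^-1.
Qed.

Lemma ccont_cbounded F r : ccont F -> spos r -> cbounded (fun u => F (ptor r u)).
Proof.
by move=> /ccont_bounded[M FM] sr; exists M => u tu; apply: FM; apply: usphere_ptor.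
Qed.

(** The zero coordinates are replaced by a small t and the others scaled by s, where s^2 + N t^2 = 1
    and N counts the zeros. *)
Lemma sphere_dense z d : usphere z -> 0 < d ->
  exists2 w, usphere w /\ (forall j, w j 0 != 0) & close d z w.
Proof.
move=> zS d0; pose N := #|[pred j | z j 0 == 0]|%:R : R.
have N0 : 0 <= N by rewrite ler0n.
pose t : R := Num.min (1 / (N + 1)) (d / 2) .
have N1 : 0 < N + 1 by rewrite ltr_wpDl.
have t0 : 0 < t by rewrite lt_min !divr_gt0.
have tN : t * (N + 1) <= 1 by rewrite -ler_pdivlMr// ge_min lexx.
have td : t <= d / 2 by rewrite ge_min lexx orbT.
have t1 : t <= 1 by nra.
have Nt : N * t ^+ 2 <= t by rewrite expr2; nra.
have Nt1 : N * t ^+ 2 < 1 by rewrite expr2; nra.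
pose s := Num.sqrt (1 - N * t ^+ 2).
have s2 : 0 < 1 - N * t ^+ 2 by lra.
have s0 : 0 < s by rewrite sqrtr_gt0.
have s1 : s <= 1.
  rewrite -[leRHS]sqrtr1 ler_wsqrtr// gerBl mulr_ge0// sqr_ge0//.
have s1t : 1 - s <= t.
  apply: le_trans Nt; have : s ^+ 2 = 1 - N * t ^+ 2 by rewrite sqr_sqrtr// ltW.
  by rewrite expr2; nra.
exists (\col_j if z j 0 == 0 then t%:C else s%:C * z j 0); [split|].
- rewrite /usphere (bigID [pred j | z j 0 == 0])/=.
  rewrite (eq_bigr (fun=> t ^+ 2)); last first.
    by move=> j zj; rewrite mxE zj normc_real gtr0_norm.
  rewrite sumr_const -[_ *+ _]mulr_natl -/N.
  rewrite (eq_bigr (fun j => s ^+ 2 * normc (z j 0) ^+ 2)); last first.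
    by move=> j /negbTE zj; rewrite mxE zj normcM normc_real gtr0_norm// exprMn.
  rewrite -mulr_sumr.
  have -> : \sum_(j | z j 0 != 0) normc (z j 0) ^+ 2 = 1.
    rewrite -[RHS]zS [RHS](bigID [pred j | z j 0 == 0])/= [X in _ = X + _]big1 ?add0r//.
    by move=> j /eqP ->; rewrite normc0 expr0n.
  by rewrite mulr1 sqr_sqrtr ?(ltW s2)// subrKC.
- move=> j; rewrite mxE; case: ifPn => [_|zj].
    by apply/eqP => /complexI/eqP; rewrite gt_eqF.
  by rewrite mulf_neq0//; apply/eqP => /complexI/eqP; rewrite gt_eqF.
- move=> j; rewrite mxE; case: ifPn => [/eqP ->|zj].
    by rewrite subr0 normc_real gtr0_norm//; lra.
  rewrite -{2}[z j 0]mul1r -mulrBl normcM -(rmorph1 (real_complex R)) -rmorphB normc_real.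
  rewrite distrC ger0_norm ?subr_ge0//.
  have : normc (z j 0) <= 1.
    rewrite -(ler_pXn2r (ltn0Sn 1)) ?nnegrE ?normc_ge0// expr1n -[leRHS]zS (bigD1 j)//= lerDl.
    by apply: sumr_ge0 => k _; apply: sqr_ge0.
  have := normc_ge0 (z j 0); nra.
Qed.

Lemma ccont_dense0 F : ccont F ->
  (forall z, usphere z -> (forall j, z j 0 != 0) -> F z = 0) -> forall z, usphere z -> F z = 0.
Proof.
move=> cF F0 z zS; apply: eq0_normc; apply/eqP; rewrite eq_le normc_ge0 andbT.
apply/ler_addgt0Pl => e e0; rewrite addr0.
have [d d0 dP] := cF z zS e e0; have [w [wS w0] zw] := sphere_dense zS d0.
by have := dP w zw; rewrite F0// sub0r normcN.
Qed.

(** [fourier_unique] applies on the torus through any point without zero coordinates; the remaining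
    points follow by density. *)
Lemma sphere_unique F : ccont F ->
  (forall r (a : 'I_n -> int), spos r -> mean (fun u => F (ptor r u) * chi a u) = 0) ->
  forall z, usphere z -> F z = 0.
Proof.
move=> cF F0; apply: (ccont_dense0 cF) => z zS z0.
pose r j := normc (z j 0).
have sr : spos r.
  split=> // j; rewrite lt_neqAle normc_ge0 andbT eq_sym.
  by apply/eqP => /eq0_normc/eqP; rewrite (negbTE (z0 j)).
have [v tv zE] := ptorK sr.1 (fun j => erefl : normc (z j 0) = r j).
rewrite zE; apply: (@fourier_unique R n (fun u => F (ptor r u)) v tv).
  by split => [|a]; [exact: ccont_cbounded|exact: F0].
move=> e e0; have [d d0 dP] := cF _ (usphere_ptor sr tv) e e0.
exists d => // u tu uv; apply: dP => j; rewrite !mxE -mulrBr normcM normc_real.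
apply: le_lt_trans (uv j); rewrite ler_piMl ?normc_ge0//.
rewrite gtr0_norm; last exact: sr.1.
rewrite -(ler_pXn2r (ltn0Sn 1)) ?nnegrE ?normc_ge0// expr1n -[leRHS]sr.2 (bigD1 j)//= lerDl.
by apply: sumr_ge0 => k _; apply: sqr_ge0.
Qed.

Definition mon m z : R[i] := \prod_j z j 0 ^+ m j.

Lemma monD a b z : mon (mnm_add a b) z = mon a z * mon b z.
Proof. by rewrite /mon -big_split; apply: eq_bigr => j _; rewrite mnmDE exprD. Qed.

Lemma mon1 j z : mon (mnm1 j) z = z j 0.
Proof.
rewrite /mon (bigD1 j)//= mnm1E eqxx expr1 big1 ?mulr1// => k kj.
by rewrite mnm1E eq_sym (negbTE kj) expr0.
Qed.

Lemma ccont_mon m : ccont (mon m).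
Proof.
rewrite /mon; elim: (index_enum _) => [|j s IH].
  by under eq_fun do rewrite big_nil; apply: ccont_cst.
under eq_fun do rewrite big_cons; apply: ccontM => //.
elim: (m j) => [|k IHk]; first exact: ccont_cst.
under eq_fun do rewrite exprS; apply: ccontM => //; exact: ccont_coord.
Qed.

Definition mexp m : 'I_n -> int := fun j => (m j)%:Z.
Definition rpow r (a : 'I_n -> int) : R := \prod_j r j ^ a j.

Lemma rpow_gt0 r (a : 'I_n -> int) : spos r -> 0 < rpow r a.
Proof. by move=> sr; apply: prodr_gt0 => j _; rewrite exprz_gt0// sr.1. Qed.

Lemma rpowD r (a b : 'I_n -> int) : spos r -> rpow r (fun j => a j + b j) = rpow r a * rpow r b.
Proof.
move=> sr; rewrite /rpow -big_split; apply: eq_bigr => j _.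
by rewrite expfzDr// gt_eqF// sr.1.
Qed.

Lemma mon_ptor r u m : mon m (ptor r u) = (rpow r (mexp m))%:C * chi (mexp m) u.
Proof.
rewrite /mon /rpow /chi rmorph_prod -big_split; apply: eq_bigr => j _.
by rewrite mxE exprMn -rmorphXn.
Qed.

Lemma conj_mon_ptor r u m : torus u ->
  Num.conj (mon m (ptor r u)) = (rpow r (mexp m))%:C * chi (fun j => - mexp m j) u.
Proof.
by move=> tu; rewrite mon_ptor rmorphM -conj_chi//; congr (_ * _); apply: conjc_real.
Qed.

Lemma mean_mon r a b (g : 'I_n -> int) : spos r ->
  mean (fun u => mon a (ptor r u) * Num.conj (mon b (ptor r u)) * chi (fun j => - g j) u) =
  if [forall j, mexp a j - mexp b j == g j] then (rpow r (mexp a) * rpow r (mexp b))%:C else 0.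
Proof.
move=> sr.
rewrite (@mean_eq _ _ _ (fun u => (rpow r (mexp a) * rpow r (mexp b))%:C *
   chi (fun j => mexp a j - mexp b j - g j) u)); last first.
  move=> u tu; rewrite mon_ptor conj_mon_ptor// rmorphM /=.
  rewrite (chiD (fun j => mexp a j - mexp b j) (fun j => - g j) tu).
  by rewrite (chiD (mexp a) (fun j => - mexp b j) tu); ring.
rewrite meanZ; last exact: cbounded_chi.
rewrite mean_chi; under eq_forallb do rewrite subr_eq0.
by case: ifP => _; rewrite ?mulr1 ?mulr0.
Qed.

End Sphere.

(** * Linear independence of the products z^a conj(z^b) on the sphere *)

Section Independence.
Context {R : realType} {n : nat}.
Implicit Types (z w u : 'cV[R[i]]_n) (r q : 'I_n -> R) (a b m : multinom n).
Local Notation torus := (@torus R n).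

Lemma digits_inj (B : nat) k (f g : 'I_k -> nat) : (forall j, (f j < B)%N) -> (forall j, (g j < B)%N) ->
  (\sum_j f j * B ^ j = \sum_j g j * B ^ j)%N -> f =1 g.
Proof.
elim: k f g => [|k IH] f g fB gB; first by move=> _ [].
rewrite !big_ord_recl /= !expn0 !muln1.
have step (h : 'I_k.+1 -> nat) :
    (\sum_(i < k) h (lift ord0 i) * B ^ bump 0 i = B * \sum_(i < k) h (lift ord0 i) * B ^ i)%N.
  by rewrite big_distrr; apply: eq_bigr => i _; rewrite /bump /= add1n expnS mulnCA.
rewrite !step => E.
have B0 : (0 < B)%N by apply: leq_ltn_trans (fB ord0).
have E0 : f ord0 = g ord0.
  have := congr1 (modn^~ B) E; rewrite ![(B * _)%N]mulnC ![(_ + _ * B)%N]addnC !modnMDl.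
  by rewrite !modn_small.
have EI : (\sum_(i < k) f (lift ord0 i) * B ^ i = \sum_(i < k) g (lift ord0 i) * B ^ i)%N.
  by move: E; rewrite E0 => /addnI/eqP; rewrite eqn_pmul2l// => /eqP.
move=> j; case: (unliftP ord0 j) => [i ->|->] //.
by apply: (IH (fun i => f (lift ord0 i)) (fun i => g (lift ord0 i))).
Qed.

Lemma mnm_le_mdeg m j : (m j <= mdeg m)%N.
Proof. by rewrite mdegE (bigD1 j)//= leq_addr. Qed.

(* Kronecker substitution: with r_j^2 proportional to t^((D+1)^j) the monomials
   become distinct powers of one variable t. *)
Lemma mon_indep (T : finType) (S : pred T) (c : T -> R[i]) (m : T -> multinom n) D :
  (0 < n)%N -> (forall p, S p -> mdeg (m p) = D) -> {in S &, injective m} ->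
  (forall r, spos r -> \sum_(p | S p) c p * (\prod_j (r j ^+ 2) ^+ m p j)%:C = 0) ->
  forall p, S p -> c p = 0.
Proof.
move=> n0 mD minj H.
pose e (x : multinom n) := (\sum_j x j * D.+1 ^ j)%N.
have einj p p' : S p -> S p' -> e (m p) = e (m p') -> p = p'.
  move=> Sp Sp' E; apply: minj => //; apply/mnmP => j.
  have lt p1 : S p1 -> forall k, (m p1 k < D.+1)%N.
    by move=> Sp1 k; rewrite ltnS -(mD p1 Sp1) mnm_le_mdeg.
  exact: (digits_inj (lt _ Sp) (lt _ Sp') E).
pose Q : {poly R[i]} := \sum_(p | S p) c p *: 'X^(e (m p)).
(* Dividing by s puts the squared radii on the sphere; as all monomials have degree D, this costs
   the common factor s^-D. *)
have Q0 (t : R) : 0 < t -> Q.[t%:C] = 0.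
  move=> t0; pose x (j : 'I_n) := t ^+ (D.+1 ^ j)%N; pose s := \sum_j x j.
  have x0 j : 0 < x j by rewrite exprn_gt0.
  have s0 : 0 < s.
    by rewrite /s (bigD1 (Ordinal n0))//= ltr_wpDr// sumr_ge0// => j _; rewrite ltW.
  have sr : spos (fun j => Num.sqrt (x j / s)).
    split=> [j|]; first by rewrite sqrtr_gt0 divr_gt0.
    under eq_bigr do rewrite sqr_sqrtr ?divr_ge0 ?ltW//.
    by rewrite -mulr_suml divff// gt_eqF.
  have := H _ sr; have E p : S p -> \prod_j (Num.sqrt (x j / s) ^+ 2) ^+ m p j = t ^+ e (m p) / s ^+ D.
    move=> Sp; under eq_bigr do rewrite sqr_sqrtr ?divr_ge0 ?ltW// expr_div_n.
    rewrite prodf_div; congr (_ / _).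
      by rewrite /e -prodrXr; apply: eq_bigr => j _; rewrite -exprM mulnC.
    by rewrite prodrXr -mdegE mD.
  under eq_bigr => p Sp do rewrite E// rmorphM /= mulrA.
  rewrite -mulr_suml => /eqP; rewrite mulf_eq0 => /orP[/eqP HQ|].
    rewrite -[RHS]HQ /Q horner_sum; apply: eq_bigr => p _.
    by rewrite hornerZ hornerXn rmorphXn.
  by rewrite fmorph_eq0 invr_eq0 expf_eq0 gt_eqF// andbF.
have Qz : Q = 0.
  apply: (@roots_geq_poly_eq0 _ Q [seq k.+1%:R%:C | k <- iota 0 (size Q)]).
  - by apply/allP => _ /mapP[k _ ->]; rewrite /root Q0.
  - rewrite map_inj_uniq ?iota_uniq// => k l /complexI/eqP.
    by rewrite eqr_nat => /eqP[].
  - by rewrite size_map size_iota.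
move=> p Sp; have := congr1 (fun q : {poly R[i]} => q`_(e (m p))) Qz.
rewrite coef0 /Q coef_sum (bigD1 p)//= coefZ coefXn eqxx mulr1 big1 ?addr0// => q /andP[Sq qp].
rewrite coefZ coefXn; case: eqP => [/(einj _ _ Sp Sq) E|_]; last by rewrite mulr0.
by rewrite E eqxx in qp.
Qed.

Section Bounded.
Variable d : nat.
Local Notation I := (bmultinom n d.+1).

Definition topdeg (p : I * I) : bool := maxn (mdeg p.1) (mdeg p.2) == d.

Definition bimon (p : I * I) z : R[i] := mon p.1 z * Num.conj (mon p.2 z).

(* On the sphere, multiplying by sum_j |z_j|^2 = 1 turns z^a conj(z^b) with
   |a|, |b| <= d into a combination of such products with max(|a|, |b|) = d,
   and the latter are linearly independent there ([bimon_indep]). *)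
Definition topform (F : 'cV[R[i]]_n -> R[i]) := exists c : I * I -> R[i],
  forall z, usphere z -> F z = \sum_(p | topdeg p) c p * bimon p z.

Lemma mdegI (x : I) : (mdeg x <= d)%N.
Proof. by rewrite -ltnS bmdeg. Qed.

Lemma ccont_bimon p : ccont (bimon p).
Proof. by apply: ccontM; [apply: ccont_mon|apply: ccont_conj; apply: ccont_mon]. Qed.

Lemma mexp_sum m : \sum_j mexp m j = (mdeg m)%:Z.
Proof. by rewrite mdegE (big_morph Posz PoszD (erefl _)). Qed.

(** Characters isolate the pairs (a, b) with a - b = g. In such a class |a| - |b| is constant, so if
    one pair has |a| = d >= |b|, all have |a| = d; each pair is determined by a, and r^(a+b) =
    r^(2a) r^(-g) leaves monomials in the r_j^2 for [mon_indep]. The case |b| = d is symmetric. *)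
Lemma bimon_indep (c : I * I -> R[i]) : (0 < n)%N ->
  (forall z, usphere z -> \sum_(p | topdeg p) c p * bimon p z = 0) ->
  forall p, topdeg p -> c p = 0.
Proof.
move=> n0 H p0 tp0.
pose g j := mexp p0.1 j - mexp p0.2 j.
pose S p := topdeg p && [forall j, mexp p.1 j - mexp p.2 j == g j].
have Sp0 : S p0 by rewrite /S tp0; apply/forallP => j; rewrite eqxx.
have SE p j : S p -> mexp p.1 j - mexp p.2 j = g j by move=> /andP[_ /forallP/(_ j)/eqP].
have H1 r : spos r -> \sum_(p | S p) c p * (rpow r (mexp p.1) * rpow r (mexp p.2))%:C = 0.
  move=> sr.
  have : mean (fun u => (\sum_(p | topdeg p) c p * bimon p (ptor r u)) * chi (fun j => - g j) u) = 0.
    rewrite -[RHS](@mean_cst R n 0); apply: mean_eq => u tu; rewrite H ?mul0r//.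
    exact: usphere_ptor.
  have bb p : cbounded (fun u => bimon p (ptor r u) * chi (fun j => - g j) u).
    apply: cboundedM; last exact: cbounded_chi.
    exact: ccont_cbounded (ccont_bimon p) sr.
  rewrite (@mean_eq _ _ _ (fun u => \sum_(p | topdeg p) c p * (bimon p (ptor r u) * chi (fun j => - g j) u))); last first.
    by move=> u _; rewrite mulr_suml; apply: eq_bigr => p _; rewrite mulrA.
  rewrite mean_sum; last by move=> p _; apply: cboundedM => //; apply: cbounded_cst.
  move=> E; rewrite -[RHS]E /S big_mkcondr /=; apply: eq_bigr => p _.
  rewrite meanZ// mean_mon//; case: ifP => _ //; by rewrite mulr0.
have gdeg p : S p -> (mdeg p.1)%:Z - (mdeg p.2)%:Z = (mdeg p0.1)%:Z - (mdeg p0.2)%:Z :> int.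
  move=> Sp; rewrite -!mexp_sum -!sumrB; apply: eq_bigr => j _; exact: SE.
have rg r k p : spos r -> S p ->
    rpow r (mexp p.1) * rpow r (mexp p.2) = (\prod_j (r j ^+ 2) ^+ (if k then p.1 j else p.2 j)) *
      rpow r (fun j => if k then - g j else g j).
  move=> sr Sp; rewrite /rpow -!big_split /=; apply: eq_bigr => j _.
  have rj : r j != 0 by rewrite gt_eqF// sr.1.
  rewrite -exprM exprnP -!expfzDr//; congr (_ ^ _).
  by rewrite -(SE p j Sp) /mexp; case: k; lia.
have [d1|d2] : mdeg p0.1 = d \/ mdeg p0.2 = d.
  by move: tp0; rewrite /topdeg /maxn; case: ifP => _ /eqP ->; [right|left].
- have Sd p : S p -> mdeg p.1 = d.
    move=> Sp; have := gdeg p Sp; have /andP[] := Sp; rewrite /topdeg => /eqP; have := mdegI p0.2; lia.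
  apply: (@mon_indep _ S c (fun p => p.1 : multinom n) d) => //.
    move=> [p1 p2] [q1 q2] Sp Sq /= E; congr pair; apply: val_inj => //=.
    apply/mnmP => j; have := SE _ j Sp; have := SE _ j Sq; rewrite /mexp /= E; lia.
  move=> r sr; have gr := rpow_gt0 (fun j => - g j) sr.
  have := H1 r sr; under eq_bigr => p Sp do rewrite (rg r true p sr Sp) rmorphM mulrA.
  rewrite -mulr_suml => /eqP; rewrite mulf_eq0 => /orP[/eqP //|].
  by rewrite fmorph_eq0 gt_eqF.
- have Sd p : S p -> mdeg p.2 = d.
    move=> Sp; have := gdeg p Sp; have /andP[] := Sp; rewrite /topdeg => /eqP; have := mdegI p0.1; lia.
  apply: (@mon_indep _ S c (fun p => p.2 : multinom n) d) => //.
    move=> [p1 p2] [q1 q2] Sp Sq /= E; congr pair; apply: val_inj => //=.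
    apply/mnmP => j; have := SE _ j Sp; have := SE _ j Sq; rewrite /mexp /= E; lia.
  move=> r sr; have gr := rpow_gt0 g sr.
  have := H1 r sr; under eq_bigr => p Sp do rewrite (rg r false p sr Sp) rmorphM mulrA.
  rewrite -mulr_suml => /eqP; rewrite mulf_eq0 => /orP[/eqP //|].
  by rewrite fmorph_eq0 gt_eqF.
Qed.

Lemma topformD F G : topform F -> topform G -> topform (fun z => F z + G z).
Proof.
move=> [c Fc] [c' Gc]; exists (fun p => c p + c' p) => z zS.
by rewrite Fc// Gc// -big_split; apply: eq_bigr => p _; rewrite mulrDl.
Qed.

Lemma topformZ k F : topform F -> topform (fun z => k * F z).
Proof.
move=> [c Fc]; exists (fun p => k * c p) => z zS.
by rewrite Fc// mulr_sumr; apply: eq_bigr => p _; rewrite mulrA.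
Qed.

Lemma topform_sum (J : Type) (s : seq J) (P : pred J) (F : J -> 'cV[R[i]]_n -> R[i]) :
  (forall j, P j -> topform (F j)) -> topform (fun z => \sum_(j <- s | P j) F j z).
Proof.
move=> WF; elim: s => [|j s IH].
  by exists (fun=> 0) => z _; rewrite big_nil big1// => p _; rewrite mul0r.
have [/WF Wj|nP] := boolP (P j); last by under eq_fun do rewrite big_cons (negbTE nP).
under eq_fun do rewrite big_cons; case: (P j) => //; exact: topformD.
Qed.

Lemma topform_eq F G : (forall z, usphere z -> F z = G z) -> topform F -> topform G.
Proof. by move=> FG [c Fc]; exists c => z zS; rewrite -FG// Fc. Qed.

Lemma sphere_sum1 z : usphere z -> \sum_j z j 0 * Num.conj (z j 0) = 1.
Proof.
move=> zS; rewrite -(rmorph1 (real_complex R)) -[in RHS]zS rmorph_sum; apply: eq_bigr => j _.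
by rewrite -normCK rmorphXn.
Qed.

Lemma topform_mon a b : (mdeg a <= d)%N -> (mdeg b <= d)%N ->
  topform (fun z => mon a z * Num.conj (mon b z)).
Proof.
move: {2}(d - maxn (mdeg a) (mdeg b))%N (leqnn (d - maxn (mdeg a) (mdeg b))) => k.
elim: k a b => [|k IH] a b.
  rewrite leqn0 subn_eq0 => h ad bd.
  have ad' : (mdeg a < d.+1)%N by []. have bd' : (mdeg b < d.+1)%N by [].
  pose p0 : I * I := (BMultinom ad', BMultinom bd').
  have tp : topdeg p0 by rewrite /topdeg /= eqn_leq h geq_max ad bd.
  exists (fun p => (p == p0)%:R) => z _; rewrite (bigD1 p0)//= eqxx mul1r big1 ?addr0//.
  by move=> p /andP[_ /negbTE ->]; rewrite mul0r.
have [|lt] := leqP d (maxn (mdeg a) (mdeg b)).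
  by rewrite -subn_eq0 => /eqP h _; apply: IH; rewrite h.
move=> hk ad bd.
apply: (@topform_eq (fun z => \sum_(j < n) mon (mnm_add a (mnm1 j)) z * Num.conj (mon (mnm_add b (mnm1 j)) z))).
  move=> z zS; rewrite -[RHS]mulr1 -(sphere_sum1 zS) mulr_sumr; apply: eq_bigr => j _.
  by rewrite !monD !mon1 rmorphM /=; ring.
by apply: topform_sum => j _; apply: IH; rewrite !mdegD !mdeg1; lia.
Qed.

End Bounded.
End Independence.

(** * Pairings with a polynomial map *)

Section SphereFunctions.
Context {R : realType} {n : nat}.
Implicit Types (z w u : 'cV[R[i]]_n) (r : 'I_n -> R) (a b m : multinom n) (g : 'I_n -> int).
Implicit Types (F G : 'cV[R[i]]_n -> R[i]).
Local Notation torus := (@torus R n).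

Lemma sholo_ccont F : sholo F -> ccont F.
Proof. by move=> [U [hU SU]] z /SU Uz e e0; apply: holo_cont hU _ Uz _ e0. Qed.

Lemma sholo_all F : (forall z, differentiable F z) -> sholo F.
Proof. by move=> dF; exists setT; split => //; split => //; exact: openT. Qed.

Lemma sholo_op2 F G H : (forall z, differentiable F z -> differentiable G z -> differentiable H z) ->
  sholo F -> sholo G -> sholo H.
Proof.
move=> FGH [U [[oU dU] SU]] [V [[oV dV] SV]]; exists (U `&` V); split; last first.
  by move=> z zS; split; [exact: SU|exact: SV].
split; first exact: openI.
by move=> z [Uz Vz]; apply: FGH; [exact: dU|exact: dV].
Qed.

Lemma sholo_cst c : sholo (fun _ : 'cV[R[i]]_n => c).
Proof. by apply: sholo_all => z; apply: differentiable_cst. Qed.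

Lemma sholoD F G : sholo F -> sholo G -> sholo (fun z => F z + G z).
Proof. by apply: sholo_op2 => z dF dG; apply: differentiableD. Qed.

Lemma sholoM F G : sholo F -> sholo G -> sholo (fun z => F z * G z).
Proof. by apply: sholo_op2 => z dF dG; apply: differentiableM. Qed.

Lemma sholo_coord (j : 'I_n) : sholo (fun z : 'cV[R[i]]_n => z j 0).
Proof. by apply: sholo_all => z; apply: differentiable_coord. Qed.

Lemma sholo_sum (J : Type) (s : seq J) (P : pred J) (F : J -> 'cV[R[i]]_n -> R[i]) :
  (forall j, sholo (F j)) -> sholo (fun z => \sum_(j <- s | P j) F j z).
Proof.
move=> hF; elim: s => [|i s IH].
  by under eq_fun do rewrite big_nil; apply: sholo_cst.
under eq_fun do rewrite big_cons; case: (P i) => //.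
exact: sholoD.
Qed.

Lemma sholo_mon m : sholo (mon m : 'cV[R[i]]_n -> R[i]).
Proof.
rewrite /mon; elim: (index_enum _) => [|j s IH].
  by under eq_fun do rewrite big_nil; apply: sholo_cst.
under eq_fun do rewrite big_cons; apply: sholoM => //.
elim: (m j) => [|k IHk]; first exact: sholo_cst.
under eq_fun do rewrite exprS; apply: sholoM => //; exact: sholo_coord.
Qed.

Lemma sholo_eq0 F (c : ('I_n -> int) -> R[i]) : sholo F ->
  (forall r g, spos r -> mean (fun u => F (ptor r u) * chi (fun k => - g k) u) =
    c g * (\prod_k r k ^ g k)%:C) ->
  (forall g, c g = 0) -> forall z, usphere z -> F z = 0.
Proof.
move=> hF Fc c0; apply: sphere_unique; first exact: sholo_ccont.
move=> r g sr; have := Fc r (fun j => - g j) sr; rewrite c0 mul0r => <-.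
by apply: mean_eq => u _; congr (_ * chi _ _); apply/funext => j; rewrite opprK.
Qed.

Section Bounded.
Variable d : nat.
Local Notation I := (bmultinom n d.+1).

Lemma mean_bimon_sum (P : pred (I * I)) (D : I * I -> R[i]) r g : spos r ->
  mean (fun u => (\sum_(p | P p) D p * bimon p (ptor r u)) * chi (fun j => - g j) u) =
  \sum_(p | P p && [forall j, mexp p.1 j - mexp p.2 j == g j])
     D p * (rpow r (mexp p.1) * rpow r (mexp p.2))%:C.
Proof.
move=> sr; have bb p : cbounded (fun u => bimon (d := d) p (ptor r u) * chi (fun j => - g j) u).
  apply: cboundedM; last exact: cbounded_chi.
  exact: ccont_cbounded (ccont_bimon p) sr.
rewrite (@mean_eq _ _ _ (fun u => \sum_(p | P p) D p * (bimon p (ptor r u) * chi (fun j => - g j) u))); last first.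
  by move=> u _; rewrite mulr_suml; apply: eq_bigr => p _; rewrite mulrA.
rewrite mean_sum; last by move=> p _; apply: cboundedM => //; apply: cbounded_cst.
rewrite big_mkcondr /=; apply: eq_bigr => p _.
by rewrite meanZ// mean_mon//; case: ifP => _ //; rewrite mulr0.
Qed.

Variables (m : nat) (T : 'I_m -> 'cV[R[i]]_n -> R[i]) (P : 'I_m -> I -> R[i]).

Definition pairing z : R[i] := \sum_i T i z * Num.conj (\sum_b P i b * mon b z).

Hypothesis hT : forall i, sholo (T i).

Lemma ccont_pairing : ccont pairing.
Proof.
apply: ccont_sum => i; apply: ccontM; first exact: sholo_ccont.
apply: ccont_conj; apply: ccont_sum => b; apply: ccontM; [exact: ccont_cst|exact: ccont_mon].
Qed.

Variable c : 'I_m -> ('I_n -> int) -> R[i].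
Hypothesis cT : forall i r g, spos r ->
  mean (fun u => T i (ptor r u) * chi (fun k => - g k) u) = c i g * (rpow r g)%:C.

(** The product z^a conj(z^b) has weight a - b, so the weight g combines the coefficient of T at g +
    b with that of P at b. *)
Lemma mean_pairing r g : spos r ->
  mean (fun u => pairing (ptor r u) * chi (fun k => - g k) u) =
  \sum_(b : I) (\sum_i c i (fun j => g j + mexp b j) * Num.conj (P i b)) *
    (rpow r (fun j => g j + mexp b j) * rpow r (mexp b))%:C.
Proof.
move=> sr.
have bT i (b : I) : cbounded (fun u => T i (ptor r u) * chi (fun k => - (g k + mexp b k)) u).
  apply: cboundedM; last exact: cbounded_chi.
  exact: ccont_cbounded (sholo_ccont (hT i)) sr.
have bT' i (b : I) : cbounded (fun u => (Num.conj (P i b) * (rpow r (mexp b))%:C) *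
     (T i (ptor r u) * chi (fun k => - (g k + mexp b k)) u)).
  by apply: cboundedM => //; apply: cbounded_cst.
rewrite (@mean_eq _ _ _ (fun u => \sum_i \sum_b (Num.conj (P i b) * (rpow r (mexp b))%:C) *
     (T i (ptor r u) * chi (fun k => - (g k + mexp b k)) u))); last first.
  move=> u tu; rewrite /pairing mulr_suml; apply: eq_bigr => i _.
  rewrite rmorph_sum mulr_sumr mulr_suml; apply: eq_bigr => b _.
  rewrite rmorphM /= conj_mon_ptor//.
  rewrite (_ : (fun k => - (g k + mexp b k)) = fun k => - mexp b k + - g k); last first.
    by apply/funext => k; rewrite opprD addrC.
  by rewrite (chiD (fun k => - mexp b k) (fun k => - g k) tu); ring.
rewrite mean_sum; last by move=> i _; apply: cbounded_sum.
rewrite (eq_bigr (fun i => \sum_(b : I) (c i (fun j => g j + mexp b j) * Num.conj (P i b)) *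
    (rpow r (fun j => g j + mexp b j) * rpow r (mexp b))%:C)); last first.
  move=> i _; rewrite mean_sum//; apply: eq_bigr => b _.
  by rewrite meanZ// cT// rmorphM /=; ring.
by rewrite exchange_big /=; apply: eq_bigr => b _; rewrite mulr_suml.
Qed.

Hypothesis c_neg : forall i g j, g j < 0 -> c i g = 0.

(** Coefficient of z^a conj(z^b), for p = (a, b), in the formal expansion of [pairing]. *)
Let D (p : I * I) : R[i] := \sum_i c i (mexp p.1) * Num.conj (P i p.2).

Lemma match_deg (p : I * I) g : [forall j, mexp p.1 j - mexp p.2 j == g j] ->
  (mdeg p.1)%:Z - (mdeg p.2)%:Z = \sum_j g j :> int.
Proof. by move=> /forallP H; rewrite -!mexp_sum -sumrB; apply: eq_bigr => j _; apply/eqP/H. Qed.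

(** If g has total degree at most 0, then a = g + b satisfies |a| <= |b| <= d, so the pairs in
    [I * I] account for all that the pairing has at weight g. A vector g + b with a negative entry
    contributes nothing, by [c_neg]. *)
Lemma mean_part (Q : pred (I * I)) r g : spos r -> \sum_j g j <= 0 ->
  (forall p : I * I, [forall j, mexp p.1 j - mexp p.2 j == g j] -> Q p) ->
  mean (fun u => (\sum_(p | Q p) D p * bimon p (ptor r u)) * chi (fun j => - g j) u) =
  mean (fun u => pairing (ptor r u) * chi (fun k => - g k) u).
Proof.
move=> sr gle gQ; rewrite mean_bimon_sum// mean_pairing//.
pose mt (a b : I) := [forall j, mexp a j - mexp b j == g j].
pose F (a b : I) := D (a, b) * (rpow r (mexp a) * rpow r (mexp b))%:C.
transitivity (\sum_(b : I) \sum_(a : I | mt a b) F a b).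
  rewrite (eq_bigl (fun p : I * I => mt p.1 p.2)); last first.
    by move=> p; rewrite /mt; apply/andb_idl/gQ.
  rewrite (eq_bigr (fun p : I * I => F p.1 p.2)); last by case.
  rewrite big_mkcond -(pair_bigA _ (fun a b : I => if mt a b then F a b else 0)) exchange_big /=.
  by apply: eq_bigr => b _; rewrite -big_mkcond.
apply: eq_bigr => b _.
have [/forallP g0|/forallPn[j]] := boolP [forall j, 0 <= g j + mexp b j :> int]; last first.
  rewrite -ltNge => gj; rewrite big_pred0.
    by rewrite big1 ?mul0r// => i _; rewrite (c_neg _ gj) mul0r.
  move=> a; apply/negP => /forallP/(_ j)/eqP E; move: gj; rewrite -E /mexp; lia.
pose a0 := Multinom (mktuple (fun j : 'I_n => absz (g j + mexp b j))).
have a0E j : mexp a0 j = g j + mexp b j by rewrite /mexp mnmE gez0_abs.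
have da0 : (mdeg a0 < d.+1)%N.
  have : (mdeg a0)%:Z = \sum_j g j + (mdeg b)%:Z.
    by rewrite -!mexp_sum -big_split; apply: eq_bigr => j _; rewrite a0E.
  have := mdegI b; lia.
rewrite (big_pred1 (BMultinom da0)); last first.
  move=> a; apply/forallP/eqP => [H|-> j].
    apply: val_inj => /=; apply/mnmP => j; have /eqP := H j; have := a0E j; rewrite /mexp; lia.
  by rewrite /= a0E addrK.
have aE : mexp a0 = fun j => g j + mexp b j by apply/funext => j; rewrite a0E.
by rewrite /F /D /= aE.
Qed.

Lemma mean_part0 (Q : pred (I * I)) r g : spos r ->
  (forall p : I * I, [forall j, mexp p.1 j - mexp p.2 j == g j] -> ~~ Q p) ->
  mean (fun u => (\sum_(p | Q p) D p * bimon p (ptor r u)) * chi (fun j => - g j) u) = 0.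
Proof.
move=> sr gQ; rewrite mean_bimon_sum// big_pred0// => p.
by apply/negP => /andP[Qp /gQ/negP].
Qed.

Lemma pairing_imaginary_topform :
  (forall z, usphere z -> pairing z + Num.conj (pairing z) = 0) -> topform d pairing.
Proof.
move=> him.
(* Pairs with |a| = |b| belong to [Q1] only: weights of total degree 0 must not be counted again
   through conjugation. *)
pose Q1 (p : I * I) := (mdeg p.1 <= mdeg p.2)%N.
pose Q2 (p : I * I) := (mdeg p.1 < mdeg p.2)%N.
pose A (Q : pred (I * I)) z := \sum_(p | Q p) D p * bimon p z.
have cA Q : ccont (A Q).
  by apply: ccont_sum => p; apply: ccontM; [exact: ccont_cst|exact: ccont_bimon].
have bA Q r g : spos r -> cbounded (fun u => A Q (ptor r u) * chi (fun j => - g j) u).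
  move=> sr; apply: cboundedM; last exact: cbounded_chi.
  exact: ccont_cbounded (cA Q) sr.
have bP r g : spos r -> cbounded (fun u => pairing (ptor r u) * chi (fun j => - g j) u).
  move=> sr; apply: cboundedM; last exact: cbounded_chi.
  exact: ccont_cbounded ccont_pairing sr.
have conj_mean F r g : spos r -> ccont F ->
    mean (fun u => Num.conj (F (ptor r u)) * chi (fun j => - g j) u) =
    Num.conj (mean (fun u => F (ptor r u) * chi (fun j => - (- g j)) u)).
  move=> sr cF; rewrite -mean_conj; last first.
    by apply: cboundedM; [exact: ccont_cbounded|exact: cbounded_chi].
  apply: mean_eq => u tu; rewrite rmorphM /= conj_chi//.
  by congr (_ * chi _ _); apply/funext => j; rewrite opprK.
have Pconj r g : spos r -> mean (fun u => pairing (ptor r u) * chi (fun j => - g j) u) =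
    - Num.conj (mean (fun u => pairing (ptor r u) * chi (fun j => - (- g j)) u)).
  move=> sr; rewrite -(conj_mean _ _ _ sr ccont_pairing).
  apply/eqP; rewrite -addr_eq0 -meanD; first last.
  - apply: cboundedM; last exact: cbounded_chi.
    by apply: cbounded_conj; apply: ccont_cbounded ccont_pairing sr.
  - exact: bP.
  rewrite (@mean_eq _ _ _ (fun=> 0)) ?mean_cst// => u tu.
  by rewrite -mulrDl him ?mul0r//; apply: usphere_ptor.
have E z : usphere z -> pairing z = A Q1 z + (-1) * Num.conj (A Q2 z).
  move=> zS; apply/eqP; rewrite -subr_eq0; apply/eqP.
  have -> : pairing z - (A Q1 z + (-1) * Num.conj (A Q2 z)) =
    pairing z + ((-1) * A Q1 z + Num.conj (A Q2 z)) by ring.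
  move: z zS; apply: sphere_unique.
    apply: ccontD; first exact: ccont_pairing.
    apply: ccontD; last exact: ccont_conj.
    by apply: ccontM; first exact: ccont_cst.
  move=> r g' sr; pose g j := - g' j.
  have -> : g' = fun j => - g j by apply/funext => j; rewrite opprK.
  rewrite (@mean_eq _ _ _ (fun u => pairing (ptor r u) * chi (fun j => - g j) u +
    ((-1) * (A Q1 (ptor r u) * chi (fun j => - g j) u) +
     Num.conj (A Q2 (ptor r u)) * chi (fun j => - g j) u))); last first.
    by move=> u _; ring.
  have b2 : cbounded (fun u => Num.conj (A Q2 (ptor r u)) * chi (fun j => - g j) u).
    apply: cboundedM; last exact: cbounded_chi.
    by apply: cbounded_conj; apply: ccont_cbounded.
  have b1 : cbounded (fun u => -1 * (A Q1 (ptor r u) * chi (fun j => - g j) u)).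
    by apply: cboundedM; [exact: cbounded_cst|exact: bA].
  rewrite meanD; [|exact: bP|exact: cboundedD].
  rewrite meanD// meanZ; last exact: bA.
  rewrite (conj_mean _ _ _ sr (cA Q2)).
  have [gle|ggt] := lerP (\sum_j g j) 0.
    rewrite (mean_part sr gle); last first.
      by move=> p /match_deg H; rewrite /Q1 -lez_nat -subr_le0 H.
    have /= -> := @mean_part0 Q2 r (fun j => - g j) sr.
      by rewrite rmorph0 addr0 mulN1r subrr.
    by move=> p /match_deg H; rewrite /Q2 -leqNgt -lez_nat -subr_ge0 H sumrN oppr_ge0.
  rewrite (@mean_part0 Q1 r g sr) ?mulr0 ?add0r; last first.
    by move=> p /match_deg H; rewrite /Q1 -ltnNge -ltz_nat -subr_gt0 H.
  have /= -> := @mean_part Q2 r (fun j => - g j) sr.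
  - by rewrite Pconj// addNr.
  - by rewrite sumrN oppr_le0 ltW.
  - by move=> p /match_deg H; rewrite /Q2 -ltz_nat -subr_lt0 H sumrN oppr_lt0.
apply: (@topform_eq _ _ _ (fun z => A Q1 z + (-1) * Num.conj (A Q2 z))).
  by move=> z zS; rewrite E.
have WA (Q : pred (I * I)) : topform d (A Q).
  by apply: topform_sum => p _; apply: topformZ; apply: topform_mon; apply: mdegI.
apply: topformD => //; apply: topformZ.
apply: (@topform_eq _ _ _ (fun z => \sum_(p | Q2 p) Num.conj (D p) * (mon p.2 z * Num.conj (mon p.1 z)))).
  move=> z _; rewrite rmorph_sum; apply: eq_bigr => p _.
  by rewrite rmorphM /= /bimon rmorphM /= conjCK mulrC [Num.conj (mon _ _) * _]mulrC mulrC.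
by apply: topform_sum => p _; apply: topformZ; apply: topform_mon; apply: mdegI.
Qed.

End Bounded.
End SphereFunctions.

(** * Real dimension of the deformations *)

Section RealBasis.
Context {R : realType} {E : lmodType R[i]} {T : finType}.
Variables (V : set E) (psi : E -> (T -> R) -> Prop).
Hypothesis V0 : V 0.
Hypothesis Vlin : forall (a : R) x y, V x -> V y -> V (a%:C *: x + y).
Hypothesis psi0 : psi 0 (fun=> 0).
Hypothesis psi_lin : forall (a : R) x y f g, psi x f -> psi y g ->
  psi (a%:C *: x + y) (fun t => a * f t + g t).
Hypothesis psi_ex : forall x, V x -> exists f, psi x f.
Hypothesis psi_inj : forall x, V x -> psi x (fun=> 0) -> x = 0.

Definition real_free k (b : 'I_k -> E) :=
  forall c : 'I_k -> R, \sum_i (c i)%:C *: b i = 0 -> forall i, c i = 0.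

Lemma sum_V (I : Type) (s : seq I) (c : I -> R) (b : I -> E) :
  (forall i, V (b i)) -> V (\sum_(i <- s) (c i)%:C *: b i).
Proof. by move=> Vb; elim: s => [|i s IH]; rewrite ?big_nil// big_cons; apply: Vlin. Qed.

Lemma sum_psi (I : Type) (s : seq I) (c : I -> R) (b : I -> E) (f : I -> T -> R) :
  (forall i, psi (b i) (f i)) ->
  psi (\sum_(i <- s) (c i)%:C *: b i) (fun t => \sum_(i <- s) c i * f i t).
Proof.
move=> bf; elim: s => [|i s IH].
  by rewrite big_nil; under eq_fun do rewrite big_nil.
rewrite big_cons (_ : (fun t => _) = fun t => c i * f i t + \sum_(j <- s) c j * f j t).
  exact: psi_lin.
by apply/funext => t; rewrite big_cons.
Qed.

(** [psi x f] says that f is a coordinate vector of x; a relation is used because coordinates are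
    obtained by an existence statement. By injectivity a dependence among the coordinate rows is one
    among the vectors. *)
Lemma free_matrix k (b : 'I_k -> E) (f : 'I_k -> T -> R) :
  (forall i, V (b i)) -> real_free b -> (forall i, psi (b i) (f i)) ->
  row_free (\matrix_(i, j) f i (enum_val j) : 'M[R]_(k, #|T|)).
Proof.
move=> Vb fb bf; set M := \matrix_(_, _) _; rewrite -kermx_eq0.
apply: contraT => /matrix0Pn[p [q /eqP]]; case; apply: (fb (fun i => kermx M p i)).
apply: psi_inj; first exact: sum_V.
have := sum_psi (index_enum _) (fun i => kermx M p i) bf.
congr psi; apply/funext => t.
have /matrixP/(_ p (enum_rank t)) := mulmx_ker M; rewrite [RHS]mxE mxE => E0; rewrite -[RHS]E0.
by apply: eq_bigr => i _; rewrite [M i _]mxE enum_rankK.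
Qed.

Lemma free_le k (b : 'I_k -> E) : (forall i, V (b i)) -> real_free b -> (k <= #|T|)%N.
Proof.
move=> Vb fb; have /choice[f bf] i := psi_ex (Vb i).
by have /eqP <- := free_matrix Vb fb bf; apply: rank_leq_col.
Qed.

(** With #|T| vectors the coordinate matrix is square with independent rows, so its rows span all
    coordinate vectors. *)
Lemma free_full k (b : 'I_k -> E) : (forall i, V (b i)) -> real_free b -> k = #|T| ->
  forall f, exists2 x, V x & psi x f.
Proof.
move=> Vb fb kT f; have /choice[g bg] i := psi_ex (Vb i).
have := free_matrix Vb fb bg; set M := \matrix_(_, _) _ => Mfree.
have /row_fullP[B BM] : row_full M by rewrite /row_full (eqP Mfree) kT.
pose c i := (\row_j f (enum_val j) *m B) 0 i.
exists (\sum_i (c i)%:C *: b i); first exact: sum_V.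
have := sum_psi (index_enum _) c bg; congr psi; apply/funext => t.
have : ((\row_j f (enum_val j)) *m B *m M) 0 (enum_rank t) = f t.
  by rewrite -mulmxA BM mulmx1 mxE enum_rankK.
rewrite mxE => <-; apply: eq_bigr => i _.
by rewrite [M i _]mxE enum_rankK.
Qed.

(** A free family of maximal size, which exists by [free_le], spans: otherwise a missed vector could
    be appended. *)
Lemma exists_real_basis : exists k (b : 'I_k -> E), real_basis V b /\ (k <= #|T|)%N.
Proof.
pose P k := `[< exists b : 'I_k -> E, (forall i, V (b i)) /\ real_free b >].
have P0 : P 0%N by apply/asboolP; exists (fun=> 0); split => // c _ [].
have Pub k : P k -> (k <= #|T|)%N by move=> /asboolP[b [Vb fb]]; apply: free_le fb.
have [k /asboolP[b [Vb fb]] kmax] := ex_maxnP (ex_intro P 0%N P0) Pub.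
exists k, b; split; last exact: free_le fb.
split => // x Vx; apply: contrapT => nx.
suff /kmax : P k.+1 by rewrite ltnn.
apply/asboolP; exists (fun i : 'I_k.+1 => if insub (i : nat) is Some j then b j else x).
split=> [i|c]; first by case: insub.
have bw (j : 'I_k) : insub (nat_of_ord j) = Some j :> option 'I_k by rewrite valK.
have bm : insub (nat_of_ord (@ord_max k)) = None :> option 'I_k by rewrite insubF//= ltnn.
rewrite big_ord_recr /= bm; under eq_bigr do rewrite bw.
move=> sum0; have cm : c ord_max = 0.
  apply/eqP; apply: contrapT => /negP cm; apply: nx.
  exists (fun j => - (c ord_max)^-1 * c (widen_ord (leqnSn k) j)).
  have cm' : (c ord_max)%:C != 0 by rewrite fmorph_eq0.
  apply: (scalerI cm'); rewrite scaler_sumr.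
  have -> : (c ord_max)%:C *: x = - \sum_(j < k) (c (widen_ord (leqnSn k) j))%:C *: b j.
    by apply/eqP; rewrite -addr_eq0 addrC sum0.
  rewrite -sumrN; apply: eq_bigr => j _.
  by rewrite scalerA -rmorphM mulNr mulrN mulrA divff// mul1r rmorphN scaleNr.
move: sum0; rewrite cm scale0r addr0 => /fb c0 i.
case: (unliftP ord_max i) => [j ->|->] //.
rewrite -[RHS](c0 j); congr c; apply: val_inj => /=; rewrite /bump leqNgt ltn_ord add0n //.
Qed.

(** The basis consists of preimages of the unit coordinate vectors. *)
Lemma full_basis : (forall f, exists2 x, V x & psi x f) ->
  (forall f, psi 0 f -> f = fun=> 0) -> exists b : 'I_#|T| -> E, real_basis V b.
Proof.
move=> surj uniq.
have /choice[X XP] : forall j : 'I_#|T|, exists x, V x /\ psi x (fun t => (t == enum_val j)%:R).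
  by move=> j; have [x] := surj (fun t => (t == enum_val j)%:R); exists x.
have comb c : psi (\sum_j (c j)%:C *: X j) (fun t => c (enum_rank t)).
  have := sum_psi (index_enum _) c (fun j => (XP j).2); congr psi; apply/funext => t.
  rewrite (bigD1 (enum_rank t))//= enum_rankK eqxx mulr1 big1 ?addr0// => j jt.
  rewrite (_ : t == enum_val j = false) ?mulr0//.
  by apply: contraNF jt => /eqP ->; rewrite enum_valK.
exists X; split; first by move=> j; exact: (XP j).1.
  move=> c c0 j; have := comb c; rewrite c0 => /uniq/(congr1 (@^~ (enum_val j))) /=.
  by rewrite enum_valK.
move=> x Vx; have [f xf] := psi_ex Vx; exists (fun j => f (enum_val j)).
apply/esym/eqP; rewrite -subr_eq0 -scaleN1r addrC; apply/eqP.
have -> : -1 = (-1)%:C :> R[i] by rewrite rmorphN1.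
apply: psi_inj.
  by apply: Vlin => //; apply: sum_V => j; exact: (XP j).1.
have := psi_lin (-1) xf (comb (fun j => f (enum_val j))).
by congr psi; apply/funext => t; rewrite enum_rankK mulN1r addNr.
Qed.

End RealBasis.

(** * Real coordinates of imaginary forms, and their number *)

Section Coordinates.
Context {R : realType} {n d : nat}.
Local Notation I := (bmultinom n d.+1).

Definition swapI (p : I * I) : I * I := (p.2, p.1).

Lemma swapIK : involutive swapI.
Proof. by case. Qed.

Lemma conj_bimon_swap p (z : 'cV[R[i]]_n) : Num.conj (bimon (swapI p) z) = bimon p z.
Proof. by rewrite /bimon rmorphM /= conjCK mulrC. Qed.

Lemma topdeg_swap p : topdeg (swapI p) = topdeg p.
Proof. by rewrite /topdeg maxnC. Qed.

Definition topI := {p : I * I | topdeg p}.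

Definition ext0 (x : topI -> R) (p : I * I) : R := if insub p is Some t then x t else 0.

(* Purely imaginary forms sum_p c_p [bimon p] are those with
   c (swapI p) = - conj (c p); the real vector x parametrizes such c by
   x_p = Re c_p + Im c_p. *)
Definition skew (x : topI -> R) (p : I * I) : R[i] :=
  ((ext0 x p - ext0 x (swapI p)) / 2) +i* ((ext0 x p + ext0 x (swapI p)) / 2).

Definition skew_form (x : topI -> R) (z : 'cV[R[i]]_n) : R[i] :=
  \sum_(p | topdeg p) skew x p * bimon p z.

Lemma skew_lin (a : R) x y p : skew (fun t => a * x t + y t) p = a%:C * skew x p + skew y p.
Proof.
have e q : ext0 (fun t => a * x t + y t) q = a * ext0 x q + ext0 y q.
  by rewrite /ext0; case: insub => //; rewrite mulr0 addr0.
by rewrite /skew !e; simpc; congr (_ +i* _); field.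
Qed.

Lemma skew_form_lin (a : R) x y z :
  skew_form (fun t => a * x t + y t) z = a%:C * skew_form x z + skew_form y z.
Proof.
rewrite /skew_form mulr_sumr -big_split; apply: eq_bigr => p _.
by rewrite skew_lin mulrDl mulrA.
Qed.

Lemma skew_form0 z : skew_form (fun=> 0) z = 0.
Proof.
apply: big1 => p _; rewrite /skew /ext0.
by do 2 case: insub => [?|]; rewrite ?subrr ?addr0 ?mul0r.
Qed.

Lemma skew_inj x : (0 < n)%N -> (forall z, usphere z -> skew_form x z = 0) -> x = fun=> 0.
Proof.
move=> n0 x0; have c0 := bimon_indep n0 x0; apply/funext => t.
have tv := valP t; have xt : ext0 x (val t) = x t by rewrite /ext0 valK.
have /eqP := c0 _ tv; rewrite /skew eq_complex /= xt => /andP[/eqP h1 /eqP h2].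
have h1' : x t - ext0 x (swapI (val t)) = 0.
  by apply/eqP; move/eqP: h1; rewrite mulf_eq0 invr_eq0 pnatr_eq0 orbF.
have h2' : x t + ext0 x (swapI (val t)) = 0.
  by apply/eqP; move/eqP: h2; rewrite mulf_eq0 invr_eq0 pnatr_eq0 orbF.
by lra.
Qed.

Lemma skew_conj x z : skew_form x z + Num.conj (skew_form x z) = 0.
Proof.
rewrite /skew_form rmorph_sum.
rewrite [X in _ + X](reindex_inj (inv_inj swapIK)) /=.
rewrite [X in _ + X](eq_bigl (fun p => topdeg p)); last by move=> p; rewrite topdeg_swap.
rewrite -big_split big1//= => p _; rewrite rmorphM /=.
rewrite conj_bimon_swap -mulrDl (_ : _ + _ = 0) ?mul0r//.
have cE a b : Num.conj (a +i* b : R[i]) = a +i* - b by [].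
rewrite /skew swapIK cE; apply/eqP; rewrite eq_complex /=; apply/andP; split; apply/eqP; lra.
Qed.

(** Independence turns F + conj F = 0 into c (swapI p) = - conj (c p), after which Re c + Im c at p
    and at its swap recover c. One real parameter per index fits both a swapped couple, which shares
    one complex coefficient, and a fixed point, whose coefficient is imaginary. *)
Lemma skew_surj F : (0 < n)%N -> topform d F ->
  (forall z : 'cV[R[i]]_n, usphere z -> F z + Num.conj (F z) = 0) ->
  exists x, forall z, usphere z -> F z = skew_form x z.
Proof.
move=> n0 [c Fc] Fim.
have cE p : topdeg p -> c p + Num.conj (c (swapI p)) = 0.
  apply: (@bimon_indep R n d (fun p => c p + Num.conj (c (swapI p)))) => // z zS.
  rewrite -[RHS](Fim z zS) Fc// rmorph_sum.
  rewrite [X in _ = _ + X](reindex_inj (inv_inj swapIK)) /=.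
  rewrite [X in _ = _ + X](eq_bigl (fun p => topdeg p)); last by move=> p'; rewrite topdeg_swap.
  rewrite -big_split; apply: eq_bigr => p' _; rewrite rmorphM /=.
  by rewrite conj_bimon_swap mulrDl.
exists (fun t => complex.Re (c (val t)) + complex.Im (c (val t))) => z zS.
rewrite Fc//; apply: eq_bigr => p tp; congr (_ * _); rewrite /skew /ext0.
have tp' : topdeg (swapI p) by rewrite topdeg_swap.
rewrite !insubT /= {Fc}; have := cE p tp.
case: (c p) => a b; case: (c (swapI p)) => a' b' /eqP; rewrite eq_complex /= => /andP[/eqP h1 /eqP h2].
apply/eqP; rewrite eq_complex /=; apply/andP; split; apply/eqP; lra.
Qed.

Lemma card_topI : #|{: topI}| =
  (#|[pred a : I | mdeg a == d]| ^ 2 +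
   2 * (#|[pred a : I | mdeg a == d]| * #|[pred a : I | (mdeg a < d)%N]|))%N.
Proof.
rewrite card_sig; set D := #|[pred a : I | mdeg a == d]|.
set L := #|[pred a : I | (mdeg a < d)%N]|.
have cI : #|{: I}| = (D + L)%N.
  rewrite /D -(cardC [pred a : I | mdeg a == d]); congr (_ + _)%N.
  by apply: eq_card => a; rewrite !inE ltn_neqAle mdegI andbT.
transitivity (#|predX [pred a : I | mdeg a == d] [pred _ : I | true]| +
   #|predX [pred a : I | (mdeg a < d)%N] [pred a : I | mdeg a == d]|)%N.
  rewrite -cardUI [X in _ = (_ + X)%N]eq_card0 ?addn0.
    apply: eq_card => -[a b]; rewrite !inE /topdeg /=; have := mdegI a; have := mdegI b.
    by rewrite /maxn; case: ltngtP => /=; lia.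
  by move=> [a b]; rewrite !inE /=; case: eqP => // ->; rewrite ltnn.
by rewrite !cardX -/D -/L (eq_card (B := {: I})) ?cI//; lia.
Qed.

Lemma Multinom_val_inj k e : injective (fun t : k.-tuple 'I_e.+1 => Multinom [tuple of map val t]).
Proof. move=> t t' E; apply/eq_from_tnth => j; have /mnmP/(_ j) := E; rewrite /fun_of_multinom /= !tnth_map; exact: val_inj. Qed.

(** Bounded multinomials are matched with tuples of entries at most e, where e bounds the degrees in
    [A]: e = d gives the index set counted by [K], and e = d - 1 gives the tuples of sum at most d -
    1. *)
Lemma card_mdeg e (A : pred nat) : (e <= d)%N -> (forall k, A k -> (k <= e)%N) ->
  #|[pred a : I | A (mdeg a)]| = #|[set t : n.-tuple 'I_e.+1 | A (\sum_(i <- t) i)%N]%SET|.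
Proof.
move=> ed Ae; pose f (t : n.-tuple 'I_e.+1) := Multinom [tuple of map val t].
have df t : mdeg (f t) = (\sum_(i <- t) i)%N by rewrite /mdeg /= big_map.
pose g t : I := insubd (bm0 : I) (f t).
have gE (t : n.-tuple 'I_e.+1) : A (\sum_(i <- t) i)%N -> (g t : multinom n) = f t.
  by move=> /Ae ht; rewrite /g -[LHS]/(val _) val_insubd /= df ltnS (leq_trans ht ed).
rewrite -(@card_in_imset _ _ g) => [|t t']; last first.
  rewrite !inE => /gE h /gE h' E; apply: (@Multinom_val_inj n e).
  by rewrite -[LHS]/(f t) -[RHS]/(f t') -h -h' E.
apply/esym/eq_card => a; rewrite !inE; apply/imsetP/idP => [[t]|ad].
  by rewrite inE => ht ->; rewrite gE// df.
have lt j : (a j < e.+1)%N by rewrite ltnS (leq_trans (mnm_le_mdeg a j))// Ae.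
pose t := [tuple Ordinal (lt j) | j < n].
have ft : f t = a.
  by apply/mnmP => j; rewrite /f /fun_of_multinom /= tnth_map tnth_mktuple.
have ts : A (\sum_(i <- t) i)%N by rewrite -df ft.
exists t; first by rewrite inE.
by apply: val_inj; rewrite -[RHS]/(bmnm (g t)) gE ?ft.
Qed.

Lemma card_mdeg_lt : (0 < d)%N -> #|[pred a : I | (mdeg a < d)%N]| = 'C(n + d.-1, n).
Proof.
move=> d0; rewrite -(card_partial_ord_partitions n d.-1) (@card_mdeg d.-1 (fun k => k < d)%N).
- by apply: eq_card => t; rewrite !inE; lia.
- exact: leq_pred.
- by move=> k; lia.
Qed.

Lemma card_mdeg_eq : #|[pred a : I | mdeg a == d]| = K n d.
Proof.
rewrite -(eqP (size_multiindex_seq n d)) size_sort -cardE.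
by apply: (@card_mdeg d (pred1 d)) => // k /eqP ->.
Qed.

Lemma card_topI_eq : (0 < n)%N -> (0 < d)%N ->
  #|{: topI}|%:R = (2 * d + n)%N%:R / n%:R * (K n d)%:R ^+ 2 :> R.
Proof.
move=> n0 d0; rewrite card_topI card_mdeg_lt// card_mdeg_eq.
have E : (n * 'C(n + d.-1, n) = d * K n d)%N.
  rewrite /K; case: n n0 => [|n'] // _; case: d d0 => // d' _; rewrite mul_bin_left /=.
  rewrite (_ : n'.+1 + d'.+1 - 1 = n'.+1 + d')%N; last by lia.
  by rewrite -(@bin_sub _ d'.+1); last (by lia); congr (_ * 'C(_, _))%N; lia.
have nn : n%:R != 0 :> R by rewrite pnatr_eq0 -lt0n.
have ER : 'C(n + d.-1, n)%:R = d%:R * (K n d)%:R / n%:R :> R.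
  by rewrite -natrM -E natrM mulrAC divff// mul1r.
by rewrite natrD natrX !natrM natrD natrM ER; field.
Qed.

End Coordinates.

(** * Maps given by coordinates: spanning and monomial maps *)

Section Bridge.
Context {R : realType} {n m : nat}.
Implicit Types (z w : 'cV[R[i]]_n) (Y : 'cV[R[i]]_n -> 'cV[R[i]]_m).

(** The neighbourhoods of the finitely many coordinates are intersected. *)
Lemma holo_near_sphereP Y : holo_near_sphere Y <-> forall i, sholo (fun z => Y z i 0).
Proof.
split=> [[U [oU SU dY]] i|hY].
  exists U; split; last by move=> z /unit_sphereE/SU.
  split=> // z Uz; apply: (@differentiable_comp _ _ _ _ Y (fun v => v i 0)); first exact: dY.
  exact: differentiable_coord.
have [U] : exists U : set 'cV[R[i]]_n, [/\ open U, (forall z, usphere z -> U z) &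
    forall z, U z -> forall i, i \in enum 'I_m -> differentiable (fun z => Y z i 0) z].
  elim: (enum 'I_m) => [|i s [U [oU SU dU]]]; first by exists setT; split => //; exact: openT.
  have [V [[oV dV] SV]] := hY i; exists (V `&` U); split; first exact: openI.
    by move=> z zS; split; [exact: SV|exact: SU].
  move=> z [Vz Uz] j; rewrite inE => /orP[/eqP ->|js]; first exact: dV.
  exact: dU.
move=> [oU SU dU]; exists U; split => //; first by move=> z /unit_sphereE/SU.
move=> z Uz.
have -> : Y = \sum_i (fun z => Y z i 0 *: delta_mx i 0).
  apply/funext => w; rewrite fct_sumE; apply/matrixP => i j; rewrite (ord1 j) summxE.
  rewrite (bigD1 i)//= mxE mxE !eqxx mulr1 big1 ?addr0// => k ki.
  by rewrite mxE mxE eq_sym (negbTE ki) mulr0.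
apply: differentiable_sum => i; apply: differentiableZl.
by apply: dU => //; rewrite mem_enum.
Qed.

End Bridge.

Section Peval.
Context {R : realType} {n d : nat}.
Local Notation I := (bmultinom n d.+1).

Lemma peval_mon (p : mpoly n R[i]) z : (msize p <= d.+1)%N ->
  peval p z = \sum_(b : I) mcoeff b p * mon b z.
Proof.
move=> pd; rewrite /peval {1}(mpolywE pd) raddf_sum /=; apply: eq_bigr => b _.
by rewrite mevalZ mevalX.
Qed.

End Peval.

Section Spanning.
Context {R : realType} {n d m : nat}.
Local Notation I := (bmultinom n d.+1).
Implicit Types (z w : 'cV[R[i]]_n).
Variable P : 'I_m -> I -> R[i].

Definition paired (F : 'cV[R[i]]_n -> R[i]) := exists T : 'I_m -> 'cV[R[i]]_n -> R[i],
  (forall i, sholo (T i)) /\ forall z, usphere z -> pairing T P z = F z.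

Hypothesis span : forall b : I, mdeg b = d -> exists w : 'I_m -> R[i],
  forall z, usphere z -> mon b z = \sum_i w i * \sum_c P i c * mon c z.

(** For |b| = d, [span] makes conj(z^b) a pairing with constants. For smaller |b|, multiplication by
    sum_j |z_j|^2 = 1 raises a and b together; the growing z^a is absorbed into T. *)
Lemma pairing_mon (a b : multinom n) : (mdeg b <= d)%N -> paired (fun z => mon a z * Num.conj (mon b z)).
Proof.
move: {2}(d - mdeg b)%N (erefl (d - mdeg b)%N) => k.
elim: k a b => [|k IH] a b.
  move=> h bd; have bd' : (mdeg b < d.+1)%N by [].
  have [|w wP] := @span (BMultinom bd'); first by rewrite /=; lia.
  exists (fun i z => Num.conj (w i) * mon a z); split.
    by move=> i; apply: sholoM; [exact: sholo_cst|exact: sholo_mon].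
  move=> z zS; rewrite [in RHS]wP// rmorph_sum mulr_sumr; apply: eq_bigr => i _.
  by rewrite rmorphM /= mulrCA mulrA.
move=> hk bd.
have /choice[T TP] : forall j : 'I_n, paired (fun z => mon (mnm_add a (mnm1 j)) z * Num.conj (mon (mnm_add b (mnm1 j)) z)).
  by move=> j; apply: IH; rewrite mdegD mdeg1; lia.
exists (fun i z => \sum_j T j i z); split.
  by move=> i; apply: sholo_sum => j; exact: (TP j).1.
move=> z zS; rewrite /pairing; under eq_bigr do rewrite mulr_suml.
rewrite exchange_big /= -[RHS]mulr1 -(sphere_sum1 zS) mulr_sumr; apply: eq_bigr => j _.
by have := (TP j).2 z zS; rewrite /pairing => ->; rewrite !monD !mon1 rmorphM /=; ring.
Qed.

Lemma pairing_skew_form x : paired (skew_form (d := d) x).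
Proof.
have /choice[T TP] : forall p : I * I, paired (bimon p).
  by move=> p; apply: pairing_mon; have := mdegI p.2.
exists (fun i z => \sum_(p | topdeg p) skew x p * T p i z); split.
  move=> i; apply: sholo_sum => p; apply: sholoM; first exact: sholo_cst.
  exact: (TP p).1.
move=> z zS; rewrite /pairing; under eq_bigr do rewrite mulr_suml.
rewrite exchange_big /=; apply: eq_bigr => p _.
by rewrite -(TP p).2// /pairing mulr_sumr; apply: eq_bigr => i _; rewrite mulrA.
Qed.

End Spanning.

Section MonomialMaps.
Context {R : realType} {n d m : nat}.
Local Notation I := (bmultinom n d.+1).

(** At weight g the pairing is r^g times a combination of the distinct monomials r^(2 b_i), with
    coefficients c_i(g + b_i) conj(s_i) where c_i are the Taylor coefficients of T_i. These vanish
    by [mon_indep], and g + b_i runs over all exponents. *)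
Lemma monomial_nondeg (s : 'I_m -> R[i]) (b : 'I_m -> I) (T : 'I_m -> 'cV[R[i]]_n -> R[i]) :
  (1 < n)%N -> (forall i, s i != 0) -> (forall i, mdeg (b i) = d) -> injective b ->
  (forall i, sholo (T i)) ->
  (forall z, usphere z -> pairing T (fun i c => s i *+ (c == b i)) z = 0) ->
  forall i z, usphere z -> T i z = 0.
Proof.
move=> n1 s0 bd bi hT T0; have n0 := ltnW n1.
have /choice[c cP] i := taylor n1 (hT i).
have cE r g i : spos r -> mean (fun u => T i (ptor r u) * chi (fun k => - g k) u) =
  c i g * (rpow r g)%:C by move=> sr; rewrite (cP i).2.
have c0 g i : c i (fun j => g j + mexp (b i) j) = 0.
  apply: (mulIf (x := Num.conj (s i))); first by rewrite fmorph_eq0.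
  rewrite mul0r; apply: (@mon_indep R n _ xpredT (fun i => c i (fun j => g j + mexp (b i) j) * Num.conj (s i))
    (fun i => b i : multinom n) d) => //.
    by move=> j k _ _ /val_inj/bi.
  move=> r sr; have := @mean_pairing R n d m T (fun i c => s i *+ (c == b i)) hT c
    (fun i r g => cE r g i) r g sr.
  rewrite (@mean_eq _ _ _ (fun=> 0)) ?mean_cst; last first.
    by move=> u tu; rewrite T0 ?mul0r//; apply: usphere_ptor.
  rewrite (eq_bigr (fun e : I => \sum_i (c i (fun j => g j + mexp e j) * Num.conj (s i) *
    (rpow r g * (rpow r (mexp e) ^+ 2))%:C) *+ (e == b i))); last first.
    move=> e _; rewrite mulr_suml; apply: eq_bigr => j _; rewrite rpowD//.
    by case: (e == b j); rewrite ?mulr1n ?mulr0n ?rmorph0 ?mulr0 ?mul0r// expr2 mulrA.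
  rewrite exchange_big /= => /esym E0.
  have gr := rpow_gt0 g sr.
  apply: (mulIf (x := (rpow r g)%:C)); first by rewrite fmorph_eq0 gt_eqF.
  rewrite mul0r -[RHS]E0 mulr_suml; apply: eq_bigr => j _.
  rewrite [RHS](bigD1 (b j))//= eqxx mulr1n [X in _ = _ + X]big1 ?addr0; last by move=> e ej; rewrite (negbTE ej) mulr0n.
  rewrite [in RHS]rmorphM mulrA [in RHS]mulrAC; congr (_ * _%:C * _).
  rewrite /rpow -prodrXl; apply: eq_bigr => k _; rewrite /mexp -exprnP -exprM mulnC exprM //.
move=> i; apply: (sholo_eq0 (hT i) (c := c i)); first exact: (cP i).2.
move=> g; rewrite -(c0 (fun j => g j - mexp (b i) j) i); congr (c i _).
by apply/funext => j; rewrite subrK.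
Qed.

End MonomialMaps.

Definition nondeg (R : realType) n m (H : 'cV[R[i]]_n -> 'cV[R[i]]_m) :=
  forall Y, holo_near_sphere Y ->
    (forall z, usphere z -> bdot (Y z) (conjv (H z)) = 0) -> forall z, usphere z -> Y z = 0.

(** * The deformation space of a rational map *)

Section Deformations.
Context {R : realType} {n d m : nat}.
Local Notation I := (bmultinom n d.+1).
Local Notation S := (@unit_sphere R n).
Implicit Types (z w : 'cV[R[i]]_n) (Y : 'cV[R[i]]_n -> 'cV[R[i]]_m).
Variables (H : 'cV[R[i]]_n -> 'cV[R[i]]_m) (P : 'I_m -> I -> R[i]) (q : 'cV[R[i]]_n -> R[i]).
Hypotheses (n1 : (1 < n)%N) (hq : sholo q) (q0 : forall z, usphere z -> q z != 0).
Hypothesis HE : forall z, usphere z -> forall i, H z i 0 = (\sum_b P i b * mon b z) / q z.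
Hypothesis ndH : nondeg H.

(** Relates X to the real coordinates of q X . conj(P), where [P] is the numerator and [q] the
    denominator of H; this is the relation [psi] of the section on real bases. *)
Definition has_skew_form (X : S -> 'cV[R[i]]_m) (x : topI -> R) := forall t : S,
  \sum_i q (set_val t) * X t i 0 * Num.conj (\sum_b P i b * mon b (set_val t)) =
  skew_form (d := d) x (set_val t).

(** Since conj(P) = conj(q) conj(H), clearing denominators multiplies by the positive real |q|^2,
    which preserves both being imaginary and being 0. *)
Lemma pairing_bdot Y z : usphere z ->
  pairing (fun i z => q z * Y z i 0) P z = q z * Num.conj (q z) * bdot (Y z) (conjv (H z)).
Proof.
move=> zS; have qz := q0 zS.
have qz' : Num.conj (q z) != 0 by rewrite fmorph_eq0.
rewrite /bdot mulr_sumr; apply: eq_bigr => i _; rewrite mxE HE// rmorphM /= fmorphV.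
by field.
Qed.

Lemma Re0_conj (w : R[i]) : complex.Re w = 0 <-> w + Num.conj w = 0.
Proof.
case: w => a b /=; split=> [->|/eqP].
  by apply/eqP; rewrite eq_complex /= addr0 subrr eqxx.
by rewrite eq_complex /= => /andP[/eqP E _]; lra.
Qed.

Lemma sphere_point (t : S) : usphere (set_val t).
Proof. by apply/unit_sphereE; exact: set_mem (valP t). Qed.

Lemma sphere_lift z : usphere z -> exists t : S, set_val t = z.
Proof. by move=> /unit_sphereE zS; exists (SigSub (mem_set zS)). Qed.

Lemma hol0 : hol H 0.
Proof.
exists (fun=> 0); split => //.
  by apply/holo_near_sphereP => i; under eq_fun do rewrite mxE; exact: sholo_cst.
by move=> z _; rewrite /bdot big1//= => i _; rewrite mxE mul0r.
Qed.

Lemma hol_lin (a : R) X X' : hol H X -> hol H X' -> hol H (a%:C *: X + X').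
Proof.
move=> [Y [hY Y0 ->]] [Y' [hY' Y'0 ->]]; exists (fun z => a%:C *: Y z + Y' z); split => //.
  apply/holo_near_sphereP => i; under eq_fun do rewrite !mxE.
  apply: sholoD; last by move: i; apply/holo_near_sphereP.
  by apply: sholoM; [exact: sholo_cst|move: i; apply/holo_near_sphereP].
move=> z zS; have := Y0 z zS; have := Y'0 z zS.
have -> : bdot (a%:C *: Y z + Y' z) (conjv (H z)) =
    a%:C * bdot (Y z) (conjv (H z)) + bdot (Y' z) (conjv (H z)).
  rewrite /bdot mulr_sumr -big_split; apply: eq_bigr => i _.
  by rewrite !mxE mulrDl mulrA.
by case: (bdot _ _) => u v /= -> ; case: (bdot _ _) => u' v' /= ->; rewrite !(mulr0,mul0r) subrr addr0.
Qed.

Lemma has_skew_form0 : has_skew_form 0 (fun=> 0).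
Proof. by move=> t; rewrite skew_form0 big1// => i _; rewrite mxE mulr0 mul0r. Qed.

Lemma has_skew_form_lin (a : R) X X' f g : has_skew_form X f -> has_skew_form X' g ->
  has_skew_form (a%:C *: X + X') (fun t => a * f t + g t).
Proof.
move=> Xf Xg t; rewrite skew_form_lin -Xf -Xg mulr_sumr -big_split; apply: eq_bigr => i _.
by rewrite !mxE /=; ring.
Qed.

Lemma has_skew_form_ex X : hol H X -> exists f, has_skew_form X f.
Proof.
move=> [Y [/holo_near_sphereP hY Y0 ->]].
pose T i z := q z * Y z i 0.
have hT i : sholo (T i) by apply: sholoM.
have /choice[c cP] i := taylor n1 (hT i).
have Pim z : usphere z -> pairing T P z + Num.conj (pairing T P z) = 0.
  move=> zS; rewrite pairing_bdot// rmorphM /= rmorphM /= conjCK [Num.conj (q z) * _]mulrC -mulrDr.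
  by have /Re0_conj -> := Y0 z ((unit_sphereE z).2 zS); rewrite mulr0.
have WP := @pairing_imaginary_topform R n d m T P hT c (fun i r g sr => (cP i).2 r g sr)
  (fun i g j gj => (cP i).1 g j gj) Pim.
have [f fP] := skew_surj (ltnW n1) WP Pim.
by exists f => t; rewrite -fP//; apply: sphere_point.
Qed.

Lemma has_skew_form_inj X : hol H X -> has_skew_form X (fun=> 0) -> X = 0.
Proof.
move=> [Y [hY Y0 ->]] Yp; apply/funext => t; apply: (ndH hY); last exact: sphere_point.
move=> z zS; have [t' t'z] := sphere_lift zS; have := Yp t'; rewrite skew_form0 t'z.
rewrite -[LHS]/(pairing (fun i z => q z * Y z i 0) P z) pairing_bdot// => /eqP.
by rewrite !mulf_eq0 fmorph_eq0 orbb (negbTE (q0 zS)) => /eqP.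
Qed.

Lemma has_skew_form_uniq f : has_skew_form 0 f -> f = fun=> 0.
Proof.
move=> f0; apply: (skew_inj (ltnW n1)) => z zS; have [t <-] := sphere_lift zS.
by rewrite -f0 big1// => i _; rewrite mxE mulr0 mul0r.
Qed.

Lemma hol_basis : exists k (b : 'I_k -> S -> 'cV[R[i]]_m),
  real_basis (hol H) b /\ (k <= #|{: @topI n d}|)%N.
Proof. exact: exists_real_basis hol0 hol_lin has_skew_form0 has_skew_form_lin has_skew_form_ex has_skew_form_inj. Qed.

Lemma hol_full k (b : 'I_k -> S -> 'cV[R[i]]_m) : real_basis (hol H) b -> k = #|{: @topI n d}| ->
  forall f, exists2 X, hol H X & has_skew_form X f.
Proof. by move=> [Vb fb _]; apply: free_full Vb fb; [exact: hol0|exact: hol_lin|exact: has_skew_form0|exact: has_skew_form_lin|exact: has_skew_form_ex|exact: has_skew_form_inj]. Qed.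

Lemma hol_dim_full : (forall f, exists2 X, hol H X & has_skew_form X f) ->
  real_dim (hol H) = #|{: @topI n d}|%:R%:E.
Proof.
move=> surj; have [b /real_dimE] := full_basis hol0 hol_lin has_skew_form0 has_skew_form_lin has_skew_form_ex has_skew_form_inj surj has_skew_form_uniq.
exact.
Qed.

End Deformations.

(** By [pairing_skew_form] every imaginary form is attained. This serves both for H^d_n and for the
    maps unitarily equivalent to it. *)
Lemma spanning_dim (R : realType) n d m (H : 'cV[R[i]]_n -> 'cV[R[i]]_m)
    (P : 'I_m -> bmultinom n d.+1 -> R[i]) : (1 < n)%N ->
  (forall z, usphere z -> forall i, H z i 0 = \sum_b P i b * mon b z) ->
  nondeg H ->
  (forall b : bmultinom n d.+1, mdeg b = d -> exists w : 'I_m -> R[i],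
    forall z, usphere z -> mon b z = \sum_i w i * \sum_c P i c * mon c z) ->
  real_dim (hol H) = #|{: @topI n d}|%:R%:E.
Proof.
move=> n1 HE nd span; apply: (@hol_dim_full R n d m H P (fun=> 1)) => //.
- exact: sholo_cst.
- by move=> z zS i; rewrite HE// divr1.
move=> f; have [T [hT TP]] := pairing_skew_form span f.
exists (fun t => \col_i T i (set_val t)).
  exists (fun z => \col_i T i z); split => //.
    by apply/holo_near_sphereP => i; under eq_fun do rewrite mxE.
  move=> z /unit_sphereE zS; apply/Re0_conj; rewrite -(skew_conj f z) -TP//.
  have -> : bdot (\col_i T i z) (conjv (H z)) = pairing T P z; last by [].
  by apply: eq_bigr => i _; rewrite !mxE HE.
move=> t; rewrite -TP; last exact: sphere_point.
by apply: eq_bigr => i _; rewrite mxE mul1r.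
Qed.

(** * The homogeneous map *)

Section HomogeneousMap.
Context {R : realType} {n d : nat}.
Local Notation I := (bmultinom n d.+1).
Implicit Types (z w : 'cV[R[i]]_n).

(** The default [bm0] is never taken, as the k-th multiindex has length d ([hidxE]). *)
Definition hidx (k : 'I_(K n d)) : I :=
  insubd (bm0 : I) (Multinom [tuple of map val (tnth (multiindices n d) k)]).

Lemma multiindicesP (t : n.-tuple 'I_d.+1) :
  (t \in (multiindices n d : seq _)) = (\sum_(j <- t) j == d)%N.
Proof. by rewrite mem_sort mem_enum inE. Qed.

Lemma hidxE k : (hidx k : multinom n) = Multinom [tuple of map val (tnth (multiindices n d) k)].
Proof.
rewrite /hidx -[LHS]/(val _) val_insubd /= /mdeg /= big_map.
by have := mem_tnth k (multiindices n d); rewrite multiindicesP => /eqP ->; rewrite ltnSn.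
Qed.

Lemma mdeg_hidx k : mdeg (hidx k) = d.
Proof.
rewrite hidxE /mdeg /= big_map; apply/eqP; rewrite -multiindicesP; exact: mem_tnth.
Qed.

Lemma hidx_inj : injective hidx.
Proof.
move=> k l E.
have {}E : (hidx k : multinom n) = hidx l by rewrite E.
rewrite !hidxE in E; have /Multinom_val_inj {}E := E.
have u : uniq (multiindices n d) by rewrite sort_uniq enum_uniq.
by move/tuple_uniqP: u; apply.
Qed.

Lemma hidx_surj (b : I) : mdeg b = d -> exists k, hidx k = b.
Proof.
move=> bd.
have lt j : (b j < d.+1)%N by have := mnm_le_mdeg b j; lia.
pose t := [tuple Ordinal (lt j) | j < n].
have tb : Multinom [tuple of map val t] = b.
  by apply/mnmP => j; rewrite /fun_of_multinom /= tnth_map tnth_mktuple.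
have ts : t \in (multiindices n d : seq _).
  by rewrite multiindicesP; have := congr1 mdeg tb; rewrite bd {1}/mdeg /= big_map => ->.
have [k tk] := tnthP _ _ ts; exists k; apply: val_inj.
by rewrite -[LHS]/(bmnm _) hidxE -tk tb.
Qed.

Lemma sum_hidx (F : I -> R[i]) : \sum_(c : I | mdeg c == d) F c = \sum_k F (hidx k).
Proof.
transitivity (\sum_(c in [set hidx k | k in [set: 'I_(K n d)]]%SET) F c).
  apply: eq_bigl => c; apply/eqP/imsetP => [/hidx_surj[k <-]|[k _ ->]]; first by exists k.
  exact: mdeg_hidx.
rewrite big_imset /=; last by move=> ? ? _ _; apply: hidx_inj.
by apply: eq_bigl => k; rewrite inE.
Qed.

Definition mcoef (b : multinom n) : R[i] := d`!%:R / (\prod_(j < n) (b j)`!)%N%:R.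

Lemma mcoef_gt0 b : 0 < mcoef b.
Proof. by rewrite divr_gt0// ltr0n ?fact_gt0// prodn_gt0// => j; rewrite fact_gt0. Qed.

Lemma sqrt_mcoef_neq0 b : sqrtC (mcoef b) != 0.
Proof. by rewrite sqrtC_eq0 gt_eqF ?mcoef_gt0. Qed.

Lemma HhomE k z : Hhom n d z k 0 = sqrtC (mcoef (hidx k)) * mon (hidx k) z.
Proof.
rewrite mxE /mcoef /mon hidxE; congr (sqrtC (_ / _%:R) * _).
  by apply: eq_bigr => j _; rewrite /fun_of_multinom /= tnth_map.
by apply: eq_bigr => j _; rewrite /fun_of_multinom /= tnth_map.
Qed.

Lemma Hhom_span (b : I) : mdeg b = d -> exists w : 'I_(K n d) -> R[i],
  forall z, mon b z = \sum_k w k * Hhom n d z k 0.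
Proof.
move=> /hidx_surj[k <-]; exists (fun l => (sqrtC (mcoef (hidx l)))^-1 *+ (l == k)) => z.
rewrite (bigD1 k)//= eqxx mulr1n HhomE mulKf ?sqrt_mcoef_neq0// big1 ?addr0// => l lk.
by rewrite (negbTE lk) mulr0n mul0r.
Qed.

Definition hcoef k (b : I) : R[i] := sqrtC (mcoef (hidx k)) *+ (b == hidx k).

Lemma Hhom_coef k z : Hhom n d z k 0 = \sum_b hcoef k b * mon b z.
Proof.
rewrite HhomE (bigD1 (hidx k))//= /hcoef eqxx mulr1n big1 ?addr0// => b bk.
by rewrite (negbTE bk) mulr0n mul0r.
Qed.

Lemma Hhom_nondeg : (1 < n)%N -> nondeg (@Hhom R n d).
Proof.
move=> n1 Y /holo_near_sphereP hY Y0 z zS; apply/matrixP => k j; rewrite (ord1 j) mxE.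
apply: (@monomial_nondeg R n d _ (fun k => sqrtC (mcoef (hidx k))) hidx
  (fun k z => Y z k 0)) => //.
- by move=> l; apply: sqrt_mcoef_neq0.
- exact: mdeg_hidx.
- exact: hidx_inj.
- move=> w wS; rewrite -[RHS](Y0 w wS); apply: eq_bigr => l _.
  by rewrite [conjv _ _ _]mxE Hhom_coef.
Qed.

Lemma Hhom_dim : (1 < n)%N -> real_dim (hol (@Hhom R n d)) = #|{: @topI n d}|%:R%:E.
Proof.
move=> n1; apply: (spanning_dim (P := hcoef)) => //.
- by move=> z _ k; apply: Hhom_coef.
- exact: Hhom_nondeg.
- move=> b /Hhom_span[w wP]; exists w => z _; rewrite wP.
  by apply: eq_bigr => k _; rewrite -Hhom_coef.
Qed.

End HomogeneousMap.

(** * Linear changes of variables *)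

Section LinearSubstitution.
Context {R : realType} {n : nat}.
Implicit Types (z w : 'cV[R[i]]_n) (F : 'cV[R[i]]_n -> R[i]).

(** The identity is required on all of C^n, so that it can be evaluated at [W *m z]. *)
Definition homog D F := exists e : bmultinom n D.+1 -> R[i],
  forall z, F z = \sum_(c : bmultinom n D.+1 | mdeg c == D) e c * mon c z.

Lemma homog_sum D (J : Type) (s : seq J) (Q : pred J) (F : J -> 'cV[R[i]]_n -> R[i]) :
  (forall j, Q j -> homog D (F j)) -> homog D (fun z => \sum_(j <- s | Q j) F j z).
Proof.
move=> hF; elim: s => [|j s [e IH]].
  by exists (fun=> 0) => z; rewrite big_nil big1// => c _; rewrite mul0r.
have [Qj|nQ] := boolP (Q j); last by exists e => z; rewrite big_cons (negbTE nQ).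
have [e' E'] := hF j Qj; exists (fun c => e' c + e c) => z; rewrite big_cons Qj E' IH.
by rewrite -big_split; apply: eq_bigr => c _; rewrite mulrDl.
Qed.

Lemma homogZ D (a : R[i]) F : homog D F -> homog D (fun z => a * F z).
Proof.
move=> [e E]; exists (fun c => a * e c) => z.
by rewrite E mulr_sumr; apply: eq_bigr => c _; rewrite mulrA.
Qed.

Lemma homog_mon (b : multinom n) : homog (mdeg b) (mon b).
Proof.
exists (fun c => (c == BMultinom (ltnSn (mdeg b)))%:R) => z.
rewrite (bigD1 (BMultinom (ltnSn (mdeg b))))//= eqxx mul1r big1 ?addr0//.
by move=> c /andP[_ /negbTE ->]; rewrite mul0r.
Qed.

(** Induction on the degree: one variable z_j is split off and replaced by the linear form in row j
    of W. *)
Lemma homog_linear (W : 'M[R[i]]_n) (b : multinom n) : homog (mdeg b) (fun z => mon b (W *m z)).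
Proof.
move: {2}(mdeg b) (erefl (mdeg b)) => D; elim: D b => [|D IH] b bD; rewrite bD.
  have -> : b = mnm0 by apply/eqP; rewrite -mdeg_eq0 bD.
  have := homog_mon (@mnm0 n); rewrite mdeg0 => -[e eE]; exists e => z; rewrite -eE.
  by rewrite /mon; apply: eq_bigr => j _; rewrite mnm0E !expr0.
have [j bj] : exists j, (0 < b j)%N.
  apply: contrapT => /forallNP H; move: bD; rewrite mdegE big1// => j _.
  by have /negP := H j; rewrite -leqNgt leqn0 => /eqP.
pose b' := mnm_sub b (mnm1 j).
have bE : b = mnm_add b' (mnm1 j) by rewrite submK// lep1mP -lt0n.
have b'D : mdeg b' = D by move: bD; rewrite {1}bE mdegD mdeg1 addn1 => -[].
have [e eE] := IH b' b'D; rewrite b'D in e eE *.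
have H : homog D.+1 (fun z => \sum_(c : bmultinom n D.+1 | mdeg c == D) e c *
    \sum_k W j k * mon (mnm_add c (mnm1 k)) z).
  apply: homog_sum => c /eqP cD; apply: homogZ; apply: homog_sum => k _; apply: homogZ.
  have := homog_mon (mnm_add c (mnm1 k)); rewrite mdegD mdeg1 cD addn1; exact.
case: H => e' e'E; exists e' => z; rewrite -e'E bE monD eE mon1 mxE mulr_suml.
apply: eq_bigr => c _; rewrite -mulrA; congr (_ * _); rewrite mulr_sumr; apply: eq_bigr => k _.
by rewrite monD mon1; ring.
Qed.

End LinearSubstitution.

(** The inverses of U and W express each monomial of degree d through the components of H, so
    [spanning_dim] applies. *)
Lemma unitary_dim (R : realType) n d m (H : 'cV[R[i]]_n -> 'cV[R[i]]_m) : (1 < n)%N ->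
  nondeg H ->
  unitarily_equivalent d H -> real_dim (hol H) = #|{: @topI n d}|%:R%:E.
Proof.
move=> n1 nd [e [U [W [Uu Wu HE]]]].
case: m / e H nd U Uu HE => H nd U Uu HE.
have {}HE z : usphere z -> H z = U *m Hhom n d (W *m z).
  by move=> /unit_sphereE/HE; rewrite castmx_id.
have WU : W \in unitmx := unitarymx_unit Wu.
have UU : U \in unitmx := unitarymx_unit Uu.
have hH i : homog d (fun z => \sum_k U i k * (sqrtC (mcoef (d := d) (hidx k)) * mon (hidx k) (W *m z))).
  apply: homog_sum => k _; do 2 apply: homogZ.
  have := homog_linear W (hidx k); rewrite mdeg_hidx; exact.
have /choice[P PE] := hH.
have HP z i : usphere z -> H z i 0 = \sum_b (P i b *+ (mdeg b == d)) * mon b z.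
  move=> zS; rewrite HE// mxE; under eq_bigr do rewrite HhomE.
  rewrite PE big_mkcond; apply: eq_bigr => b _.
  by case: eqP => _; rewrite ?mulr1n// mulr0n mul0r.
apply: (spanning_dim (P := fun i b => P i b *+ (mdeg b == d))) => //.
  by move=> z zS i; apply: HP.
move=> b bd; have := homog_linear (invmx W) b; rewrite bd => -[f fE].
exists (fun i => \sum_k f (hidx k) / sqrtC (mcoef (d := d) (hidx k)) * invmx U k i) => z zS.
under eq_bigr do rewrite -HP// mulr_suml.
rewrite exchange_big /=; have := fE (W *m z); rewrite mulKmx// => ->; rewrite sum_hidx.
apply: eq_bigr => k _; under eq_bigr do rewrite -mulrA.
have -> : mon (hidx k) (W *m z) = (sqrtC (mcoef (d := d) (hidx k)))^-1 * Hhom n d (W *m z) k 0.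
  by rewrite HhomE mulKf// sqrt_mcoef_neq0.
rewrite -mulr_sumr mulrA; congr (_ * _).
by rewrite -[in LHS](mulKmx UU (Hhom n d (W *m z))) -HE// mxE.
Qed.

(** * Multinomial expansion *)

Section Multinomial.
Context {R : realType} {n : nat}.
Implicit Types (x : 'I_n -> R[i]) (a b c : multinom n).

Definition mfact b := (\prod_(j < n) (b j)`!)%N.

Lemma mfactS b j : mfact (mnm_add b (mnm1 j)) = ((b j).+1 * mfact b)%N.
Proof.
rewrite /mfact (bigD1 j)//= [in RHS](bigD1 j)//= mulnA -factS mnmDE mnm1E eqxx addn1.
by congr (_ * _)%N; apply: eq_bigr => k kj; rewrite mnmDE mnm1E eq_sym (negbTE kj) addn0.
Qed.

Lemma monomialS x b j :
  \prod_k x k ^+ (mnm_add b (mnm1 j)) k = x j * \prod_k x k ^+ b k.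
Proof.
rewrite (bigD1 j)//= [in RHS](bigD1 j)//= mulrA -exprS mnmDE mnm1E eqxx addn1.
by congr (_ * _); apply: eq_bigr => k kj; rewrite mnmDE mnm1E eq_sym (negbTE kj) addn0.
Qed.

Lemma multinomial d x : (\sum_j x j) ^+ d =
  \sum_(b : bmultinom n d.+1 | mdeg b == d) mcoef (d := d) b * \prod_j x j ^+ b j.
Proof.
elim: d => [|d IH].
  rewrite expr0 (big_pred1 bm0); last first.
    move=> b; rewrite mdeg_eq0; apply/eqP/eqP => [E|->//]; exact: val_inj.
  rewrite /mcoef fact0 !big1 ?divr1 ?mulr1// => j _; rewrite /= mnm0E//.
rewrite exprS IH mulr_suml.
transitivity (\sum_j \sum_(c : bmultinom n d.+2 | mdeg c == d.+1)
    ((c j)%:R * (d`!%:R / (mfact c)%:R)) * \prod_k x k ^+ c k); last first.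
  rewrite exchange_big /=; apply: eq_bigr => c /eqP cd.
  rewrite -mulr_suml -mulr_suml -natr_sum -mdegE cd /mcoef -/(mfact c) factS natrM mulrA//.
apply: eq_bigr => j _; rewrite mulr_sumr.
rewrite [RHS](bigID (fun c : bmultinom n d.+2 => (0 < c j)%N)) /= [X in _ = _ + X]big1 ?addr0; last first.
  by move=> c /andP[_]; rewrite lt0n negbK => /eqP ->; rewrite !mul0r.
have hP (b : bmultinom n d.+1) : (mdeg (mnm_add b (mnm1 j)) < d.+2)%N.
  by rewrite mdegD mdeg1 addn1 ltnS; have := mdegI b.
pose h (b : bmultinom n d.+1) : bmultinom n d.+2 := BMultinom (hP b).
pose h' (c : bmultinom n d.+2) : bmultinom n d.+1 := insubd bm0 (mnm_sub c (mnm1 j)).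
have h'E (c : bmultinom n d.+2) : (0 < c j)%N -> mdeg c = d.+1 ->
    mnm_add (h' c) (mnm1 j) = c :> multinom n.
  move=> cj cd; have cE : mnm_add (mnm_sub c (mnm1 j)) (mnm1 j) = c by rewrite submK// lep1mP -lt0n.
  have md : mdeg (mnm_sub c (mnm1 j)) = d.
    by have := congr1 mdeg cE; rewrite mdegD mdeg1 cd addn1 => -[].
  by rewrite /h' -[X in mnm_add X _]/(val _) val_insubd md ltnSn.
rewrite [RHS](reindex_onto h h') /=; last first.
  by move=> c /andP[/eqP cd cj]; apply: val_inj; rewrite /= h'E.
have hh (b : bmultinom n d.+1) : (0 < h b j)%N by rewrite /= mnmDE mnm1E eqxx addn1.
apply: eq_big => [b|b /eqP bd].
  rewrite [(0 < _)%N]hh andbT mdegD mdeg1 addn1 eqSS.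
  case: eqP => //= bd; apply/esym/eqP/val_inj => /=.
  have := h'E (h b) (hh b); rewrite /= mdegD mdeg1 addn1 bd => /(_ erefl) E.
  by apply/mnmP => k; have /mnmP/(_ k) := E; rewrite !mnmDE => /addIn.
rewrite monomialS mfactS mnmDE mnm1E eqxx addn1 natrM /mcoef -/(mfact b) mulrCA.
have b0 : (b j).+1%:R != 0 :> R[i] by rewrite pnatr_eq0.
have E (u v w : R[i]) : u != 0 -> v / w = u * (v / (u * w)).
  by move=> u0; rewrite invfM mulrCA mulVKf.
by rewrite -E.
Qed.

Lemma sphere_multinomial d (z : 'cV[R[i]]_n) : usphere z ->
  \sum_(b : bmultinom n d.+1 | mdeg b == d) mcoef (d := d) b * (mon b z * Num.conj (mon b z)) = 1.
Proof.
move=> zS; rewrite -[RHS](expr1n _ d) -(sphere_sum1 zS) multinomial; apply: eq_bigr => b _.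
congr (_ * _); rewrite /mon rmorph_prod -big_split; apply: eq_bigr => j _.
by rewrite exprMn rmorphXn.
Qed.

End Multinomial.

(** * Polynomials are determined by their values on the sphere *)

Section PolynomialCoefficients.
Context {R : realType} {n : nat}.
Implicit Types (z w u : 'cV[R[i]]_n) (r : 'I_n -> R).

Lemma mean_poly d (e : bmultinom n d.+1 -> R[i]) (a : bmultinom n d.+1) r : spos r ->
  mean (fun u => (\sum_b e b * mon b (ptor r u)) * chi (fun j => - mexp a j) u) =
  e a * (rpow r (mexp a))%:C.
Proof.
move=> sr.
rewrite (@mean_eq _ _ _ (fun u => \sum_b (e b * (rpow r (mexp b))%:C) *
    chi (fun j => mexp b j - mexp a j) u)); last first.
  move=> u tu; rewrite mulr_suml; apply: eq_bigr => b _.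
  by rewrite mon_ptor (chiD (mexp b) (fun j => - mexp a j) tu) !mulrA.
rewrite mean_sum; last first.
  by move=> b _; apply: cboundedM; [exact: cbounded_cst|exact: cbounded_chi].
rewrite (bigD1 a)//= meanZ ?mean_chi; last exact: cbounded_chi.
rewrite (_ : [forall j, _] = true) ?mulr1; last by apply/forallP => j; rewrite subrr.
rewrite big1 ?addr0// => b ba; rewrite meanZ ?mean_chi; last exact: cbounded_chi.
rewrite (_ : [forall j, _] = false) ?mulr0//; apply/negbTE; apply: contra ba => /forallP E.
apply/eqP/val_inj/mnmP => j; have /eqP := E j; rewrite /mexp /=; lia.
Qed.

(** One torus suffices: the Fourier coefficients on it are those of the polynomial up to positive
    factors. *)
Lemma peval_eq0 (p : mpoly n R[i]) : (0 < n)%N ->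
  (forall z, usphere z -> peval p z = 0) -> p = 0.
Proof.
move=> n0 p0; have [r sr] := @exists_spos R n n0.
have pd : (msize p <= (msize p).+1)%N by [].
apply/mpolyP => a; rewrite mcoeff0.
have [am|am] := leqP (msize p) (mdeg a); first by apply/memN_msupp_eq0/msize_mdeg_ge.
have am' : (mdeg a < (msize p).+1)%N by apply: leqW.
have := @mean_poly (msize p) (fun b => mcoeff b p) (BMultinom am') r sr.
rewrite (@mean_eq _ _ _ (fun=> 0)) ?mean_cst; last first.
  by move=> u tu; rewrite -peval_mon// p0 ?mul0r//; apply: usphere_ptor.
move=> /esym/eqP; rewrite mulf_eq0 => /orP[/eqP //|].
by rewrite fmorph_eq0 gt_eqF// rpow_gt0.
Qed.

Lemma peval_inj (p q : mpoly n R[i]) : (0 < n)%N ->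
  (forall z, usphere z -> peval p z = peval q z) -> p = q.
Proof.
move=> n0 pq; apply/eqP; rewrite -subr_eq0; apply/eqP; apply: peval_eq0 => // z zS.
by rewrite /peval mevalB -/(peval p z) -/(peval q z) pq// subrr.
Qed.

End PolynomialCoefficients.

(** * Rigidity *)

Section Rigidity.
Context {R : realType} {n d m : nat}.
Local Notation I := (bmultinom n d.+1).
Implicit Types (z w : 'cV[R[i]]_n).

Lemma topform_conj F : topform d F -> topform d (fun z : 'cV[R[i]]_n => Num.conj (F z)).
Proof.
move=> [c Fc]; exists (fun p => Num.conj (c (swapI p))) => z zS.
rewrite Fc// rmorph_sum (reindex_inj (inv_inj swapIK)) /=.
apply: eq_big => [p|p _]; first by rewrite topdeg_swap.
by rewrite rmorphM /= conj_bimon_swap.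
Qed.

Variables (H : 'cV[R[i]]_n -> 'cV[R[i]]_m) (P : 'I_m -> I -> R[i]).
Hypothesis n1 : (1 < n)%N.
Hypothesis HE : forall z, usphere z -> forall i, H z i 0 = \sum_b P i b * mon b z.
Hypothesis HS : forall z, usphere z -> \sum_i H z i 0 * Num.conj (H z i 0) = 1.
Hypothesis ndH : nondeg H.
Hypothesis surj : forall f : topI -> R, exists2 X, hol H X & has_skew_form P (fun=> 1) X f.

(** The hypothesis yields imaginary forms only; F is recovered from F - conj F and i (F + conj F),
    both imaginary, because T may be multiplied by complex constants. *)
Lemma pairing_topform F : topform d F -> paired P F.
Proof.
move=> WF; have WF' := topform_conj WF.
have lift G : topform d G -> (forall z, usphere z -> G z + Num.conj (G z) = 0) ->
    paired P G.
  move=> WG G0; have [f fG] := skew_surj (ltnW n1) WG G0.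
  have [X [Y [hY _ ->]] Xf] := surj f; exists (fun i z => Y z i 0); split.
    by move: hY => /holo_near_sphereP.
  move=> z zS; have [t tz] := sphere_lift zS; rewrite fG// -tz -Xf.
  by apply: eq_bigr => i _; rewrite mul1r.
have [A [hA AP]] : paired P (fun z => F z + (-1) * Num.conj (F z)).
  apply: lift => [|z zS]; first by apply: topformD => //; apply: topformZ.
  by rewrite rmorphD rmorphM /= conjCK rmorphN rmorph1; ring.
have [B [hB BP]] : paired P (fun z => 'i * (F z + Num.conj (F z))).
  apply: lift => [|z zS]; first by apply: topformZ; apply: topformD.
  by rewrite rmorphM /= conjCi rmorphD /= conjCK; ring.
exists (fun i z => 2^-1 * (A i z + (- 'i) * B i z)); split.
  by move=> i; do ?[exact: sholo_cst|exact: hA|exact: hB|apply: sholoM|apply: sholoD].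
move=> z zS; transitivity (2^-1 * (pairing A P z + (- 'i) * pairing B P z)).
  by rewrite /pairing mulr_sumr -big_split mulr_sumr; apply: eq_bigr => i _ /=; ring.
have iiX (X : R[i]) : - 'i * ('i * X) = X by rewrite mulrA mulNr -expr2 sqrCi opprK mul1r.
rewrite AP// BP// iiX mulN1r addrACA addNr addr0.
by rewrite -mulr2n -[F z *+ 2]mulr_natl mulKf// pnatr_eq0.
Qed.

(* Some T b pairs with H to conj(z^b). By nondegeneracy and the multinomial
   expansion of 1 = (sum_j |z_j|^2)^d, H is the combination of the z^b T b with
   |b| = d, which has no Taylor coefficient of degree less than d. *)
Lemma lower_coef_eq0 i (a : I) : (mdeg a < d)%N -> P i a = 0.
Proof.
move=> ad.
have /choice[T TP] : forall b : I, paired P (fun z => Num.conj (mon b z)).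
  move=> b; apply: pairing_topform; apply: (topform_eq _ (@topform_mon R n d mnm0 b _ (mdegI b))).
    by move=> z _; rewrite [mon mnm0 z]big1 ?mul1r// => j _; rewrite mnm0E expr0.
  by rewrite mdeg0.
have hT b j : sholo (T b j) := (TP b).1 j.
(* Paired with conj H, the first sum gives |H|^2 = 1 and the second the multinomial expansion of
   1. *)
pose Y z : 'cV[R[i]]_m := \col_j (\sum_b P j b * mon b z +
  (-1) * \sum_(b : I | mdeg b == d) mcoef (d := d) b * (mon b z * T b j z)).
have hY : holo_near_sphere Y.
  apply/holo_near_sphereP => j; under eq_fun do rewrite mxE.
  apply: sholoD; first by apply: sholo_sum => b; apply: sholoM; [exact: sholo_cst|exact: sholo_mon].
  apply: sholoM; first exact: sholo_cst.
  apply: sholo_sum => b; apply: sholoM; first exact: sholo_cst.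
  by apply: sholoM; first exact: sholo_mon.
have Y0 z : usphere z -> Y z = 0.
  move=> zS; apply: (ndH hY) => // {zS}z zS.
  transitivity (\sum_j H z j 0 * Num.conj (H z j 0) -
    \sum_(b : I | mdeg b == d) mcoef (d := d) b * (mon b z * pairing (T b) P z)); last first.
    rewrite HS//; under eq_bigr do rewrite (TP _).2//.
    by rewrite sphere_multinomial// subrr.
  under [X in _ = _ - X]eq_bigr do rewrite /pairing mulr_sumr mulr_sumr.
  rewrite [X in _ = _ - X]exchange_big -sumrB; apply: eq_bigr => j _.
  rewrite !mxE -HE// mulrDl mulN1r mulNr; congr (_ - _).
  by rewrite mulr_suml; apply: eq_bigr => b _; rewrite HE//; ring.
have [r sr] := @exists_spos R n (ltnW n1).
have /choice[c cP] b := taylor n1 (hT b i).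
have key : mean (fun u => (\sum_b P i b * mon b (ptor r u)) * chi (fun j => - mexp a j) u) =
    mean (fun u => \sum_(b : I | mdeg b == d) (mcoef (d := d) b * (rpow r (mexp b))%:C) *
      (T b i (ptor r u) * chi (fun j => - (mexp a j - mexp b j)) u)).
  apply: mean_eq => u tu.
  have := congr1 (fun v : 'cV[R[i]]_m => v i 0) (Y0 _ (usphere_ptor sr tu)).
  rewrite !mxE mulN1r => /eqP; rewrite subr_eq0 => /eqP ->.
  rewrite mulr_suml; apply: eq_bigr => b _; rewrite mon_ptor.
  rewrite (_ : (fun j => - (mexp a j - mexp b j)) = fun j => mexp b j + - mexp a j); last first.
    by apply/funext => j; rewrite opprB.
  by rewrite (chiD (mexp b) (fun j => - mexp a j) tu); ring.
have bT b g : cbounded (fun u => T b i (ptor r u) * chi g u).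
  by apply: cboundedM; [exact: ccont_cbounded (sholo_ccont (hT b i)) sr|exact: cbounded_chi].
have : mean (fun u => (\sum_b P i b * mon b (ptor r u)) * chi (fun j => - mexp a j) u) = 0.
  rewrite key mean_sum; last by move=> b _; apply: cboundedM => //; exact: cbounded_cst.
  apply: big1 => b /eqP bd.
  (* As |a| < d = |b|, the exponent a - b has a negative entry, where the Taylor coefficients of
     [T b] vanish. *)
  have [j aj] : exists j, (a j < b j)%N.
    apply: contrapT => /forallNP H0; suff : (mdeg b <= mdeg a)%N by rewrite bd leqNgt ad.
    by rewrite !mdegE leq_sum// => j _; have /negP := H0 j; rewrite -leqNgt.
  by rewrite meanZ// (cP b).2// ((cP b).1 _ j) ?mul0r ?mulr0// subr_lt0 ltz_nat.
rewrite mean_poly// => /eqP; rewrite mulf_eq0 => /orP[/eqP //|].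
by rewrite fmorph_eq0 gt_eqF// rpow_gt0.
Qed.

(** Both |H|^2 and (sum_j |z_j|^2)^d are combinations of the products with max(|a|, |b|) = d, the
    former by [lower_coef_eq0], and [bimon_indep] identifies their coefficients. *)
Lemma gram_coef (a b : I) : mdeg a = d -> mdeg b = d ->
  \sum_i P i a * Num.conj (P i b) = mcoef (d := d) a *+ (a == b).
Proof.
move=> ad bd.
pose D (p : I * I) : R[i] := mcoef (d := d) p.1 *+ ((mdeg p.1 == d) && (p.1 == p.2)).
have := @bimon_indep R n d (fun p => \sum_i P i p.1 * Num.conj (P i p.2) - D p) (ltnW n1).
move=> /(_ _ (a, b)); rewrite /topdeg /= ad bd maxnn => /(_ _ (eqxx _)) H0.
apply/eqP; rewrite -subr_eq0; apply/eqP; rewrite -[RHS]H0; last first.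
  move=> z zS; under eq_bigr do rewrite mulrBl.
  rewrite sumrB; apply/eqP; rewrite subr_eq0; apply/eqP.
  transitivity (1 : R[i]).
    rewrite -(HS zS) big_mkcond /=.
    transitivity (\sum_(p : I * I) (\sum_i P i p.1 * Num.conj (P i p.2)) * bimon p z).
      apply: eq_bigr => p _; case: ifP => // tp.
      rewrite big1 ?mul0r// => i _; rewrite lower_coef_eq0 ?mul0r//.
      by move: tp; have := mdegI p.1; have := mdegI p.2; lia.
    transitivity (\sum_i \sum_(p : I * I) P i p.1 * Num.conj (P i p.2) * bimon p z).
      by rewrite exchange_big; apply: eq_bigr => p _; rewrite mulr_suml.
    apply: eq_bigr => i _.
    rewrite HE// rmorph_sum big_distrlr /= pair_big /=; apply: eq_bigr => p _.
    by rewrite rmorphM /bimon /=; ring.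
  rewrite -(sphere_multinomial d zS) [LHS]big_mkcond [RHS]big_mkcond /=.
  rewrite (eq_bigr (fun p : I * I => (fun a b : I =>
    if topdeg (a, b) then D (a, b) * bimon (a, b) z else 0) p.1 p.2)); last by case.
  rewrite -(pair_bigA _ (fun a b : I =>
    if topdeg (a, b) then D (a, b) * bimon (a, b) z else 0)) /=.
  apply: eq_bigr => c _; rewrite (bigD1 c)//= big1 ?addr0 => [|e ec].
    by rewrite /topdeg /= maxnn /D /= eqxx andbT; case: eqP => // _; rewrite mulr1n.
  have ce : c == e = false by rewrite eq_sym (negbTE ec).
  by rewrite /D /= ce andbF mulr0n mul0r if_same.
by rewrite /D /= ad eqxx.
Qed.

End Rigidity.

(** The columns of U are orthonormal, so K <= m. A nonzero row v with v conj(U) = 0 would be a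
    constant map with v . conj(H) = 0, which nondegeneracy excludes; hence m <= K and U is square
    and unitary. *)
Lemma isometry_unitarily_equivalent (R : realType) n d m (H : 'cV[R[i]]_n -> 'cV[R[i]]_m)
    (U : 'M[R[i]]_(m, K n d)) : (0 < n)%N ->
  (forall z, usphere z -> H z = U *m Hhom n d z) ->
  U^T *m map_mx Num.conj U = 1%:M ->
  nondeg H ->
  unitarily_equivalent d H.
Proof.
move=> n0 HU UU nd.
have le1 : (K n d <= m)%N.
  have : row_free U^T by apply/row_freeP; exists (map_mx Num.conj U).
  by move=> /eqP <-; apply: rank_leq_col.
have le2 : (m <= K n d)%N.
  suff : row_free (map_mx Num.conj U) by move=> /eqP <-; apply: rank_leq_col.
  rewrite -kermx_eq0; apply/eqP/matrixP => p j; rewrite [RHS]mxE.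
  pose v : 'cV[R[i]]_m := \col_j kermx (map_mx Num.conj U) p j.
  have [r sr] := @exists_spos R n n0.
  have zS : usphere (ptor r (const_mx 1)).
    by apply: usphere_ptor => // k; rewrite mxE normc_real normr1.
  have : v = 0.
    apply: (nd (fun=> v) _ _ _ zS).
      by apply/holo_near_sphereP => k; exact: sholo_cst.
    move=> z {}zS; rewrite /bdot.
    transitivity (\sum_k (kermx (map_mx Num.conj U) *m map_mx Num.conj U) p k * Num.conj (Hhom n d z k 0)).
      under [RHS]eq_bigr do rewrite [X in X * _]mxE mulr_suml.
      rewrite exchange_big /=; apply: eq_bigr => k _.
      rewrite [v k 0]mxE [conjv _ _ _]mxE HU// [(U *m _) k 0]mxE rmorph_sum mulr_sumr.
      by apply: eq_bigr => l _; rewrite rmorphM [map_mx _ _ _ _]mxE mulrA.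
    by rewrite mulmx_ker big1// => k _; rewrite mxE mul0r.
  by move=> /matrixP/(_ j 0); rewrite !mxE.
have e : K n d = m by apply/eqP; rewrite eqn_leq le1 le2.
case: m / e H U HU UU nd le1 le2 => H U HU UU _ _ _.
exists (erefl _), U, 1%:M; split.
- apply/unitarymxP; have := mulmx1C UU => /(congr1 (map_mx Num.conj)).
  rewrite map_mxM map_mx1 -map_mx_comp; congr (_ *m _ = _).
  by apply/matrixP => i j; rewrite mxE /= conjCK.
- by apply/unitarymxP; rewrite mul1mx trmx1 map_mx1.
- by move=> z /unit_sphereE zS; rewrite castmx_id mul1mx HU.
Qed.

(** Dividing the coefficient vectors of H by the square roots of the multinomial coefficients gives
    the columns of U, and [gram_coef] becomes their orthonormality. *)
Lemma full_unitarily_equivalent (R : realType) n d m (H : 'cV[R[i]]_n -> 'cV[R[i]]_m)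
    (P : 'I_m -> bmultinom n d.+1 -> R[i]) : (1 < n)%N ->
  (forall z, usphere z -> forall i, H z i 0 = \sum_b P i b * mon b z) ->
  (forall z, usphere z -> \sum_i H z i 0 * Num.conj (H z i 0) = 1) ->
  nondeg H ->
  (forall f : topI -> R, exists2 X, hol H X & has_skew_form P (fun=> 1) X f) ->
  unitarily_equivalent d H.
Proof.
move=> n1 HE HS nd surj.
pose s (k : 'I_(K n d)) : R[i] := sqrtC (mcoef (d := d) (hidx k)).
have s0 k : s k != 0 by exact: sqrt_mcoef_neq0.
have sK k : s k * Num.conj (s k) = mcoef (d := d) (hidx k).
  have sr : Num.conj (s k) = s k by apply: geC0_conj; rewrite sqrtC_ge0 ltW// mcoef_gt0.
  by rewrite sr -expr2 sqrtCK.
apply: (@isometry_unitarily_equivalent R n d m H (\matrix_(i, k) (P i (hidx k) / s k))) => //.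
- exact: ltnW.
- move=> z zS; apply/matrixP => i j; rewrite (ord1 j) mxE HE//.
  rewrite (bigID (fun b : bmultinom n d.+1 => mdeg b == d)) /= [X in _ + X]big1 ?addr0; last first.
    move=> b bd; rewrite (lower_coef_eq0 n1 HE HS nd surj) ?mul0r//.
    by have := mdegI b; lia.
  rewrite sum_hidx; apply: eq_bigr => k _.
  by rewrite mxE HhomE mulrA divfK.
- apply/matrixP => k l; rewrite !mxE.
  transitivity ((\sum_i P i (hidx k) * Num.conj (P i (hidx l))) / (s k * Num.conj (s l))).
    rewrite mulr_suml; apply: eq_bigr => i _; rewrite !mxE rmorphM /= fmorphV invfM.
    by ring.
  rewrite (gram_coef n1 HE HS nd surj (mdeg_hidx k) (mdeg_hidx l)).
  rewrite (inj_eq (@hidx_inj n d)); case: eqP => [->|_]; last by rewrite mulr0n mul0r.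
  by rewrite mulr1n sK divff// gt_eqF// mcoef_gt0.
Qed.

Section Polynomials.
Context {R : realType} {n : nat}.

Lemma sholo_peval (p : mpoly n R[i]) : sholo (peval p).
Proof.
have -> : peval p = fun z => \sum_(b : bmultinom n (msize p).+1) mcoeff b p * mon b z.
  by apply/funext => z; apply: peval_mon.
by apply: sholo_sum => b; apply: sholoM; [exact: sholo_cst|exact: sholo_mon].
Qed.

Lemma pdeg_msize (p : mpoly n R[i]) d : (pdeg p <= d)%N -> (msize p <= d.+1)%N.
Proof. by rewrite /pdeg; case: (msize p). Qed.

Lemma holo_nondegenerate_nondeg m (H : 'cV[R[i]]_n -> 'cV[R[i]]_m) : holo_nondegenerate H ->
  nondeg H.
Proof.
move=> nd Y hY Y0 z zS; apply: contrapT => Yz; apply: nd; exists Y; split => //.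
  by exists z; [exact/unit_sphereE|exact/eqP].
by move=> w /unit_sphereE; apply: Y0.
Qed.

(** P_i = Q P'_i holds on the sphere, hence between polynomials, so lowest terms force Q to be
    constant. The coefficients are taken from P / Q because the degree bound d is known for P. *)
Lemma polynomial_denominator m d (H : 'cV[R[i]]_n -> 'cV[R[i]]_m) : (0 < n)%N ->
  rational_sphere_map d H -> polynomial_map H ->
  exists P : 'I_m -> bmultinom n d.+1 -> R[i],
    forall z, usphere z -> forall i, H z i 0 = \sum_b P i b * mon b z.
Proof.
move=> n0 [P [Q [low Q0 HE _ dE]]] [P' HE'].
have PQ i : P i = Q * P' i.
  apply: peval_inj => // z /unit_sphereE zS; rewrite /peval mevalM -/(peval Q z) -/(peval _ z) -/(peval _ z).
  have := congr1 (fun v : 'cV[R[i]]_m => v i 0) (HE z zS).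
  by rewrite HE'// !mxE => ->; rewrite mulrC divfK// Q0.
have Qdeg : pdeg Q = 0%N.
  by apply: low => [i|]; [exists (P' i)|exists 1; rewrite mulr1].
have Qc : Q = mpolyC n (mcoeff mnm0 Q) by apply: msize1_polyC; apply: pdeg_msize; rewrite Qdeg.
exists (fun i b => mcoeff b (P i) / mcoeff mnm0 Q) => z zS i.
have PE : peval (P i) z = \sum_(b : bmultinom n d.+1) mcoeff b (P i) * mon b z.
  apply: peval_mon; apply: pdeg_msize; rewrite dE leq_max; apply/orP; left.
  exact: leq_bigmax.
rewrite HE ?mxE; last exact/unit_sphereE.
rewrite PE [in peval Q z]Qc [X in _ / X]mevalC mulr_suml.
by apply: eq_bigr => b _; rewrite mulrAC.
Qed.

End Polynomials.

Theorem theorem2 (R : realType) (n m d : nat)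
    (hn : (2 <= n)%N) (hm : (1 <= m)%N) (hd : (1 <= d)%N)
    (H : 'cV[R[i]]_n -> 'cV[R[i]]_m)
    (Hrat : rational_sphere_map d H) (Hnd : holo_nondegenerate H) :
  [/\ (real_dim (hol H) <= real_dim (hol (@Hhom R n d)))%E,
      real_dim (hol (@Hhom R n d)) =
        ((2 * d + n)%N%:R / n%:R * (K n d)%:R ^+ 2)%:E
    & polynomial_map H ->
      (real_dim (hol H) = real_dim (hol (@Hhom R n d)) <->
       unitarily_equivalent d H)].
Proof.
have nd := holo_nondegenerate_nondeg Hnd.
rewrite Hhom_dim//; split.
- have [P [Q [_ Q0 HE _ dE]]] := Hrat.
  have [|||k [b [kb kN]]] := @hol_basis R n d m H (fun i b => mcoeff b (P i)) (peval Q) hn _ _ _ nd.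
  + exact: sholo_peval.
  + by move=> z /unit_sphereE; apply: Q0.
  + move=> z zS i; rewrite HE ?mxE; last exact/unit_sphereE.
    congr (_ / _); apply: peval_mon; apply: pdeg_msize; rewrite dE leq_max; apply/orP; left.
    exact: leq_bigmax.
  by rewrite (real_dimE kb) lee_fin ler_nat.
- by rewrite card_topI_eq// ltnW.
move=> Hpoly; split; last exact: unitary_dim.
have [P HE] := polynomial_denominator (ltnW hn) Hrat Hpoly.
(* A polynomial H is treated with denominator 1, the form required by
   [full_unitarily_equivalent]. *)
have q0 (z : 'cV[R[i]]_n) : usphere z -> (1 : R[i]) != 0 by move=> _; exact: oner_neq0.
have HE1 z : usphere z -> forall i, H z i 0 = (\sum_b P i b * mon b z) / 1.
  by move=> zS i; rewrite divr1 HE.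
have [k [b [kb _]]] := hol_basis hn (sholo_cst 1) q0 HE1 nd.
rewrite (real_dimE kb) => -[/eqP]; rewrite eqr_nat => /eqP kN.
have surj := hol_full hn (sholo_cst 1) q0 HE1 nd kb kN.
apply: (full_unitarily_equivalent hn HE _ nd surj) => z /unit_sphereE zS.
have [P0 [Q0 [_ _ _ HS _]]] := Hrat.
by rewrite -[RHS](HS z zS); apply: eq_bigr => i _; rewrite normCK.
Qed.
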